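(* Let $p>2$, $f\ge1$, $q=p^f$, $k=(k_0,\dots,k_{f-1})$ with $r_i=k_i-2>q+p-2$ for all $i$, and $r=\sum_ir_ip^i\not\equiv 0,1,p,\dots,p^{f-1}\pmod{q-1}$. Let $a_p$ lie in a finite extension of $\mathbb{Q}_{p^f}$ with $v(a_p)\in(0,1)$. Then the natural surjection $\mathrm{ind}_{KZ}^G\mathrm{cosoc}(Q)\twoheadrightarrow F_t$ vanishes on $T(\mathrm{ind}_{KZ}^G\mathrm{cosoc}(Q))$, i.e. it factors through $T$.
   Context: Setting: $\mathbb{Q}_{p^f}$ unramified of degree $f$ over $\mathbb{Q}_p$, ring of integers $\mathbb{Z}_{p^f}$, residue field $\mathbb F_q$, Teichmüller lifts $[\lambda]$; $G=\mathrm{GL}_2(\mathbb{Q}_{p^f})$, $K=\mathrm{GL}_2(\mathbb{Z}_{p^f})$, $Z$ the center, $\Gamma=\mathrm{GL}_2(\mathbb F_q)$, $v(p)=1$. For a ring $R$, $V(R)=\bigotimes_{i=0}^{f-1}\mathrm{Sym}^{r_i}R^2$ is modeled on polynomials homogeneous of degree $r_i$ in $(X_i,Y_i)$; $\begin{pmatrix}a&b\\c&d\end{pmatrix}\in K$ acts by $v\mapsto v(a^{\sigma^i}X_i+c^{\sigma^i}Y_i,b^{\sigma^i}X_i+d^{\sigma^i}Y_i)$ ($\sigma$ Frobenius), $p\in Z$ acts trivially. $[g,v]\in\mathrm{ind}_{KZ}^GV$ is supported on $KZg^{-1}$ with $g'\mapsto g'g\cdot v$. Hecke operator: $T([g,v])=\sum_{\lambda\in\mathbb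 F_q}[g\begin{pmatrix}p&[\lambda]\\0&1\end{pmatrix},v(X_i,(-[\lambda])^{p^i}X_i+pY_i)]+[g\begin{pmatrix}1&0\\0&p\end{pmatrix},v(pX_i,Y_i)]$; on the induction of a mod $p$ weight $\bigotimes\mathrm{Sym}^{s_i}\bar{\mathbb F}_p^2\otimes\det^m$, $T$ is given by the reduced formula $T([g,v])=\sum_\lambda[g\begin{pmatrix}p&[\lambda]\\0&1\end{pmatrix},v(X_i,(-\lambda)^{p^i}X_i)]+[g\begin{pmatrix}1&0\\0&p\end{pmatrix},v(0,Y_i)]$. For $a_p$ in a finite extension $E$ of $\mathbb{Q}_{p^f}$ (ring of integers $\mathcal O_E$, residue field $k_E$): $\Pi_{k,a_p}=\mathrm{ind}_{KZ}^GV(E)/(T-a_p)$, $\Theta_{k,a_p}$ = image of $\mathrm{ind}_{KZ}^GV(\mathcal O_E)$ in it, $\bar\Theta_{k,a_p}=\Theta_{k,a_p}\otimes k_E$; there is a natural surjection $\mathrm{ind}_{KZ}^GV_r\twoheadrightarrow\bar\Theta_{k,a_p}$ with $V_r=V(\bar{\mathbb F}_p)$. Let $\theta_i=X_iY_{i-1}^p-Y_iX_{i-1}^p$ (indices mod $f$), $V_r^*$ the subspace of $V_r$ of elements $\sum_i\theta_iP_i$, $X_r$ the $\Gamma$-submodule generated by $\prod_iX_i^{r_i}$, and $Q=V_r/(V_r^*+X_r)$; under the hypotheses the surjection factors through $\mathrm{ind}_{KZ}^GQ\twoheadrightarrow\bar\Theta_{k,a_p}$. Let $Q_1=\mathrm{soc}(Q)\subset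 Q_2\subset\cdots$ be the socle filtration ($Q_{i+1}/Q_i=\mathrm{soc}(Q/Q_i)$), with $Q_f=Q$ as in the paper, $\mathrm{cosoc}(Q):=Q_f/Q_{f-1}$, $F_i$ the image of $\mathrm{ind}_{KZ}^GQ_i$ in $\bar\Theta_{k,a_p}$, and $F_t=F_f/F_{f-1}$; the map $\mathrm{ind}_{KZ}^G\mathrm{cosoc}(Q)\twoheadrightarrow F_t$ is the induced surjection. *)

(* Defs.v *)
From HB Require Import structures.
From mathcomp Require Import all_boot all_order all_algebra all_field.
From mathcomp.multinomials Require Import mpoly.

Set Implicit Arguments.
Unset Strict Implicit.
Unset Printing Implicit Defensive.

Import Order.TTheory GRing.Theory Num.Theory.
Local Open Scope ring_scope.

Section Valuations.
Variables (F : fieldType) (D : realDomainType) (v : F -> D).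

(* v is written additively and is meaningful on nonzero elements only;
   [val_ge N x] means v(x) >= N with the convention v(0) = +oo. *)
Definition val_ge (N : D) (x : F) : bool := (x == 0) || (N <= v x).

Definition is_valuation : Prop :=
  (forall x y, x != 0 -> y != 0 -> v (x * y) = v x + v y) /\
  (forall N x y, val_ge N x -> val_ge N y -> val_ge N (x + y)).

Definition v_integral (x : F) : bool := val_ge 0 x.
Definition v_maximal (x : F) : bool := (x == 0) || (0 < v x).

(* red induces an injective ring morphism from (valuation ring)/(maximal
   ideal) to k; its values outside the valuation ring are irrelevant. *)
Definition is_reduction (k : fieldType) (red : F -> k) : Prop :=
  [/\ red 1 = 1,
      forall x y, v_integral x -> v_integral y -> red (x + y) = red x + red y,
      forall x y, v_integral x -> v_integral y -> red (x * y) = red x * red y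
    & forall x, v_integral x -> (red x == 0) = v_maximal x].

Definition v_complete : Prop :=
  forall u : nat -> F,
    (forall N, exists n0, forall m n, (n0 <= m)%N -> (n0 <= n)%N ->
       val_ge N (u m - u n)) ->
    exists l, forall N, exists n0, forall n, (n0 <= n)%N -> val_ge N (u n - l).
End Valuations.

(* (F, v) is the completion of the rational numbers for the p-adic valuation. *)
Definition is_Qp (p : nat) (F : fieldType) (v : F -> int) : Prop :=
  [/\ is_valuation v,
      forall n : nat, (0 < n)%N -> n%:R != 0 :> F /\ v n%:R = (logn p n)%:Z,
      forall (x : F) (N : int), exists a : rat, val_ge v N (x - ratr a)
    & v_complete v].

(* The unramified extension of degree f of Q_p.  An extension of the
   valuation of Q_p with values in Z again has p as a uniformizer, i.e. the
   ramification index is 1.  The Frobenius and the Teichmuller lifts are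
   determined by their defining properties. *)
Record unramified (p f : nat) := Unramified {
  Qp : fieldType;
  vQp : Qp -> int;
  Qp_spec : is_Qp p vQp;
  Qpf : fieldExtType Qp;
  Qpf_dim : \dim {:Qpf} = f;
  vK : Qpf -> int;
  vK_spec : is_valuation vK;
  vK_extends : forall x : Qp, x != 0 -> vK x%:A = vQp x;
  Fq : finFieldType;
  Fq_card : #|Fq| = (p ^ f)%N;
  redK : Qpf -> Fq;
  redK_spec : is_reduction vK redK;
  redK_surj : forall a : Fq, exists2 x, v_integral vK x & redK x = a;
  teich : Fq -> Qpf;
  teich_spec : forall a : Fq,
    [/\ v_integral vK (teich a), redK (teich a) = a
      & teich a ^+ (p ^ f) = teich a];
  frob : {lrmorphism Qpf -> Qpf};
  frob_spec : forall x, v_integral vK x -> v_maximal vK (frob x - x ^+ p)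
}.

(* A finite extension E of Q_{p^f}, with the valuation normalized by
   v(p) = 1, an algebraic closure kbar of F_q, and an embedding of the residue
   field of E into kbar, given as the composite redE : O_E -> k_E -> kbar. *)
Record coefficients (p f : nat) (S : unramified p f) := Coefficients {
  E : fieldExtType (Qpf S);
  vE : E -> rat;
  vE_spec : is_valuation vE;
  vE_extends : forall x : Qpf S, x != 0 -> vE x%:A = (vK x)%:~R;
  kbar : closedFieldType;
  Fq_kbar : {rmorphism Fq S -> kbar};
  kbar_algebraic : forall x : kbar, algebraicOver Fq_kbar x;
  redE : E -> kbar;
  redE_spec : is_reduction vE redE;
  redE_compat : forall x : Qpf S,
    v_integral (@vK _ _ S) x -> redE x%:A = Fq_kbar (redK x)
}.

Section Polynomials.
Variables (f : nat) (R : comNzRingType).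

Definition pol := {mpoly R[f + f]}.
Definition Xv (i : 'I_f) : pol := 'X_(lshift f i).
Definition Yv (i : 'I_f) : pol := 'X_(rshift f i).

(* v(PX_i, PY_i) *)
Definition subst (PX PY : 'I_f -> pol) (v : pol) : pol :=
  v \mPo [tuple match split j with inl i => PX i | inr i => PY i end | j < f + f].

(* V(R), the tensor product of the Sym^(r_i) R^2 *)
Definition V (r : 'I_f -> nat) (v : pol) : Prop :=
  forall m, m \in msupp v ->
    forall i, (m (lshift f i) + m (rshift f i))%N = r i.

(* (a b; c d) sends v to v(e_i(a) X_i + e_i(c) Y_i, e_i(b) X_i + e_i(d) Y_i) *)
Definition act (A : Type) (e : 'I_f -> A -> R) (g : 'M[A]_2) (v : pol) : pol :=
  subst (fun i => e i (g 0 0) *: Xv i + e i (g 1 0) *: Yv i)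
        (fun i => e i (g 0 1) *: Xv i + e i (g 1 1) *: Yv i) v.
End Polynomials.

Section Induction.
Variables (p f : nat) (S : unramified p f).
Local Notation L := (Qpf S).
Local Notation vL := (@vK p f S).

Definition mx2 (a b c d : L) : 'M[L]_2 :=
  \matrix_(i, j) if i == 0 then if j == 0 then a else b
                 else if j == 0 then c else d.

Definition inG (g : 'M[L]_2) : bool := g \in unitmx.

Definition inK (g : 'M[L]_2) : bool :=
  [&& [forall i, forall j, v_integral vL (g i j)], \det g != 0
    & vL (\det g) == 0].

(* Z = p^Z (Z cap K), so every element of KZ is p^n k with k in K and
   n = v(det)/2; Kpart returns k.  Since p acts trivially, p^n k acts as k. *)
Definition Kpart (g : 'M[L]_2) : 'M[L]_2 :=
  (p%:R ^ (- (vL (\det g) %/ 2)%Z)) *: g.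
Definition inKZ (g : 'M[L]_2) : bool := inG g && inK (Kpart g).

Variable R : comNzRingType.
Local Notation P := (pol f R).
(* Functions on G are extended by 0 to all matrices. *)
Local Notation fn := ('M[L]_2 -> P).
(* ac is an action of K; only its values on K matter. *)
Variable ac : 'M[L]_2 -> P -> P.

Definition ind (M : P -> Prop) (h : fn) : Prop :=
  [/\ forall g, M (h g),
      forall g, ~~ inG g -> h g = 0,
      forall k g, inKZ k -> inG g -> h (k *m g) = ac (Kpart k) (h g)
    & exists s : seq 'M[L]_2,
        forall g, h g != 0 -> has (fun g0 => inKZ (g *m invmx g0)) s].

(* [g, v] *)
Definition elt (g : 'M[L]_2) (v : P) : fn :=
  fun g' => if inKZ (g' *m g) then ac (Kpart (g' *m g)) v else 0.

(* The argument t is the Teichmuller lift when R = E, and the inclusion of F_q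
   when R = kbar; in the latter case p%:R = 0 and this is the reduced formula. *)
Definition hecke_elt (t : Fq S -> R) (g : 'M[L]_2) (v : P) : fn :=
  fun g' =>
    \sum_(a : Fq S)
      elt (g *m mx2 p%:R (teich a) 0 1)
          (subst (@Xv f R)
             (fun i => (- t a) ^+ (p ^ i) *: Xv R i + p%:R *: Yv R i) v) g'
    + elt (g *m mx2 1 0 0 p%:R)
          (subst (fun i => p%:R *: Xv R i) (@Yv f R) v) g'.

(* T h = h', where T is the additive extension of hecke_elt to ind M *)
Definition hecke (t : Fq S -> R) (M : P -> Prop) (h h' : fn) : Prop :=
  exists s : seq ('M[L]_2 * P),
    [/\ forall c, c \in s -> inG c.1 /\ M c.2,
        h =1 (fun g' => \sum_(c <- s) elt c.1 c.2 g')
      & h' =1 (fun g' => \sum_(c <- s) hecke_elt t c.1 c.2 g')].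
End Induction.

Section Reduction.
Variables (p f : nat) (S : unramified p f) (C : coefficients S).
Variable r : 'I_f -> nat.
Local Notation L := (Qpf S).
Local Notation EE := (E C).
Local Notation kb := (kbar C).
Local Notation PE := (pol f EE).
Local Notation Pk := (pol f kb).

Definition actE : 'M[L]_2 -> PE -> PE :=
  act (fun i x => (iter i (frob S) x)%:A : EE).
Definition teichE (a : Fq S) : EE := (teich a)%:A.

(* The action of Gamma = GL_2(F_q) over kbar, twisted by det^m, and the
   resulting action of K *)
Definition actGamma (m : nat) (g : 'M[Fq S]_2) (v : Pk) : Pk :=
  Fq_kbar C (\det g) ^+ m *: act (fun i x => Fq_kbar C x ^+ (p ^ i)) g v.
Definition actk (m : nat) (k : 'M[L]_2) : Pk -> Pk :=
  actGamma m (map_mx (@redK p f S) k).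

(* V(O_E), inside V(E) *)
Definition VO (v : PE) : Prop :=
  V r v /\ forall m, v_integral (@vE _ _ _ C) v@_m.
Definition Vr : Pk -> Prop := V r.

Definition indE : ('M[L]_2 -> PE) -> Prop := ind actE (V r).
Definition indO : ('M[L]_2 -> PE) -> Prop := ind actE VO.
Definition indk (M : Pk -> Prop) : ('M[L]_2 -> Pk) -> Prop := ind (actk 0) M.

Variable ap : EE.

(* h lies in (T - a_p)(ind V(E)), the kernel of ind V(E) -> Pi_{k,a_p} *)
Definition zero_in_Pi (h : 'M[L]_2 -> PE) : Prop :=
  exists x y, [/\ indE x, hecke actE teichE (V r) x y
                & forall g, h g = y g - ap *: x g].

(* Theta is the quotient of ind V(O_E) by the h that vanish in Pi; thus the
   O_E-semilinear maps from Theta to a kbar-space M are the maps b below. *)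
Definition theta_map (M : lmodType kb) (b : ('M[L]_2 -> PE) -> M) : Prop :=
  [/\ forall h1 h2, indO h1 -> indO h2 ->
        b (fun g => h1 g + h2 g) = b h1 + b h2,
      forall (a : EE) h, v_integral (@vE _ _ _ C) a -> indO h ->
        b (fun g => a *: h g) = redE a *: b h
    & forall h, indO h -> zero_in_Pi h -> b h = 0].

(* (TB, iota) is the base change of Theta along O_E -> k_E -> kbar, by the
   universal property of the tensor product *)
Definition is_theta_bar (TB : lmodType kb) (iota : ('M[L]_2 -> PE) -> TB) :
    Prop :=
  theta_map iota /\
  forall (M : lmodType kb) (b : ('M[L]_2 -> PE) -> M), theta_map b ->
    exists psi : {linear TB -> M},
      (forall h, indO h -> psi (iota h) = b h) /\
      (forall psi' : {linear TB -> M},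
         (forall h, indO h -> psi' (iota h) = b h) -> psi' =1 psi).

(* These conditions determine s on ind V_r, which is spanned over kbar by the
   reductions of elements of ind V(O_E). *)
Definition is_natural_surjection (TB : lmodType kb)
    (iota : ('M[L]_2 -> PE) -> TB) (s : ('M[L]_2 -> Pk) -> TB) : Prop :=
  [/\ forall x y, indk Vr x -> indk Vr y ->
        s (fun g => x g + y g) = s x + s y,
      forall (a : kb) x, indk Vr x -> s (fun g => a *: x g) = a *: s x
    & forall h x, indO h -> indk Vr x ->
        (forall g m, (x g)@_m = redE (h g)@_m) -> s x = iota h].

Definition is_submodule (U : Pk -> Prop) : Prop :=
  [/\ forall v, U v -> Vr v, U 0,
      forall v w, U v -> U w -> U (v + w),
      forall a v, U v -> U (a *: v)
    & forall g v, g \in unitmx -> U v -> U (actGamma 0 g v)].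

Definition theta (i : 'I_f) : Pk :=
  Xv kb i * Yv kb (ord_pred i) ^+ p - Yv kb i * Xv kb (ord_pred i) ^+ p.

Definition Vstar (v : Pk) : Prop :=
  Vr v /\ exists Q : 'I_f -> Pk, v = \sum_i theta i * Q i.

Definition Xr (v : Pk) : Prop :=
  exists s : seq (kb * 'M[Fq S]_2),
    (forall c, c \in s -> c.2 \in unitmx) /\
    v = \sum_(c <- s) c.1 *: actGamma 0 c.2 (\prod_i Xv kb i ^+ r i).

(* Submodules of Q = V_r / (V_r^* + X_r) are represented by their preimages in
   V_r: [simple_over W U] says that U/W is an irreducible submodule of V_r/W,
   [soc_over W] is the preimage of soc(V_r/W), and [Qfil n] that of Q_n. *)
Definition simple_over (W U : Pk -> Prop) : Prop :=
  [/\ is_submodule U, forall v, W v -> U v, exists2 v, U v & ~ W v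
    & forall U', is_submodule U' ->
        (forall v, W v -> U' v) -> (forall v, U' v -> U v) ->
        (forall v, U' v -> W v) \/ (forall v, U v -> U' v)].

Definition soc_over (W : Pk -> Prop) (v : Pk) : Prop :=
  forall U', is_submodule U' -> (forall w, W w -> U' w) ->
    (forall U, simple_over W U -> forall w, U w -> U' w) -> U' v.

Fixpoint Qfil (n : nat) : Pk -> Prop :=
  match n with
  | 0 => fun v => exists v1 v2, [/\ Vstar v1, Xr v2 & v = v1 + v2]
  | n'.+1 => soc_over (Qfil n')
  end.

(* F_n; an element of F_f is zero in F_t = F_f / F_(f-1) iff it is in F_(f-1). *)
Definition Ffil (TB : lmodType kb) (s : ('M[L]_2 -> Pk) -> TB) (n : nat)
    (y : TB) : Prop :=
  exists2 x, indk (Qfil n) x & y = s x.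

(* phi lifts a Gamma-morphism from the weight (tensor of Sym^(w_i)) (x) det^m to
   cosoc(Q) = Q_f / Q_(f-1) *)
Definition weight_morphism (w : 'I_f -> nat) (m : nat) (phi : Pk -> Pk) :
    Prop :=
  [/\ forall v, V w v -> Qfil f (phi v),
      forall a u v, V w u -> V w v ->
        Qfil f.-1 (phi (a *: u + v) - (a *: phi u + phi v))
    & forall g v, g \in unitmx -> V w v ->
        Qfil f.-1 (phi (actGamma m g v) - actGamma 0 g (phi v))].

(* The elements of ind Q_f whose class in ind cosoc(Q) lies in
   T(ind cosoc(Q)).  As cosoc(Q) is a sum of images of weights, T on
   ind cosoc(Q) is determined by T (ind phi) = (ind phi) T for all morphisms
   phi from a weight. *)
Inductive T_ind_cosoc : ('M[L]_2 -> Pk) -> Prop :=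
| T_ind_weight (w : 'I_f -> nat) (m : nat) (phi : Pk -> Pk) x y z :
    (forall i, (w i < p)%N) -> weight_morphism w m phi ->
    ind (actk m) (V w) x -> hecke (actk m) (Fq_kbar C) (V w) x y ->
    indk (Qfil f) z -> (forall g, Qfil f.-1 (z g - phi (y g))) ->
    T_ind_cosoc z
| T_ind_add z1 z2 :
    T_ind_cosoc z1 -> T_ind_cosoc z2 -> T_ind_cosoc (fun g => z1 g + z2 g).
End Reduction.

(* Main.v *)
Require Import Defs.
From HB Require Import structures.
From mathcomp Require Import all_boot all_order all_algebra all_field.
From mathcomp Require Import zify ring.
From mathcomp.multinomials Require Import mpoly.
From Stdlib Require Import Classical FunctionalExtensionality.

(* Evaluating [v] in V_r at (x^(p^i), y^(p^i)) turns it into a function on F_q^2,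
   and the kernel of this evaluation is V_r^*.  The monomial functions x^a y^b are
   filtered by the digit sum of (a, b): this filtration starts with X_r, its
   successive quotients are sums of simple modules, and it exhausts V_r after f
   steps, so that its n-th step lies in Q_n.  Hence cosoc(Q) is zero or simple, and
   the line fixed by the unipotent upper triangular matrices is then spanned by
   M = x^(q-1) y^d, where d is the digit vector of r.

   By G-equivariance it suffices that sum_a [g A_a, M] (a in F_q, A_a = (p [a]; 0 1)),
   the value of T at the highest weight vector of cosoc(Q), dies in F_t.  Put
   v = M - Y^r.  Let u_1 be the sum of the terms of (X + Y)^r whose X-weight is nonzero
   and divisible by q - 1, so that u_1 = - sum_a (1 [a]; 0 1) Y^r modulo p, and let u_2
   be u_1 corrected by a multiple of one monomial so that its coefficients sum to 0.
   The hypotheses r <> 0, p^i mod q - 1 make T [g, u_2] divisible by p^2, and since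
   0 < v(a_p) < 1 the element
   (T - a_p)(sum_a [g A_a, v / a_p] + [g, u_2 / a_p^2])
   is integral and congruent to - sum_a [g A_a, v] modulo the maximal ideal. *)

Set Implicit Arguments.
Unset Strict Implicit.
Unset Printing Implicit Defensive.

Import Order.TTheory GRing.Theory Num.Theory.
Local Open Scope ring_scope.

(** Passing to functions frees the exponents from the degree r: a monomial of much smaller degree
    stands for an element of V_r once its weight agrees with that of r modulo q - 1, and submodules
    are then governed by digits and carries. An inclusion of the digit filtration in the socle
    filtration suffices, since a larger Q_(f-1) only shrinks the quotient; hence the alternative of
    zero or simple. The term Y^r of v is free, being in X_r, and it cancels M under the
    substitutions at A_b modulo p. As A_a (1 0; 0 p) = p (1 [a]; 0 1), what survives of T
    [g A_a, v / a_p] is - [g (1 [a]; 0 1), Y^r] / a_p. This need not be integral, and - a_p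
    [g, u_2 / a_p^2] is there to absorb it. Then T [g, u_2 / a_p^2] must be small, for which one
    factor p is not enough once v(a_p) >= 1/2. In T [g, u_1] the terms free of Y have a coefficient
    sum divisible by p (as r <> 0), perhaps not by p^2, so the correction cancels it exactly; the
    terms linear in Y carry one p and gain the second from r <> p^i. All errors have valuation at
    least 1 - v(a_p) > 0. *)

(** * Exponent vectors, weights and carries in base p *)

Section Weights.
Variables (p f : nat).
Hypothesis p_gt1 : (1 < p)%N.
Local Notation vec := 'X_{1..f}.
Local Notation q := (p ^ f)%N.

Definition wt (a : vec) : nat := (\sum_i a i * p ^ i)%N.

Lemma wtD a b : wt (a + b)%MM = (wt a + wt b)%N.
Proof. by rewrite /wt -big_split; apply: eq_bigr => i _; rewrite mnmDE mulnDl. Qed.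

Lemma wt0 : wt 0%MM = 0%N.
Proof. by rewrite /wt big1 // => i _; rewrite mnm0E. Qed.

Lemma wt1 i : wt U_(i)%MM = (p ^ i)%N.
Proof.
rewrite /wt (bigD1 i) //= mnm1E eqxx mul1n big1 ?addn0 // => j ne.
by rewrite mnm1E eq_sym (negPf ne).
Qed.

Lemma wtMn a n : wt (a *+ n)%MM = (wt a * n)%N.
Proof. by rewrite /wt big_distrl; apply: eq_bigr => i _; rewrite mulmnE mulnAC. Qed.

Lemma wt_gt0 a : a != 0%MM -> (0 < wt a)%N.
Proof.
rewrite lt0n; apply: contraNneq => /eqP; rewrite sum_nat_eq0 => /forallP h.
apply/eqP/mnmP => i; have := h i.
by rewrite muln_eq0 expn_eq0 (gtn_eqF (ltnW p_gt1)) orbF mnm0E => /eqP.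
Qed.

Definition is_digits (a : vec) : bool := [forall i, (a i < p)%N].
Definition digits (n : nat) : vec := [multinom (n %/ p ^ i) %% p | i < f].

Lemma digits_lt n : is_digits (digits n).
Proof. by apply/forallP => i; rewrite mnmE ltn_pmod // ltnW. Qed.

Lemma sum_digits n k : (\sum_(i < k) (n %/ p ^ i %% p) * p ^ i)%N = (n %% p ^ k)%N.
Proof.
elim: k => [|k IH]; first by rewrite big_ord0 modn1.
rewrite big_ord_recr /= IH expnSr.
have pk : (0 < p ^ k)%N by rewrite expn_gt0 ltnW.
have e : n = ((n %/ p ^ k %/ p) * (p ^ k * p) + ((n %/ p ^ k %% p) * p ^ k + n %% p ^ k))%N.
  rewrite [LHS](divn_eq n (p ^ k)) {1}(divn_eq (n %/ p ^ k) p).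
  by rewrite mulnDl -mulnA (mulnC p) addnA.
rewrite [in RHS]e modnMDl addnC [RHS]modn_small //.
have h1 := ltn_pmod n pk; have h2 := ltn_pmod (n %/ p ^ k) (ltnW p_gt1).
set u := (_ %% p)%N in h2 *; set t := (n %% _)%N in h1 *.
rewrite addnC; have : ((u.+1) * p ^ k <= p * p ^ k)%N by rewrite leq_mul2r h2 orbT.
by rewrite mulSn (mulnC (p ^ k)%N p); apply: leq_trans; rewrite ltn_add2r.
Qed.

Lemma wt_digits n : (n < q)%N -> wt (digits n) = n.
Proof.
move=> lt; rewrite /wt -[RHS](modn_small lt) -sum_digits.
by apply: eq_bigr => i _; rewrite mnmE.
Qed.

Lemma digit_sum_lt (a : nat -> nat) k :
  (forall i, a i < p)%N -> (\sum_(i < k) a i * p ^ i < p ^ k)%N.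
Proof.
move=> ha; elim: k => [|k IH]; first by rewrite big_ord0.
rewrite big_ord_recr /= expnS.
have : ((a k).+1 * p ^ k <= p * p ^ k)%N by rewrite leq_mul2r ha orbT.
by rewrite mulSn; apply: leq_trans; rewrite ltn_add2r.
Qed.

Lemma digit_sum_inj (a b : nat -> nat) k :
  (forall i, a i < p)%N -> (forall i, b i < p)%N ->
  (\sum_(i < k) a i * p ^ i = \sum_(i < k) b i * p ^ i)%N ->
  forall i, (i < k)%N -> a i = b i.
Proof.
move=> ha hb; elim: k => [//|k IH]; rewrite !big_ord_recr /= => e.
have pk : (0 < p ^ k)%N by rewrite expn_gt0 ltnW.
have ek : a k = b k.
  have /(congr1 (fun n => n %/ p ^ k)%N) := e.
  by rewrite !divnDMl // !divn_small ?digit_sum_lt.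
move=> i; rewrite ltnS leq_eqVlt => /predU1P [-> //|]; apply: IH.
by move: e; rewrite ek => /addIn.
Qed.

(** Extension by zero, so that inductions on the number of digits apply to vectors of fixed
    length. *)
Definition vec_ext (a : vec) (n : nat) : nat :=
  if insub n is Some i then a i else 0%N.

Lemma vec_extE a (i : 'I_f) : vec_ext a i = a i.
Proof. by rewrite /vec_ext valK. Qed.

Lemma wt_ext a : wt a = (\sum_(i < f) vec_ext a i * p ^ i)%N.
Proof. by apply: eq_bigr => i _; rewrite vec_extE. Qed.

Lemma vec_ext_lt a : is_digits a -> forall n, (vec_ext a n < p)%N.
Proof.
by move=> /forallP h n; rewrite /vec_ext; case: insubP => // *; rewrite ltnW.
Qed.

Lemma wt_lt a : is_digits a -> (wt a < q)%N.
Proof. by move=> h; rewrite wt_ext digit_sum_lt //; exact: vec_ext_lt. Qed.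

Lemma wt_inj a b : is_digits a -> is_digits b -> wt a = wt b -> a = b.
Proof.
move=> ha hb; rewrite !wt_ext => e; apply/mnmP => i.
rewrite -!vec_extE; apply: (digit_sum_inj _ _ e) => //; exact: vec_ext_lt.
Qed.

Lemma digits_wt a : is_digits a -> digits (wt a) = a.
Proof. by move=> h; apply: wt_inj; rewrite ?digits_lt ?wt_digits ?wt_lt. Qed.

Lemma wt_top : wt [multinom p.-1 | i < f] = q.-1.
Proof.
rewrite predn_exp /wt big_distrr; apply: eq_bigr => i _.
by rewrite mnmE.
Qed.

(* Replaces [p] units in position [i - 1] by one unit in position [i]; the
   weight changes by a multiple of [q - 1]. *)
Definition carry (i : 'I_f) (a : vec) : vec := (a - U_(ord_pred i) *+ p + U_(i))%MM.

Lemma carry_sub i (a : vec) : (p <= a (ord_pred i))%N -> (U_(ord_pred i) *+ p <= a)%MM.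
Proof.
move=> h; apply/mnm_lepP => j; rewrite mulmnE mnm1E.
by case: eqP => [<-|_] //=; rewrite ?mul1n ?mul0n.
Qed.

(** Positions are cyclic: the two sides are equal except at [i = 0], where the left one is p^f,
    congruent to 1. *)
Lemma expn_ord_pred (i : 'I_f) : (p ^ ord_pred i * p = p ^ i %[mod q.-1])%N.
Proof.
have f0 : (0 < f)%N by exact: leq_ltn_trans (ltn_ord i).
have e : nat_of_ord (ord_pred i) = ((i + f).-1 %% f)%N by [].
rewrite -expnSr e; case: (posnP i) => [->|i0].
  rewrite add0n (_ : f.-1 %% f = f.-1)%N ?prednK //; last by rewrite modn_small ?prednK.
  have -> : q = (1 * q.-1 + 1)%N by rewrite mul1n addn1 prednK ?expn_gt0 ?(ltnW p_gt1).
  by rewrite mul1n addn1 /= expn0 -addn1 modnDl.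
have -> : (i + f).-1 = (i.-1 + f)%N by lia.
rewrite modnDr (_ : i.-1 %% f = i.-1)%N ?prednK // modn_small //.
exact: leq_ltn_trans (leq_pred _) (ltn_ord i).
Qed.

Lemma wt_carry i (a : vec) : (p <= a (ord_pred i))%N -> (wt (carry i a) = wt a %[mod q.-1])%N.
Proof.
move=> /carry_sub h; rewrite /carry wtD wt1 -{2}(submK h) wtD.
by rewrite wtMn wt1 -modnDmr -expn_ord_pred modnDmr.
Qed.

Lemma mdeg_carry i (a : vec) : (p <= a (ord_pred i))%N ->
  mdeg a = (mdeg (carry i a) + p.-1)%N.
Proof.
move=> /carry_sub h; rewrite /carry mdegD mdeg1 -{1}(submK h) mdegD mdegMn mdeg1.
by move: p_gt1; lia.
Qed.

Lemma not_digits (a : vec) : ~~ is_digits a -> exists i : 'I_f, (p <= a (ord_pred i))%N.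
Proof.
rewrite negb_forall => /existsP [j]; rewrite -leqNgt => h.
by exists (ordS j); rewrite ordSK.
Qed.

(** Weights of digit vectors lie in [0, q - 1], so reduction modulo q - 1 confuses only the two
    extreme ones, and their common residue 0 is excluded. *)
Lemma digits_modP l d : is_digits l -> is_digits d -> (wt d != 0 %[mod q.-1])%N ->
  (wt l = wt d %[mod q.-1])%N -> l = d.
Proof.
move=> hl hd; rewrite mod0n => nz e; apply: wt_inj => //.
have small a : is_digits a -> (wt a %% q.-1 != 0)%N -> (wt a %% q.-1)%N = wt a.
  move=> ha na; rewrite modn_small // ltn_neqAle; apply/andP; split.
    by apply: contraNneq na => ->; rewrite modnn.
  by have := wt_lt ha; lia.
have := small _ hl; rewrite e => <- //; exact: small.
Qed.

(** Carrying until only digits remain lowers the degree by p - 1 each time and can end only at [d];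
    [k] counts the carries. This number is the level in the filtration. *)
Lemma mdeg_level l d : is_digits d -> (wt d != 0 %[mod q.-1])%N ->
  (wt l = wt d %[mod q.-1])%N ->
  exists2 k, mdeg l = (mdeg d + k * p.-1)%N & (k = 0%N -> l = d).
Proof.
move=> hd nz; have [n] := ubnP (mdeg l); elim: n l => // n IH l lt e.
case: (boolP (is_digits l)) => [hl|/not_digits [i hi]].
  by rewrite (digits_modP hl hd nz e); exists 0%N; rewrite ?addn0.
have dl := mdeg_carry hi.
have lt' : (mdeg (carry i l) < n)%N by move: p_gt1 lt; rewrite dl; clear; lia.
have e' : (wt (carry i l) = wt d %[mod q.-1])%N by rewrite wt_carry.
have [k ek _] := IH _ lt' e'.
by exists k.+1 => //; rewrite dl ek mulSn; lia.
Qed.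

Definition compl (a : vec) : vec := [multinom p.-1 - a i | i < f].

Lemma compl_digits a : is_digits (compl a).
Proof. by apply/forallP => i; rewrite mnmE; move: p_gt1; lia. Qed.

Lemma complK a : is_digits a -> (a + compl a)%MM = [multinom p.-1 | i < f].
Proof.
by move=> /forallP h; apply/mnmP => i; rewrite mnmDE !mnmE; have := h i; lia.
Qed.

Lemma wt_compl a : is_digits a -> (wt a + wt (compl a))%N = q.-1.
Proof. by move=> h; rewrite -wtD complK // wt_top. Qed.

Lemma mdeg_compl a : is_digits a -> (mdeg a + mdeg (compl a))%N = (f * p.-1)%N.
Proof.
move=> h; rewrite -mdegD complK // mdegE.
by rewrite (eq_bigr (fun=> p.-1)) ?sum_nat_const ?card_ord // => i _; rewrite mnmE.
Qed.

(** Complementing the digits of [a] and [b] turns the lower bound of [mdeg_level], applied to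
    [compl d], into an upper bound. Hence the levels run from 0 to f, with a single multidegree at
    level f. *)
Lemma mdeg_level_top a b d : is_digits a -> is_digits b -> is_digits d ->
  (wt d != 0 %[mod q.-1])%N -> (wt (a + b)%MM = wt d %[mod q.-1])%N ->
  (mdeg (a + b)%MM <= mdeg d + f * p.-1)%N /\
  (mdeg (a + b)%MM = (mdeg d + f * p.-1)%N ->
     (a + b)%MM = [multinom p.-1 + d i | i < f]).
Proof.
move=> ha hb hd nz e.
have nz' : (wt (compl d) != 0 %[mod q.-1])%N.
  apply: contraNneq nz => ed; have := wt_compl hd.
  by move/(congr1 (modn^~ q.-1)); rewrite -modnDmr ed modnDmr addn0 modnn mod0n => ->.
have e' : (wt (compl a + compl b)%MM = wt (compl d) %[mod q.-1])%N.
  apply/eqP; rewrite -(eqn_modDl (wt d)) wt_compl // -modnDml -e modnDml !wtD.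
  have := wt_compl ha; have := wt_compl hb => eb ea.
  rewrite (_ : _ + _ = (wt a + wt (compl a)) + (wt b + wt (compl b)))%N; last by lia.
  by rewrite ea eb modnDr.
have [k ek k0] := mdeg_level (compl_digits d) nz' e'.
have := mdeg_compl ha; have := mdeg_compl hb; have := mdeg_compl hd.
have pg : (0 < p.-1)%N by move: p_gt1; clear; lia.
move: ek pg k0; rewrite !mdegD.
move: (mdeg a) (mdeg b) (mdeg d) (mdeg (compl a)) (mdeg (compl b)) (mdeg (compl d)).
move: (f * _)%N => N xa xb xd ya yb yd ek pg k0 ed eb ea.
split; first by move: (k * p.-1)%N ek ed eb ea; clear; lia.
move=> eq; have {}k0 : (compl a + compl b)%MM = compl d.
  apply: k0; move: ek ed eb ea eq pg; clear; case: k => // k.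
  by rewrite mulSn; move: (k * p.-1)%N (p.-1); lia.
apply/mnmP => i; have /mnmP/(_ i) := k0.
move: ha hb hd => /forallP/(_ i) ha /forallP/(_ i) hb /forallP/(_ i) hd.
by rewrite !mnmDE !mnmE; move: ha hb hd; clear; lia.
Qed.
End Weights.

(** * Monomials, substitutions and multidegrees in the variables X_i, Y_i *)

Section Monomials.
Variables (f : nat) (R : comNzRingType).
Local Notation vec := 'X_{1..f}.
Local Notation P := (pol f R).

Definition mjoin (a b : vec) : 'X_{1..f + f} :=
  [multinom match split j with inl i => a i | inr i => b i end | j < f + f].
Definition expX (m : 'X_{1..f + f}) : vec := [multinom m (lshift f i) | i < f].
Definition expY (m : 'X_{1..f + f}) : vec := [multinom m (rshift f i) | i < f].

Lemma split_lshift (i : 'I_f) : split (lshift f i) = inl i.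
Proof. exact: (unsplitK (inl i)). Qed.

Lemma split_rshift (i : 'I_f) : split (rshift f i) = inr i.
Proof. exact: (unsplitK (inr i)). Qed.

Lemma mjoin_l a b i : mjoin a b (lshift f i) = a i.
Proof. by rewrite mnmE split_lshift. Qed.

Lemma mjoin_r a b i : mjoin a b (rshift f i) = b i.
Proof. by rewrite mnmE split_rshift. Qed.

Lemma expX_join a b : expX (mjoin a b) = a.
Proof. by apply/mnmP => i; rewrite mnmE mjoin_l. Qed.

Lemma expY_join a b : expY (mjoin a b) = b.
Proof. by apply/mnmP => i; rewrite mnmE mjoin_r. Qed.

Lemma mjoinK m : mjoin (expX m) (expY m) = m.
Proof.
apply/mnmP => j; rewrite mnmE; case: (splitP j) => k e; rewrite mnmE;
  congr (m _); exact: val_inj.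
Qed.

Lemma mjoinD a b c d : (mjoin a b + mjoin c d)%MM = mjoin (a + c) (b + d).
Proof. by apply/mnmP => j; rewrite mnmDE !mnmE; case: (split j) => k; rewrite mnmDE. Qed.

Definition mono (a b : vec) : P := 'X_[mjoin a b].

Lemma monoM a b c d : mono a b * mono c d = mono (a + c) (b + d).
Proof. by rewrite /mono -mpolyXD mjoinD. Qed.

Lemma monoE a b : mono a b = (\prod_i Xv R i ^+ a i) * \prod_i Yv R i ^+ b i.
Proof.
rewrite /mono mpolyXE_id big_split_ord /=; congr (_ * _).
  by apply: eq_bigr => i _; rewrite mjoin_l.
by apply: eq_bigr => i _; rewrite mjoin_r.
Qed.

Lemma mono0r a : mono a 0%MM = \prod_i Xv R i ^+ a i.
Proof. by rewrite monoE [X in _ * X]big1 ?mulr1 // => i _; rewrite mnm0E. Qed.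

Lemma mono0l b : mono 0%MM b = \prod_i Yv R i ^+ b i.
Proof. by rewrite monoE big1 ?mul1r // => i _; rewrite mnm0E. Qed.

Lemma pol_mono (v : P) : v = \sum_(m <- msupp v) v@_m *: mono (expX m) (expY m).
Proof. by rewrite {1}(mpolyE v); apply: eq_bigr => m _; rewrite /mono mjoinK. Qed.

Section Subst.
Variables PX PY : 'I_f -> P.
Local Notation sub := (subst PX PY).

Lemma substD u v : sub (u + v) = sub u + sub v.
Proof. exact: raddfD. Qed.
Lemma substB u v : sub (u - v) = sub u - sub v.
Proof. exact: raddfB. Qed.
Lemma substZ a v : sub (a *: v) = a *: sub v.
Proof. exact: comp_mpolyZ. Qed.
Lemma subst_sum (I : Type) (s : seq I) (Q : pred I) F :
  sub (\sum_(i <- s | Q i) F i) = \sum_(i <- s | Q i) sub (F i).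
Proof. exact: raddf_sum. Qed.

Lemma subst_mono a b : sub (mono a b) = (\prod_i PX i ^+ a i) * \prod_i PY i ^+ b i.
Proof.
rewrite /subst comp_mpolyX big_split_ord /=; congr (_ * _); apply: eq_bigr => i _.
  by rewrite tnth_mktuple split_lshift mjoin_l.
by rewrite tnth_mktuple split_rshift mjoin_r.
Qed.

Lemma substX i : sub (Xv R i) = PX i.
Proof. by rewrite /subst /Xv comp_mpolyXU -tnth_nth tnth_mktuple split_lshift. Qed.

Lemma substY i : sub (Yv R i) = PY i.
Proof. by rewrite /subst /Yv comp_mpolyXU -tnth_nth tnth_mktuple split_rshift. Qed.
End Subst.

Lemma eq_subst PX PY QX QY v : PX =1 QX -> PY =1 QY ->
  subst PX PY v = subst QX QY v :> P.
Proof.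
move=> eX eY; rewrite /subst; congr (_ \mPo _).
by apply: eq_from_tnth => j; rewrite !tnth_mktuple; case: (split j).
Qed.

Lemma subst_comp (PX PY QX QY : 'I_f -> P) v :
  subst PX PY (subst QX QY v) =
  subst (fun i => subst PX PY (QX i)) (fun i => subst PX PY (QY i)) v.
Proof.
rewrite (pol_mono v) [subst QX QY _]subst_sum [LHS]subst_sum [RHS]subst_sum.
apply: eq_bigr => m _; rewrite !substZ !subst_mono.
rewrite /subst rmorphM !rmorph_prod; congr (_ *: (_ * _)); apply: eq_bigr => i _;
  exact: rmorphXn.
Qed.

Lemma subst_id v : subst (@Xv f R) (@Yv f R) v = v.
Proof.
rewrite {2}(pol_mono v) {1}(pol_mono v) subst_sum; apply: eq_bigr => m _.
by rewrite substZ subst_mono -monoE.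
Qed.

Lemma VP (r : vec) (v : P) :
  V r v <-> (forall m, m \in msupp v -> (expX m + expY m)%MM = r).
Proof.
split=> h m hm.
  by apply/mnmP => i; rewrite mnmDE !mnmE; exact: h.
by move=> i; have /mnmP/(_ i) := h m hm; rewrite mnmDE !mnmE.
Qed.

Lemma eq_V (r r' : 'I_f -> nat) (v : P) : r =1 r' -> V r v -> V r' v.
Proof. by move=> e h m /h hm i; rewrite hm e. Qed.

Lemma V_fun (r : 'I_f -> nat) (v : P) : V r v <-> V [multinom r i | i < f] v.
Proof. by split; apply: eq_V => i; rewrite mnmE. Qed.

Lemma V_mono a b : V (a + b)%MM (mono a b).
Proof. by apply/VP => m; rewrite msuppX inE => /eqP ->; rewrite expX_join expY_join. Qed.

Section Degrees.
Variable r : 'I_f -> nat.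

Lemma V0 : V r (0 : P).
Proof. by move=> m; rewrite msupp0. Qed.

Lemma VD u v : V r u -> V r v -> V r (u + v : P).
Proof.
by move=> hu hv m /msuppD_le; rewrite mem_cat => /orP [/hu|/hv].
Qed.

Lemma VZ a v : V r v -> V r (a *: v : P).
Proof. by move=> hv m /msuppZ_le /hv. Qed.

Lemma VB u v : V r u -> V r v -> V r (u - v : P).
Proof. by move=> hu hv; rewrite -scaleN1r; apply: VD => //; exact: VZ. Qed.

Lemma V_sum (I : eqType) (s : seq I) (F : I -> P) :
  (forall i, i \in s -> V r (F i)) -> V r (\sum_(i <- s) F i).
Proof.
move=> h; rewrite big_seq; elim/big_ind: _ => //; first exact: V0; exact: VD.
Qed.
End Degrees.

Lemma VM r s (u v : P) : V r u -> V s v -> V (fun i => r i + s i)%N (u * v).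
Proof.
move=> hu hv m /msuppM_le /allpairsP [[m1 m2] /= [h1 h2 ->]] i.
by rewrite !mnmDE -(hu _ h1) -(hv _ h2); lia.
Qed.

Lemma V1 : V (fun=> 0%N) (1 : P).
Proof. by move=> m; rewrite -mpolyC1 msupp1 inE => /eqP -> i; rewrite !mnm0E. Qed.

Lemma VX s (u : P) n : V s u -> V (fun i => s i * n)%N (u ^+ n).
Proof.
move=> hu; elim: n => [|n IH].
  by apply: eq_V V1 => i; rewrite muln0.
by rewrite exprS; apply: eq_V (VM hu IH) => i; rewrite mulnS.
Qed.

Lemma V_prod (I : Type) (s : seq I) (e : I -> 'I_f -> nat) (F : I -> P) :
  (forall i, V (e i) (F i)) -> V (fun j => \sum_(i <- s) e i j)%N (\prod_(i <- s) F i).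
Proof.
move=> h; elim: s => [|i s IH].
  by rewrite big_nil; apply: eq_V V1 => j; rewrite big_nil.
by rewrite big_cons; apply: eq_V (VM (h i) IH) => j; rewrite big_cons.
Qed.

Lemma V_Xv (i : 'I_f) : V U_(i)%MM (Xv R i).
Proof.
move=> m; rewrite /Xv msuppX inE => /eqP -> j; rewrite !mnm1E.
by rewrite !eq_shift addn0.
Qed.

Lemma V_Yv (i : 'I_f) : V U_(i)%MM (Yv R i).
Proof.
move=> m; rewrite /Yv msuppX inE => /eqP -> j; rewrite !mnm1E.
by rewrite !eq_shift.
Qed.

Lemma V_subst_lin r (a b c d : 'I_f -> R) v : V r v ->
  V r (subst (fun i => a i *: Xv R i + b i *: Yv R i)
             (fun i => c i *: Xv R i + d i *: Yv R i) v).
Proof.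
move=> hv; rewrite (pol_mono v) subst_sum; apply: V_sum => m hm.
rewrite substZ; apply: VZ; rewrite subst_mono.
have lin (x y : 'I_f -> R) i : V U_(i)%MM (x i *: Xv R i + y i *: Yv R i).
  by apply: VD; apply: VZ; [exact: V_Xv | exact: V_Yv].
have h1 := V_prod (s := index_enum _) (fun i => @VX _ _ (expX m i) (lin a b i)).
have h2 := V_prod (s := index_enum _) (fun i => @VX _ _ (expY m i) (lin c d i)).
apply: (eq_V _ (VM h1 h2)) => j /=.
rewrite -(hv m hm j); congr (_ + _)%N.
  rewrite (bigD1 j) //= big1 ?addn0 => [|i ne]; rewrite mnm1E ?eqxx ?mul1n ?mnmE //.
  by rewrite (negPf ne).
rewrite (bigD1 j) //= big1 ?addn0 => [|i ne]; rewrite mnm1E ?eqxx ?mul1n ?mnmE //.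
by rewrite (negPf ne).
Qed.

Lemma V_act (A : Type) (e : 'I_f -> A -> R) r g v : V r v -> V r (act e g v).
Proof. exact: V_subst_lin. Qed.

Lemma act_comp (A : pzRingType) (e : 'I_f -> A -> R) (g h : 'M[A]_2) v :
  (forall i x y, e i (x + y) = e i x + e i y) ->
  (forall i x y, e i (x * y) = e i x * e i y) ->
  act e (g *m h) v = act e g (act e h v).
Proof.
move=> eD eM; rewrite /act subst_comp.
have mE i j : (g *m h) i j = g i 0 * h 0 j + g i 1 * h 1 j.
  rewrite mxE big_ord_recl big_ord_recl big_ord0 addr0.
  by rewrite (_ : lift ord0 ord0 = 1) //; apply: val_inj.
apply: eq_subst => i; rewrite !substD !substZ !substX !substY !mE !eD !eM;
  rewrite !scalerDr !scalerA !scalerDl ![e i (h _ _) * _]mulrC addrACA //.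
Qed.

Definition vec_of (N : nat) (j : {ffun 'I_f -> 'I_N}) : vec := [multinom (j i : nat) | i < f].
Definition bin (b j : vec) : nat := (\prod_i 'C(b i, j i))%N.
Definition mpow (c : 'I_f -> R) (j : vec) : R := \prod_i c i ^+ j i.

Lemma vbin_small b j : ~~ (j <= b)%MM -> bin b j = 0%N.
Proof.
rewrite negb_forall => /existsP [i]; rewrite -ltnNge => lt.
by rewrite /bin (bigD1 i) //= bin_small // mul0n.
Qed.

Lemma vbin0 b : bin b 0%MM = 1%N.
Proof. by rewrite /bin big1 // => i _; rewrite mnm0E bin0. Qed.

Lemma vec_of_inj N : injective (@vec_of N).
Proof.
move=> i j /mnmP e; apply/ffunP => k; apply: val_inj.
by have := e k; rewrite !mnmE.
Qed.

Lemma prod_exprD (A : comNzRingType) (u v : 'I_f -> A) (b : vec) N :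
  (forall i, b i < N)%N ->
  \prod_i (u i + v i) ^+ b i =
  \sum_(j : {ffun 'I_f -> 'I_N})
     (\prod_i (u i ^+ (b i - j i) * v i ^+ j i)) *+ bin b (vec_of j).
Proof.
move=> hb.
have e i : (u i + v i) ^+ b i =
    \sum_(j < N) (u i ^+ (b i - j) * v i ^+ j) *+ 'C(b i, j).
  rewrite exprDn (big_ord_widen N (fun j => (u i ^+ (b i - j) * v i ^+ j) *+ 'C(b i, j))) //.
  rewrite big_mkcond; apply: eq_bigr => j _; case: ltnP => // h.
  by rewrite bin_small ?mulr0n.
under eq_bigr do rewrite e.
rewrite bigA_distr_bigA; apply: eq_bigr => j _.
rewrite /bin -prodrMn /=.
by apply: eq_bigr => i _; rewrite mnmE.
Qed.

Lemma prod_linear_expand (c d : 'I_f -> R) (b : vec) N : (forall i, b i < N)%N ->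
  \prod_i (c i *: Xv R i + d i *: Yv R i) ^+ b i =
  \sum_(j : {ffun 'I_f -> 'I_N})
    ((bin b (vec_of j))%:R * mpow c (b - vec_of j)%MM * mpow d (vec_of j)) *:
      mono (b - vec_of j)%MM (vec_of j).
Proof.
move=> hb; rewrite (prod_exprD _ _ hb); apply: eq_bigr => j _.
rewrite -scaler_nat -mulrA -scalerA; congr (_ *: _).
rewrite monoE big_split /= /mpow.
under eq_bigr do rewrite exprZn; under [X in _ * X]eq_bigr do rewrite exprZn.
rewrite !scaler_prod -scalerAl -scalerAr scalerA.
congr ((_ * _) *: (_ * _)); apply: eq_bigr => i _; by rewrite ?mnmBE !mnmE.
Qed.

Lemma prod_linear_expandX (c d : 'I_f -> R) (b : vec) N : (forall i, b i < N)%N ->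
  \prod_i (c i *: Xv R i + d i *: Yv R i) ^+ b i =
  \sum_(j : {ffun 'I_f -> 'I_N})
    ((bin b (vec_of j))%:R * mpow c (vec_of j) * mpow d (b - vec_of j)%MM) *:
      mono (vec_of j) (b - vec_of j)%MM.
Proof.
move=> hb; under eq_bigr do rewrite addrC.
rewrite (prod_exprD _ _ hb); apply: eq_bigr => j _.
rewrite -scaler_nat -mulrA -scalerA; congr (_ *: _).
rewrite monoE big_split /= /mpow mulrC.
under eq_bigr do rewrite exprZn; under [X in _ * X]eq_bigr do rewrite exprZn.
rewrite !scaler_prod -scalerAl -scalerAr scalerA.
congr ((_ * _) *: (_ * _)); apply: eq_bigr => i _; by rewrite ?mnmBE !mnmE.
Qed.
End Monomials.

(** * Power sums over a finite field *)

Section FiniteFieldSums.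
Variables (F : finFieldType) (q : nat).
Hypothesis F_card : #|F| = q.

Lemma card_gt1 : (1 < q)%N.
Proof. by rewrite -F_card finRing_gt1. Qed.

Lemma expf_pred_card (x : F) : x != 0 -> x ^+ q.-1 = 1.
Proof.
move=> nz; apply: (mulfI nz); rewrite -exprS prednK ?mulr1 ?(ltnW card_gt1) //.
by rewrite -F_card expf_card.
Qed.

Lemma expf_eqmod (x : F) m n : (0 < m)%N -> (0 < n)%N -> m = n %[mod q.-1] ->
  x ^+ m = x ^+ n.
Proof.
move=> m0 n0 e; have [->|nz] := eqVneq x 0; first by rewrite !expr0n !gtn_eqF.
by rewrite -(expr_mod m (expf_pred_card nz)) e expr_mod ?expf_pred_card.
Qed.

(** Otherwise X^(n mod (q - 1)) - 1 would have all q - 1 nonzero elements as roots, more than its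
    degree. *)
Lemma exists_expf_neq1 n : ~~ (q.-1 %| n)%N -> exists2 x : F, x != 0 & x ^+ n != 1.
Proof.
move=> nd; have q1 : (0 < q.-1)%N by have := card_gt1; lia.
pose n' := (n %% q.-1)%N.
have n'0 : (0 < n')%N by rewrite lt0n.
have n'q : (n' < q.-1)%N by rewrite ltn_pmod.
case: (pickP [pred x : F | (x != 0) && (x ^+ n != 1)]) => [x /andP [h1 h2]|h]; first by exists x.
pose s := [seq x <- enum F | x != 0].
have sz : size s = q.-1.
  rewrite size_filter -F_card (cardD1 0) inE /= cardE -size_filter.
  by rewrite add0n [in RHS]/enum_mem -enumT; congr size; apply: eq_filter => x; rewrite !inE andbT.
have monic1 : 'X^n' - 1%:P \is @monic F by rewrite monicXnsubC.
have := @max_poly_roots F ('X^n' - 1%:P) s (monic_neq0 monic1) _ _.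
rewrite size_XnsubC // sz => /(_ _ _)/wrap [].
- apply/allP => x; rewrite mem_filter => /andP [nz _].
  rewrite rootE !hornerE subr_eq0 expr_mod ?expf_pred_card //.
  by have /= := h x; rewrite nz /= => /negbFE.
- by rewrite filter_uniq ?enum_uniq.
- by rewrite ltnS leqNgt n'q.
Qed.

(** The substitution x -> y x multiplies the sum by y^n. At [n = 0] the convention 0^0 = 1 makes the
    sum q = 0, whence the condition [0 < n]. *)
Lemma sum_expf n : \sum_(x : F) x ^+ n = - ((0 < n) && (q.-1 %| n))%N%:R.
Proof.
have card0 : q%:R = 0 :> F.
  have : \sum_(x : F) (x + 1) = \sum_(x : F) x.
    by rewrite [RHS](reindex_inj (addIr 1)).
  by rewrite big_split /= sumr_const F_card => /(canRL (addKr _)); rewrite addNr.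
have [->|n0] := posnP n.
  by rewrite oppr0 (eq_bigr (fun=> 1)) ?sumr_const ?F_card.
case: (boolP (q.-1 %| n)%N) => [dv|/exists_expf_neq1 [y ny yn]] /=.
  rewrite (bigD1 0) //= expr0n gtn_eqF // add0r.
  rewrite (eq_bigr (fun=> 1)) => [|x nx]; last first.
    by have /dvdnP [m ->] := dv; rewrite mulnC exprM expf_pred_card // expr1n.
  rewrite sumr_const cardC1 F_card -subn1 natrB ?card0 ?sub0r //.
  exact: ltnW card_gt1.
rewrite oppr0; apply/eqP.
have /eqP : \sum_(x : F) x ^+ n = y ^+ n * \sum_(x : F) x ^+ n.
  rewrite mulr_sumr (reindex_inj (mulfI ny)); apply: eq_bigr => x _.
  by rewrite exprMn.
rewrite -{1}[X in X == _]mul1r -subr_eq0 -mulrBl mulf_eq0 subr_eq0 eq_sym.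
by rewrite (negPf yn).
Qed.
End FiniteFieldSums.

(** * V_r^* as the kernel of evaluation on F_q^2 *)

Section Evaluation.
Variables (p f : nat) (S : unramified p f) (C : coefficients S).
Hypothesis p_prime : prime p.
Hypothesis f_gt0 : (0 < f)%N.
Local Notation q := (p ^ f)%N.
Local Notation F := (Fq S).
Local Notation K := (kbar C).
Local Notation io := (Fq_kbar C).
Local Notation P := (pol f K).
Local Notation vec := 'X_{1..f}.
Local Notation mono := (@mono f K).
Local Notation wt := (@wt p f).

Let p_gt1 : (1 < p)%N := prime_gt1 p_prime.

Lemma pchar_Fq : p \in [pchar F].
Proof.
exact: card_finPcharP (Fq_card S) p_prime.
Qed.

Lemma pchar_kbar : p \in [pchar K].
Proof. exact: (rmorph_pchar io pchar_Fq). Qed.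

Lemma sum_io n : \sum_(x : F) io x ^+ n = - ((0 < n) && (q.-1 %| n))%N%:R.
Proof.
rewrite (eq_bigr (fun x => io (x ^+ n))) => [|x _]; last first.
  by rewrite rmorphXn.
by rewrite -rmorph_sum (sum_expf (Fq_card S)) rmorphN rmorph_nat.
Qed.

(** The Frobenius twists make a monomial collapse to x^(wt a) y^(wt b) and make evaluation
    compatible with Gamma ([ev_act]). *)
Definition ev (x y : F) (v : P) : K :=
  v.@[fun j => match split j with inl i => io x ^+ (p ^ i) | inr i => io y ^+ (p ^ i) end].

Lemma evD x y u v : ev x y (u + v) = ev x y u + ev x y v.
Proof. exact: mevalD. Qed.
Lemma evB x y u v : ev x y (u - v) = ev x y u - ev x y v.
Proof. exact: mevalB. Qed.
Lemma evZ x y a v : ev x y (a *: v) = a * ev x y v.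
Proof. exact: mevalZ. Qed.
Lemma evM x y u v : ev x y (u * v) = ev x y u * ev x y v.
Proof. exact: mevalM. Qed.
Lemma ev_sum x y (I : Type) (s : seq I) (Q : pred I) G :
  ev x y (\sum_(i <- s | Q i) G i) = \sum_(i <- s | Q i) ev x y (G i).
Proof. exact: raddf_sum. Qed.

Lemma evX x y u n : ev x y (u ^+ n) = ev x y u ^+ n.
Proof. exact: rmorphXn. Qed.
Lemma ev_prod x y (G : 'I_f -> P) : ev x y (\prod_i G i) = \prod_i ev x y (G i).
Proof. exact: rmorph_prod. Qed.

Lemma prod_wt (c : K) (a : vec) : \prod_(i < f) (c ^+ (p ^ i)) ^+ a i = c ^+ wt a.
Proof.
rewrite /wt -prodrXr; apply: eq_bigr => i _.
by rewrite -exprM mulnC.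
Qed.

Lemma ev_mono x y a b : ev x y (mono a b) = io x ^+ wt a * io y ^+ wt b.
Proof.
rewrite /ev mevalX big_split_ord -!prod_wt /=; congr (_ * _); apply: eq_bigr => i _.
  by rewrite split_lshift mjoin_l.
by rewrite split_rshift mjoin_r.
Qed.

Lemma ev_Xv x y i : ev x y (Xv K i) = io x ^+ (p ^ i).
Proof. by rewrite /ev /Xv mevalXU split_lshift. Qed.

Lemma ev_Yv x y i : ev x y (Yv K i) = io y ^+ (p ^ i).
Proof. by rewrite /ev /Yv mevalXU split_rshift. Qed.

Lemma io_expD (x y : F) i : io (x + y) ^+ (p ^ i) = io x ^+ (p ^ i) + io y ^+ (p ^ i).
Proof.
rewrite rmorphD exprDn_pchar //.
apply/andP; split; first by rewrite expn_gt0 prime_gt0.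
apply/allP => l; case: i => [|i] //; rewrite primesX // primes_prime // inE => /eqP ->.
exact: pchar_kbar.
Qed.

Lemma actGamma0 g (v : P) : actGamma 0 g v = act (fun i x => io x ^+ (p ^ i)) g v.
Proof. by rewrite /actGamma expr0 scale1r. Qed.

Lemma actGammaD m g (u v : P) : actGamma m g (u + v) = actGamma m g u + actGamma m g v.
Proof. by rewrite /actGamma /act substD scalerDr. Qed.

Lemma actGammar0 m g : actGamma m g (0 : P) = 0.
Proof. by rewrite /actGamma /act /subst comp_mpoly0 scaler0. Qed.

Lemma actGamma_sum m g (I : Type) (s : seq I) (G : I -> P) :
  actGamma m g (\sum_(i <- s) G i) = \sum_(i <- s) actGamma m g (G i).
Proof. exact: (big_morph _ (actGammaD m g) (actGammar0 m g)). Qed.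

Lemma actGammaZ m g a (v : P) : actGamma m g (a *: v) = a *: actGamma m g v.
Proof. by rewrite /actGamma /act substZ !scalerA mulrC. Qed.

Lemma actGammaB m g (u v : P) : actGamma m g (u - v) = actGamma m g u - actGamma m g v.
Proof. by rewrite -[- v]scaleN1r actGammaD actGammaZ scaleN1r. Qed.

Lemma actGamma_comp m g h (v : P) : actGamma m (g *m h) v = actGamma m g (actGamma m h v).
Proof.
rewrite /actGamma [act _ g (_ *: _)]substZ scalerA det_mulmx rmorphM exprMn; congr (_ *: _).
by apply: act_comp => i x y; [exact: io_expD | rewrite rmorphM exprMn].
Qed.

Lemma V_actGamma r m g (v : P) : V r v -> V r (actGamma m g v).
Proof. by move=> h; apply/VZ/V_act. Qed.

Lemma ev_act x y g v :
  ev x y (actGamma 0 g v) = ev (g 0 0 * x + g 1 0 * y) (g 0 1 * x + g 1 1 * y) v.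
Proof.
rewrite actGamma0 /act (pol_mono v) subst_sum !ev_sum; apply: eq_bigr => m _.
rewrite substZ !evZ subst_mono ev_mono evM; congr (_ * (_ * _)).
  rewrite -prod_wt ev_prod; apply: eq_bigr => i _; rewrite evX.
  by rewrite evD !evZ ev_Xv ev_Yv io_expD !rmorphM !exprMn.
rewrite -prod_wt ev_prod; apply: eq_bigr => i _; rewrite evX.
by rewrite evD !evZ ev_Xv ev_Yv io_expD !rmorphM !exprMn.
Qed.

Lemma io_eqmod (x : F) m n : (0 < m)%N -> (0 < n)%N -> m = n %[mod q.-1] ->
  io x ^+ m = io x ^+ n.
Proof.
move=> m0 n0 e; rewrite -!rmorphXn; congr (io _).
exact: (expf_eqmod (Fq_card S)).
Qed.

Lemma ev_theta x y i : ev x y (theta C i) = 0.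
Proof.
rewrite /theta evB.
rewrite (evM _ _ (Xv K i)) (evM _ _ (Yv K i)) !evX !ev_Xv !ev_Yv -!exprM.
have e z : io z ^+ (p ^ ord_pred i * p) = io z ^+ (p ^ i).
  apply: io_eqmod; rewrite ?muln_gt0 ?expn_gt0 ?prime_gt0 //.
  exact: expn_ord_pred p_gt1 _.
by rewrite !e mulrC subrr.
Qed.

Variable r : 'I_f -> nat.
Hypothesis r_gt : forall i, (p ^ f + p - 2 < r i)%N.
Local Notation rv := [multinom r i | i < f].

Lemma r_ge_p i : (p <= r i)%N.
Proof. by have := r_gt i; have := card_gt1 (Fq_card S); clear; lia. Qed.

Lemma r_ge_q i : (q.-1 < r i)%N.
Proof. by have := r_gt i; have := card_gt1 (Fq_card S); have := p_gt1; clear; lia. Qed.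

Lemma Vr_mono a b : (a + b)%MM = rv -> Vr r (mono a b).
Proof. by move=> e; apply/V_fun; rewrite -e; exact: V_mono. Qed.

Lemma VstarD (u v : P) : Vstar r u -> Vstar r v -> Vstar r (u + v).
Proof.
move=> [hu [Q eu]] [hv [Q' ew]]; split; first exact: VD.
by exists (fun i => Q i + Q' i); rewrite eu ew -big_split; apply: eq_bigr => i _; rewrite mulrDr.
Qed.

Lemma VstarZ a (v : P) : Vstar r v -> Vstar r (a *: v).
Proof.
move=> [hv [Q e]]; split; first exact: VZ.
by exists (fun i => a *: Q i); rewrite e scaler_sumr; apply: eq_bigr => i _; rewrite scalerAr.
Qed.

Lemma Vstar0 : Vstar r (0 : P).
Proof.
by split; [exact: V0 | exists (fun=> 0); rewrite big1 // => i _; rewrite mulr0].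
Qed.

Lemma Vstar_ev (v : P) : Vstar r v -> forall x y, ev x y v = 0.
Proof.
by move=> [_ [Q ->]] x y; rewrite ev_sum big1 // => i _; rewrite evM ev_theta mul0r.
Qed.

(** A carry on the Y-exponents, with the reverse move on the X-exponents, is thus free modulo
    V_r^*. *)
Lemma theta_carry i (a b : vec) : (0 < a i)%N -> (p <= b (ord_pred i))%N ->
  theta C i * mono (a - U_(i))%MM (b - U_(ord_pred i) *+ p)%MM =
  mono a b - mono (a - U_(i) + U_(ord_pred i) *+ p)%MM (carry p i b).
Proof.
move=> ha hb; rewrite /theta.
have eX j n : Xv K j ^+ n = mono (U_(j) *+ n)%MM 0%MM.
  rewrite /Xv mpolyXn; congr 'X_[_]; apply/mnmP => l; rewrite -[l]splitK.
  case: (split l) => k /=; rewrite ?mjoin_l ?mjoin_r mulmnE !mnm1E ?mulmnE ?mnm1E ?mnm0E !eq_shift //.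
have eY j n : Yv K j ^+ n = mono 0%MM (U_(j) *+ n)%MM.
  rewrite /Yv mpolyXn; congr 'X_[_]; apply/mnmP => l; rewrite -[l]splitK.
  case: (split l) => k /=; rewrite ?mjoin_l ?mjoin_r mulmnE !mnm1E ?mulmnE ?mnm1E ?mnm0E !eq_shift //.
rewrite -[Xv K i]expr1 -[Yv K i]expr1 !eX !eY !monoM mulrBl !monoM.
have leU : (U_(i) <= a)%MM.
  by apply/mnm_lepP => j; rewrite mnm1E; case: eqP => // <-.
have m1 : (U_(i) *+ 1 = U_(i))%MM by apply/mnmP => j; rewrite mulmnE muln1.
rewrite m1 !addm0 !add0m; congr (mono _ _ - mono _ _).
- by rewrite addmC submK.
- by rewrite addmC submK ?carry_sub.
- by rewrite addmC.
- by rewrite /carry addmC.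
Qed.

(** There are q + 1 such exponents, as many as points on the projective line over F_q. *)
Definition normal_exponent (b : vec) : bool := is_digits p b || (b == rv).

(* Unless [b] is already reduced or equal to [r], some carry is possible: a
   blocked position forces the next exponent to be maximal, hence large. *)
Lemma exists_carry a b : (a + b)%MM = rv -> ~~ normal_exponent b ->
  exists i, (0 < a i)%N /\ (p <= b (ord_pred i))%N.
Proof.
rewrite negb_or => e /andP [/not_digits [i0 hi0] nb].
case: (pickP [pred i | (0 < a i)%N && (p <= b (ord_pred i))%N]) => [i /andP h|no].
  by exists i.
case/negP: nb; apply/eqP.
have step i : (p <= b (ord_pred i))%N -> a i = 0%N.
  by move=> h; have := no i; rewrite /= h andbT; lia.
have ab i : (a i + b i)%N = r i by have /mnmP/(_ i) := e; rewrite mnmDE mnmE.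
pose o n := Ordinal (ltn_pmod n f_gt0).
have oS n : ord_pred (o n.+1) = o n.
  rewrite -[RHS]ordSK; congr (ord_pred _); apply: val_inj => /=.
  by rewrite -addn1 -modnDml addn1.
have all n : a (o (i0 + n)%N) = 0%N.
  elim: n => [|n IH].
    rewrite addn0 (_ : o i0 = i0); first exact: step.
    by apply: val_inj; rewrite /= modn_small.
  apply: step; rewrite addnS oS; have := ab (o (i0 + n)%N).
  by rewrite IH add0n => ->; exact: r_ge_p.
apply/mnmP => i; rewrite mnmE -ab.
have := all (f - i0 + i)%N; rewrite (_ : o _ = i) => [->|] //.
by apply: val_inj; rewrite /= addnA subnKC ?(ltnW (ltn_ord i0)) // modnDl modn_small.
Qed.

(** Each carry lowers the degree of [b] by p - 1, so carrying stops, and it stops only at a normal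
    exponent. *)
Lemma Vstar_normal a b : (a + b)%MM = rv -> exists b',
  [/\ normal_exponent b', (b' <= rv)%MM & Vstar r (mono a b - mono (rv - b')%MM b')].
Proof.
have [n] := ubnP (mdeg b); elim: n a b => // n IH a b lt e.
have leb : (b <= rv)%MM by rewrite -e lem_addl.
case: (boolP (normal_exponent b)) => [nb|/(exists_carry e) [i [ha hb]]].
  exists b; split=> //; rewrite -{1}e addmK subrr; exact: Vstar0.
have dg := mdeg_carry p_gt1 hb.
set a' := (a - U_(i) + U_(ord_pred i) *+ p)%MM.
have leU : (U_(i) <= a)%MM.
  by apply/mnm_lepP => j; rewrite mnm1E; case: eqP => // <-.
have e' : (a' + carry p i b)%MM = rv.
  apply/mnmP => j; have /mnmP/(_ j) := e; have /mnm_lepP/(_ j) := leU.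
  have /mnm_lepP/(_ j) := carry_sub hb; rewrite /a' /carry !mnmDE !mnmBE.
  by clear; lia.
have [|b' [nb' le' vs]] := IH a' (carry p i b) _ e'.
  by have := p_gt1; move: lt; rewrite dg; clear; lia.
exists b'; split=> //.
rewrite -[mono a b](subrK (mono a' (carry p i b))) -addrA.
apply: VstarD => //; rewrite -theta_carry //; split.
  rewrite theta_carry //; apply: VB; exact: Vr_mono.
exists (fun j => if j == i then mono (a - U_(i))%MM (b - U_(ord_pred i) *+ p)%MM else 0).
by rewrite (bigD1 i) //= eqxx big1 ?addr0 // => j /negPf ->; rewrite mulr0.
Qed.

Lemma digits_le_r b : is_digits p b -> (b <= rv)%MM.
Proof.
move=> /forallP h; apply/mnm_lepP => i; rewrite mnmE.
by rewrite (leq_trans (ltnW (h i))) ?r_ge_p.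
Qed.

(** Because 0^0 = 1, exponents congruent modulo q - 1 give the same function only when both are
    positive; this is the purpose of the positivity facts here and below. *)
Lemma wt_rB_gt0 b : is_digits p b -> (0 < wt (rv - b)%MM)%N.
Proof.
move=> /forallP h; apply: wt_gt0; first exact: p_gt1.
apply/eqP => /mnmP/(_ (Ordinal f_gt0)); rewrite mnm0E mnmBE mnmE.
by have := h (Ordinal f_gt0); have := r_ge_p (Ordinal f_gt0); lia.
Qed.

Lemma Vstar_reduce (v : P) : Vr r v -> exists (c : 'I_q -> K) (c0 : K),
  Vstar r (v - (\sum_(n < q) c n *: mono (rv - digits p f n)%MM (digits p f n)
                + c0 *: mono 0%MM rv)).
Proof.
move=> hv.
pose red u := exists (c : 'I_q -> K) (c0 : K),
  Vstar r (u - (\sum_(n < q) c n *: mono (rv - digits p f n)%MM (digits p f n)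
                + c0 *: mono 0%MM rv)).
have red0 : red 0.
  exists (fun=> 0), 0; rewrite scale0r addr0 big1 ?subrr => [|n _]; last by rewrite scale0r.
  exact: Vstar0.
have redD u w : red u -> red w -> red (u + w).
  move=> [c [c0 h]] [d [d0 h']]; exists (fun n => c n + d n), (c0 + d0).
  have := VstarD h h'; congr Vstar.
  rewrite addrACA -opprD; congr (_ - _); rewrite addrACA; congr (_ + _).
    by rewrite -big_split; apply: eq_bigr => n _; rewrite scalerDl.
  by rewrite scalerDl.
have redZ a u : red u -> red (a *: u).
  move=> [c [c0 h]]; exists (fun n => a * c n), (a * c0).
  have := VstarZ a h; congr Vstar; rewrite scalerBr scalerDr scaler_sumr scalerA.
  by congr (_ - (_ + _)); apply: eq_bigr => n _; rewrite scalerA.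
rewrite -/(red v) (pol_mono v) big_seq; elim/big_ind: _ => // m hm.
apply: redZ.
have e : (expX m + expY m)%MM = rv by have /V_fun/VP := hv; exact.
have [b [/orP [hb|/eqP ->] le vs]] := Vstar_normal e.
  exists (fun n => (n == Ordinal (wt_lt p_gt1 hb))%:R), 0.
  rewrite scale0r addr0 (bigD1 (Ordinal (wt_lt p_gt1 hb))) //= eqxx scale1r.
  by rewrite (digits_wt p_gt1 hb) big1 ?addr0 // => n /negPf ->; rewrite scale0r.
exists (fun=> 0), 1; rewrite scale1r big1 ?add0r => [|n _]; last by rewrite scale0r.
by move: vs; rewrite (_ : rv - rv = 0)%MM //; apply/mnmP => i; rewrite mnmBE subnn mnm0E.
Qed.

(** The normal forms are linearly independent as functions: at (0, 1) only Y^r is nonzero, and on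
    the line x = 1 the others restrict to the powers y^n with n < q. *)
Lemma ev_Vstar (v : P) : Vr r v -> (forall x y, ev x y v = 0) -> Vstar r v.
Proof.
move=> hv ev0; have [c [c0 h]] := Vstar_reduce hv.
pose w := \sum_(n < q) c n *: mono (rv - digits p f n)%MM (digits p f n) + c0 *: mono 0%MM rv.
rewrite -/w in h.
have evw x y : ev x y w = 0.
  by have := Vstar_ev h x y; rewrite evB ev0 sub0r => /eqP; rewrite oppr_eq0 => /eqP.
have digs n : is_digits p (digits p f n) by exact: digits_lt p_gt1 _.
have evwE x y : ev x y w =
    \sum_(n < q) c n * (io x ^+ wt (rv - digits p f n)%MM * io y ^+ n) + c0 * io y ^+ wt rv.
  rewrite /w evD evZ ev_mono wt0 expr0 mul1r ev_sum; congr (_ + _).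
  by apply: eq_bigr => n _; rewrite evZ ev_mono wt_digits ?p_gt1.
have c00 : c0 = 0.
  have := evw 0 1; rewrite evwE rmorph1 expr1n mulr1 rmorph0 big1 ?add0r // => n _.
  by rewrite expr0n gtn_eqF ?wt_rB_gt0 // mul0r mulr0.
have cn n : c n = 0.
  (* The function y -> w(1, y) as a polynomial of degree below q; it vanishes at the q elements of
     F_q. *)
  pose g := \poly_(i < q) (if insub i is Some n then c n else 0).
  have g0 : g = 0.
    apply/eqP/negPn/negP => nz.
    have := @max_poly_roots K g [seq io x | x <- enum F] nz _ _.
    rewrite size_map -cardT Fq_card ltnNge size_poly => /(_ _ _)/wrap [] //.
      apply/allP => _ /mapP [y _ ->]; rewrite rootE horner_poly.
      have := evw 1 y; rewrite evwE c00 mul0r addr0 => e; apply/eqP; rewrite -[RHS]e.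
      by apply: eq_bigr => k _; rewrite valK rmorph1 expr1n mul1r.
    by rewrite map_inj_uniq ?enum_uniq //; exact: fmorph_inj.
  by have := congr1 (fun h : {poly K} => h`_n) g0; rewrite coef_poly ltn_ord valK coef0.
have w0 : w = 0.
  by rewrite /w c00 scale0r addr0 big1 // => n _; rewrite cn scale0r.
by move: h; rewrite w0 subr0.
Qed.
End Evaluation.

(** * Two by two matrices and auxiliary facts *)

Section TwoByTwo.
Variable R : comNzRingType.

Definition mk2 (a b c d : R) : 'M[R]_2 :=
  \matrix_(i, j) if i == 0 then if j == 0 then a else b else if j == 0 then c else d.

Lemma mul2E (g h : 'M[R]_2) i j : (g *m h) i j = g i 0 * h 0 j + g i 1 * h 1 j.
Proof.
rewrite mxE big_ord_recl big_ord_recl big_ord0 addr0.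
by rewrite (_ : lift ord0 ord0 = 1) //; apply: val_inj.
Qed.

Lemma det2 (g : 'M[R]_2) : \det g = g 0 0 * g 1 1 - g 0 1 * g 1 0.
Proof.
rewrite (expand_det_row _ 0) big_ord_recl big_ord_recl big_ord0 addr0.
rewrite (_ : lift ord0 ord0 = 1); last exact: val_inj.
rewrite /cofactor !det_mx11 !mxE /= addn0 addn1 expr0 expr1 mul1r mulN1r mulrN.
by congr (_ * g _ _ - _ * g _ _); apply: val_inj.
Qed.

Lemma mx2P (g h : 'M[R]_2) :
  g 0 0 = h 0 0 -> g 0 1 = h 0 1 -> g 1 0 = h 1 0 -> g 1 1 = h 1 1 -> g = h.
Proof.
move=> h1 h2 h3 h4; apply/matrixP => i j.
have o (k : 'I_2) : k = 0 \/ k = 1.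
  by case: k => [[|[|k]]] // lt; [left | right]; apply: val_inj.
by case: (o i) => ->; case: (o j) => ->.
Qed.

Lemma det_mk2 a b c d : \det (mk2 a b c d) = a * d - b * c.
Proof. by rewrite det2 !mxE. Qed.
End TwoByTwo.

Lemma sub_subK (V : zmodType) (x y z : V) : x - (x - y) - (y - z) = z.
Proof. by rewrite !subKr. Qed.

Lemma seq_argmax (T : eqType) (g : T -> nat) (s : seq T) : s != [::] ->
  exists2 m, m \in s & forall n, n \in s -> (g n <= g m)%N.
Proof.
elim: s => // x s IH _; have [->|/IH [m hm mx]] := eqVneq s [::].
  by exists x; rewrite ?inE // => n; rewrite inE => /eqP ->.
case: (leqP (g x) (g m)) => h; [exists m | exists x]; rewrite ?inE ?eqxx ?hm ?orbT // => n.
  by rewrite inE => /predU1P [->|/mx].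
rewrite inE => /predU1P [->//|/mx h']; exact: leq_trans h' (ltnW h).
Qed.

Lemma prime_ndvd_bin p n k : prime p -> (n < p)%N -> (k <= n)%N -> ~~ (p %| 'C(n, k))%N.
Proof.
move=> pp lt le; have nf m : (m < p)%N -> ~~ (p %| m`!)%N.
  elim: m => [|m IH] h; first by rewrite dvdn1 gtn_eqF ?prime_gt1.
  by rewrite factS Euclid_dvdM // negb_or gtnNdvd // IH // ltnW.
apply: contra (nf n lt) => h; rewrite -(bin_fact le); exact: dvdn_mulr.
Qed.

(** * The digit filtration inside the socle filtration of Q *)

Section SocleLayers.
Variables (p f : nat) (S : unramified p f) (C : coefficients S).
Hypothesis p_prime : prime p.
Hypothesis f_gt0 : (0 < f)%N.
Local Notation q := (p ^ f)%N.
Local Notation F := (Fq S).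
Local Notation K := (kbar C).
Local Notation io := (Fq_kbar C).
Local Notation P := (pol f K).
Local Notation vec := 'X_{1..f}.
Local Notation mono := (@mono f K).
Local Notation wt := (@wt p f).
Variable r : 'I_f -> nat.
Hypothesis r_gt : forall i, (p ^ f + p - 2 < r i)%N.
Local Notation rv := [multinom r i | i < f].
Hypothesis r_neq0 : wt rv != 0 %[mod q.-1].
Let p_gt1 : (1 < p)%N := prime_gt1 p_prime.

Lemma qm1_gt0 : (0 < q.-1)%N.
Proof. by have := card_gt1 (Fq_card S); clear; lia. Qed.

Definition dvec : vec := digits p f (wt rv %% q.-1).

Lemma dvec_digits : is_digits p dvec.
Proof. exact: digits_lt. Qed.

Lemma wt_dvec : wt dvec = (wt rv %% q.-1)%N.
Proof.
rewrite wt_digits // (leq_trans (ltn_pmod _ qm1_gt0)) // leq_pred //.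
Qed.

Lemma wt_dvec_mod : wt dvec = wt rv %[mod q.-1].
Proof. by rewrite wt_dvec modn_mod. Qed.

Lemma wt_dvec_neq0 : wt dvec != 0 %[mod q.-1].
Proof. by rewrite wt_dvec_mod. Qed.

(** Here [w] may have any multidegree and stands for the elements of V_r with the same function. For
    [w] in V_r and an [ev_module] this is plain membership ([ev_inE]). *)
Definition ev_in (U : P -> Prop) (w : P) : Prop :=
  exists2 v, U v & forall x y, ev x y v = ev x y w.

(** These are the submodules of V_r that are determined by their functions on F_q^2. *)
Definition ev_module (U : P -> Prop) : Prop :=
  is_submodule r U /\ (forall v, Vstar r v -> U v).

Lemma ev_in_sub (U U' : P -> Prop) w : (forall v, U v -> U' v) -> ev_in U w -> ev_in U' w.
Proof. by move=> h [v /h hv e]; exists v. Qed.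

Lemma ev_in_eq (U : P -> Prop) w w' : (forall x y, ev x y w = ev x y w') ->
  ev_in U w -> ev_in U w'.
Proof. by move=> h [v hv e]; exists v => // x y; rewrite e h. Qed.

Lemma ev_in_of (U : P -> Prop) v : U v -> ev_in U v.
Proof. by move=> h; exists v. Qed.

Lemma ev_module_Vr : ev_module (Vr r).
Proof.
split; last by move=> v [].
split=> //; [exact: V0 | by move=> *; exact: VD | by move=> *; exact: VZ | ].
by move=> *; exact: V_actGamma.
Qed.

Section Module.
Variable U : P -> Prop.
Hypothesis hU : ev_module U.

Lemma ev_inE v : Vr r v -> ev_in U v -> U v.
Proof.
have [[UV U0 UD UZ UA] Us] := hU; move=> hv [u hu e].
rewrite -(subrK u v); apply: UD => //; apply: Us; apply: ev_Vstar => //.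
  apply: VB => //; exact: UV.
by move=> x y; rewrite evB e subrr.
Qed.

Lemma ev_in0 : ev_in U 0.
Proof. by have [[]] := hU => _ h *; exists 0. Qed.

Lemma ev_inD u w : ev_in U u -> ev_in U w -> ev_in U (u + w).
Proof.
have [[UV U0 UD UZ UA] Us] := hU; move=> [a ha ea] [b hb eb].
by exists (a + b); [exact: UD | move=> x y; rewrite !evD ea eb].
Qed.

Lemma ev_inZ c w : ev_in U w -> ev_in U (c *: w).
Proof.
have [[UV U0 UD UZ UA] Us] := hU; move=> [a ha ea].
by exists (c *: a); [exact: UZ | move=> x y; rewrite !evZ ea].
Qed.

Lemma ev_inB u w : ev_in U u -> ev_in U w -> ev_in U (u - w).
Proof. by move=> hu hw; rewrite -[- w]scaleN1r; apply: ev_inD => //; exact: ev_inZ. Qed.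

Lemma ev_in_sum (I : eqType) (s : seq I) (Q : pred I) (G : I -> P) :
  (forall i, i \in s -> Q i -> ev_in U (G i)) -> ev_in U (\sum_(i <- s | Q i) G i).
Proof.
move=> h; rewrite big_seq_cond; elim/big_ind: _ => [|*|i /andP []].
- exact: ev_in0.
- exact: ev_inD.
- exact: h.
Qed.

Lemma ev_in_act g w : g \in unitmx -> ev_in U w -> ev_in U (actGamma 0 g w).
Proof.
have [[UV U0 UD UZ UA] Us] := hU; move=> ug [a ha ea].
by exists (actGamma 0 g a); [exact: UA | move=> x y; rewrite !ev_act].
Qed.
End Module.

Definition upper (c : F) : 'M[F]_2 := mk2 1 c 0 1.
Definition lower (c : F) : 'M[F]_2 := mk2 1 0 c 1.

Lemma upper_unit c : upper c \in unitmx.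
Proof. by rewrite unitmxE det_mk2 mulr0 subr0 mulr1 unitr1. Qed.

Lemma lower_unit c : lower c \in unitmx.
Proof. by rewrite unitmxE det_mk2 mul0r subr0 mulr1 unitr1. Qed.

Lemma mpow_wt (c : K) (j : vec) : mpow (fun i : 'I_f => c ^+ (p ^ i)) j = c ^+ wt j.
Proof. exact: prod_wt. Qed.

Lemma digits_ord (b : vec) : is_digits p b -> forall i, (b i < p)%N.
Proof. by move=> /forallP. Qed.

Lemma io1X n : io 1 ^+ n = 1.
Proof. by rewrite rmorph1 expr1n. Qed.

Lemma io0X n : io 0 ^+ (p ^ n) = 0.
Proof.
rewrite rmorph0 expr0n (_ : p ^ n == 0 = false)%N //.
by apply/negbTE; rewrite -lt0n expn_gt0 prime_gt0.
Qed.

Lemma act_upper c a b : is_digits p b -> actGamma 0 (upper c) (mono a b) =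
  \sum_(j : {ffun 'I_f -> 'I_p})
    ((bin b (vec_of j))%:R * io c ^+ wt (vec_of j)) *:
      mono (a + vec_of j)%MM (b - vec_of j)%MM.
Proof.
move=> /digits_ord hb; rewrite actGamma0 /act subst_mono !mxE /=.
rewrite (eq_bigr (fun i => Xv K i ^+ a i)) => [|i _]; last first.
  by rewrite io1X io0X scale1r scale0r addr0.
rewrite (prod_linear_expandX _ _ hb) mulr_sumr; apply: eq_bigr => j _.
rewrite -scalerAr.
rewrite !mpow_wt io1X mulr1; congr (_ *: _).
by rewrite -mono0r monoM add0m.
Qed.

Lemma act_lower c a b : is_digits p a -> actGamma 0 (lower c) (mono a b) =
  \sum_(j : {ffun 'I_f -> 'I_p})
    ((bin a (vec_of j))%:R * io c ^+ wt (vec_of j)) *: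
      mono (a - vec_of j)%MM (b + vec_of j)%MM.
Proof.
move=> /digits_ord ha; rewrite actGamma0 /act subst_mono !mxE /=.
rewrite [X in _ * X](eq_bigr (fun i => Yv K i ^+ b i)) => [|i _]; last first.
  by rewrite io1X io0X scale1r scale0r add0r.
rewrite (prod_linear_expand _ _ ha) mulr_suml; apply: eq_bigr => j _.
rewrite -scalerAl.
rewrite !mpow_wt io1X mulr1; congr (_ *: _).
by rewrite -mono0l monoM addm0 (addmC b).
Qed.

(* Orthogonality of characters of F_q^* makes these averages of unipotents
   isolate one term of the binomial expansion. *)
Definition avg (u : F -> 'M[F]_2) (J : vec) (w : P) : P :=
  - \sum_(c : F) io c ^+ (q.-1 - wt J) *: actGamma 0 (u c) w.

Lemma avgD u J v w : avg u J (v + w) = avg u J v + avg u J w.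
Proof.
rewrite /avg -opprD -big_split; congr (- _); apply: eq_bigr => c _.
by rewrite actGammaD scalerDr.
Qed.

Lemma avgZ u J a w : avg u J (a *: w) = a *: avg u J w.
Proof.
rewrite /avg scalerN scaler_sumr; congr (- _); apply: eq_bigr => c _.
by rewrite actGammaZ [LHS]scalerA [RHS]scalerA mulrC.
Qed.

Lemma avgB u J v w : avg u J (v - w) = avg u J v - avg u J w.
Proof. by rewrite -[- w]scaleN1r avgD avgZ scaleN1r. Qed.

Lemma avg0 u J : avg u J 0 = 0.
Proof. by rewrite /avg big1 ?oppr0 // => c _; rewrite actGammar0 scaler0. Qed.

Lemma avg_sum u J (I : Type) (s : seq I) (G : I -> P) :
  avg u J (\sum_(i <- s) G i) = \sum_(i <- s) avg u J (G i).
Proof.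
elim: s => [|i s IH]; first by rewrite !big_nil avg0.
by rewrite !big_cons avgD IH.
Qed.

Lemma avg_in U u J w : ev_module U -> (forall c, u c \in unitmx) -> ev_in U w ->
  ev_in U (avg u J w).
Proof.
move=> hU hu hw; rewrite /avg -scaleN1r; apply: ev_inZ => //; apply: ev_in_sum => // c _ _.
by apply: ev_inZ => //; exact: ev_in_act.
Qed.

(** The exponent q - 1 - wt J is smaller than q - 1, so its power sum vanishes and subtracting [w]
    from every translate does not change the average. *)
Lemma avg_inv U u J w : ev_module U -> is_digits p J -> J != 0%MM ->
  (forall c, ev_in U (actGamma 0 (u c) w - w)) -> ev_in U (avg u J w).
Proof.
move=> hU dJ nJ h.
have -> : avg u J w = - \sum_(c : F) io c ^+ (q.-1 - wt J) *: (actGamma 0 (u c) w - w).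
  rewrite /avg; congr (- _).
  under [RHS]eq_bigr do rewrite scalerBr.
  rewrite sumrB -scaler_suml sum_io // (_ : _ && _ = false) ?oppr0 ?scale0r ?subr0 //.
  have := wt_gt0 p_gt1 nJ; have := qm1_gt0; move: (wt J) (q.-1) => a b b0 a0.
  by case: posnP => //= c0; apply/negbTE/negP => /(dvdn_leq c0); move: b0 a0; clear; lia.
rewrite -scaleN1r; apply: ev_inZ => //; apply: ev_in_sum => // c _ _.
exact: ev_inZ.
Qed.

(** The total exponent is below 2(q - 1), so q - 1 is the only positive multiple of q - 1 that it
    can reach, exactly when the two weights agree. *)
Lemma sum_io_digits (j J : vec) : is_digits p j -> is_digits p J -> J != 0%MM ->
  \sum_(c : F) io c ^+ (q.-1 - wt J) * io c ^+ wt j = - (j == J)%:R.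
Proof.
move=> dj dJ nJ; under eq_bigr do rewrite -exprD.
rewrite sum_io //; congr (- _%:R); congr nat_of_bool.
have J0 := wt_gt0 p_gt1 nJ; have := wt_lt p_gt1 dj; have := wt_lt p_gt1 dJ => lJ lj.
apply/andP/eqP => [[n0 /dvdnP [k ek]]|->].
  apply: (wt_inj p_gt1) => //.
  move: ek n0 J0 lj lJ; have := qm1_gt0; move: (wt J) (wt j) q => a b Q.
  case: k => [|[|k]]; rewrite ?mul0n ?mul1n ?mulSn; clear; lia.
move: J0 lJ; move: (wt J) q qm1_gt0 => a Q h a0 h'.
by rewrite subnK ?dvdnn //; clear -h'; lia.
Qed.

Lemma vec_of_digits (j : {ffun 'I_f -> 'I_p}) : is_digits p (vec_of j).
Proof. by apply/forallP => i; rewrite mnmE. Qed.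

Lemma digits_vec_of J : is_digits p J -> exists j : {ffun 'I_f -> 'I_p}, vec_of j = J.
Proof.
move=> /forallP h; exists [ffun i => Ordinal (h i)].
by apply/mnmP => i; rewrite mnmE ffunE.
Qed.

Lemma avg_expand (u : F -> 'M[F]_2) J w (B : vec -> nat) (M : vec -> P) :
  is_digits p J -> J != 0%MM ->
  (forall c, actGamma 0 (u c) w =
     \sum_(j : {ffun 'I_f -> 'I_p}) ((B (vec_of j))%:R * io c ^+ wt (vec_of j)) *: M (vec_of j)) ->
  avg u J w = (B J)%:R *: M J.
Proof.
move=> dJ nJ h; have [j0 ej] := digits_vec_of dJ; rewrite /avg.
under eq_bigr do rewrite h scaler_sumr.
rewrite exchange_big /= (bigD1 j0) //= [X in _ + X]big1 ?addr0 => [|j ne]; last first.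
  under eq_bigr do rewrite scalerA mulrCA -scalerA.
  rewrite -scaler_sumr -scaler_suml sum_io_digits ?vec_of_digits //.
  rewrite -ej (inj_eq (@vec_of_inj f p)) (negPf ne) oppr0 scale0r scaler0 //.
under eq_bigr do rewrite scalerA mulrCA -scalerA.
rewrite -scaler_sumr -scaler_suml sum_io_digits ?vec_of_digits // ej eqxx.
by rewrite scaleN1r scalerN opprK.
Qed.

Lemma avg_upper J a b : is_digits p b -> is_digits p J -> J != 0%MM ->
  avg upper J (mono a b) = (bin b J)%:R *: mono (a + J)%MM (b - J)%MM.
Proof.
move=> db dJ nJ.
apply: (avg_expand (B := bin b) (M := fun J => mono (a + J)%MM (b - J)%MM)) => // c.
exact: act_upper.
Qed.

Lemma avg_lower J a b : is_digits p a -> is_digits p J -> J != 0%MM ->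
  avg lower J (mono a b) = (bin a J)%:R *: mono (a - J)%MM (b + J)%MM.
Proof.
move=> db dJ nJ.
apply: (avg_expand (B := bin a) (M := fun J => mono (a - J)%MM (b + J)%MM)) => // c.
exact: act_lower.
Qed.

Lemma bin_neq0 (b J : vec) : is_digits p b -> (J <= b)%MM -> (bin b J)%:R != 0 :> K.
Proof.
move=> /digits_ord db /mnm_lepP le; rewrite /bin natr_prod; apply/prodf_neq0 => i _.
rewrite -(dvdn_pcharf (pchar_kbar C p_prime)); exact: prime_ndvd_bin.
Qed.

(** * One multidegree modulo the lower levels *)

Section Layer.
Variables (W : P -> Prop) (lam : vec).
Hypothesis hW : ev_module W.
Hypothesis W_carry : forall a b : vec, (a + b)%MM = lam ->
  ~~ (is_digits p a && is_digits p b) -> ev_in W (mono a b).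

(** The least Y-exponent whose complementary X-exponent consists of digits; truncated subtraction
    gives 0 where [lam i < p]. *)
Definition bmin : vec := [multinom lam i - p.-1 | i < f].
(** Highest weight vector of the layer: where the Y-exponent is positive the X-exponent is already p
    - 1, so upper unipotents only add monomials in [W]. *)
Definition Nmin : P := mono (lam - bmin)%MM bmin.

Lemma amax_digits : is_digits p (lam - bmin)%MM.
Proof. by apply/forallP => i; rewrite mnmBE mnmE; move: p_gt1; clear; lia. Qed.

Lemma bmin_min a b : (a + b)%MM = lam -> is_digits p a -> (bmin <= b)%MM.
Proof.
move=> e /forallP da; apply/mnm_lepP => i; rewrite mnmE -e mnmDE.
by have := da i; clear; lia.
Qed.

Lemma digits_sub (b c : vec) : is_digits p b -> is_digits p (b - c)%MM.
Proof.
move=> /forallP h; apply/forallP => i; rewrite mnmBE.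
exact: leq_ltn_trans (leq_subr _ _) (h i).
Qed.

(** Averages over lower unipotents move exponents from X to Y with binomial coefficients prime to
    p. *)
Lemma Nmin_generates : ev_in W Nmin ->
  forall a b, (a + b)%MM = lam -> ev_in W (mono a b).
Proof.
move=> hN a b e; case: (boolP (is_digits p a && is_digits p b)); last exact: W_carry.
move=> /andP [da db]; have le := bmin_min e da.
have [J0|nJ] := eqVneq (b - bmin)%MM 0%MM.
  have eb : b = bmin by rewrite -(submK le) J0 add0m.
  by move: hN; rewrite /Nmin -e -eb addmK.
have := avg_in (b - bmin)%MM hW lower_unit hN.
rewrite /Nmin avg_lower ?amax_digits ?digits_sub //.
have le2 : (b - bmin <= lam - bmin)%MM.
  by apply/mnm_lepP => i; rewrite !mnmBE leq_sub2r // -e mnmDE leq_addl.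
rewrite (_ : lam - bmin - (b - bmin) = a)%MM; last first.
  apply/mnmP => i; have /mnm_lepP/(_ i) := le; have /mnmP/(_ i) := e; rewrite !mnmBE mnmDE.
  by clear; lia.
rewrite (addmC bmin) submK // => /(ev_inZ hW (bin (lam - bmin)%MM (b - bmin)%MM)%:R^-1).
by rewrite scalerA mulVf ?scale1r // bin_neq0 ?amax_digits.
Qed.

(** The first alternative occurs when all digit monomials of [w] have Y-exponent [bmin]. Otherwise
    let b be a Y-exponent of largest degree among them and J = b - bmin: a digit monomial surviving
    the average modulo [W] has a Y-exponent dominating b, hence equal to b. *)
Lemma layer_extract w : V lam w ->
  (exists c, ev_in W (w - c *: Nmin)) \/
  (exists J c, [/\ is_digits p J, J != 0%MM, c != 0 & ev_in W (avg upper J w - c *: Nmin)]).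
Proof.
move=> /VP hw.
pose dig (m : 'X_{1..f + f}) := is_digits p (expX m) && is_digits p (expY m).
pose L := [seq m <- msupp w | dig m].
pose w' := \sum_(m <- L) w@_m *: mono (expX m) (expY m).
have Ww : ev_in W (w - w').
  rewrite {1}(pol_mono w) (bigID dig) /= /w' /L big_filter addrAC subrr add0r.
  apply: ev_in_sum => // m hm nd; apply: ev_inZ => //; apply: W_carry => //; exact: hw.
have hL m : m \in L -> [/\ m \in msupp w, is_digits p (expX m), is_digits p (expY m)
    & (expX m + expY m)%MM = lam].
  by rewrite mem_filter => /andP [/andP [h1 h2] h]; split => //; exact: hw.
case: (boolP (all (fun m => expY m == bmin) L)) => [/allP alleq|/allPn [m1 m1L m1b]].
  left; exists (\sum_(m <- L) w@_m).
  suff <- : w' = (\sum_(m <- L) w@_m) *: Nmin by [].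
  rewrite /w' scaler_suml [LHS]big_seq [RHS]big_seq; apply: eq_bigr => m hm.
  have [_ _ _ e] := hL m hm; rewrite /Nmin -(eqP (alleq m hm)).
  by rewrite -e addmK.
have Ln : L != [::] by apply: contraTneq m1L => ->.
have [m0 m0L m0max] := seq_argmax (fun m => mdeg (expY m)) Ln.
have [m0s da0 db0 e0] := hL m0 m0L.
have le0 := bmin_min e0 da0.
have nJ : (expY m0 - bmin)%MM != 0%MM.
  apply: contraNneq m1b => J0; have [_ da1 _ e1] := hL m1 m1L.
  have eb : expY m0 = bmin by rewrite -(submK le0) J0 add0m.
  have := m0max m1 m1L; have le1 := bmin_min e1 da1.
  rewrite eb -(submK le1) mdegD => h.
  have /eqP : mdeg (expY m1 - bmin) = 0%N by move: h; clear; lia.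
  by rewrite mdeg_eq0 => /eqP ->; rewrite add0m.
right; exists (expY m0 - bmin)%MM; set J := (expY m0 - bmin)%MM.
have dJ : is_digits p J by exact: digits_sub.
exists (w@_m0 * (bin (expY m0) J)%:R); split => //.
  by rewrite mulf_neq0 ?bin_neq0 // ?lem_subr // -mcoeff_msupp.
have -> : avg upper J w = avg upper J (w - w') + avg upper J w' by rewrite -avgD subrK.
rewrite -addrA; apply: ev_inD => //.
  by apply: avg_in => //; exact: upper_unit.
rewrite /w' avg_sum (bigD1_seq m0) ?filter_uniq ?msupp_uniq //=.
rewrite avgZ avg_upper // (_ : expY m0 - J = bmin)%MM; last first.
  by apply/mnmP => i; have /mnm_lepP/(_ i) := le0; rewrite !mnmBE; clear; lia.
rewrite (_ : expX m0 + J = lam - bmin)%MM; last first.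
  apply/mnmP => i; have /mnm_lepP/(_ i) := le0; rewrite -e0 mnmDE !mnmBE mnmDE.
  by clear; lia.
rewrite scalerA -/Nmin.
rewrite [X in ev_in W X]addrAC.
rewrite subrr add0r; apply: ev_in_sum => // m mL ne.
have [ms da db e] := hL m mL; rewrite avgZ avg_upper //; apply: ev_inZ => //.
case: (boolP (J <= expY m)%MM) => [leJ|/vbin_small ->]; last first.
  by rewrite scale0r; exact: ev_in0.
apply: ev_inZ => //; apply: W_carry.
  by rewrite -addmA (addmC J) submK.
apply: contra ne => /andP [dX dY].
have e' : (expX m + J + (expY m - J))%MM = lam by rewrite -addmA (addmC J) submK.
have := bmin_min e' dX => le1.
have le2 : (expY m0 <= expY m)%MM.
  apply/mnm_lepP => i; have /mnm_lepP/(_ i) := le1; have /mnm_lepP/(_ i) := leJ.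
  by have /mnm_lepP/(_ i) := le0; rewrite /J !mnmBE; clear; lia.
have eY : expY m = expY m0.
  have := m0max m mL; rewrite -(submK le2) mdegD => h.
  have /eqP : mdeg (expY m - expY m0) = 0%N by move: h; clear; lia.
  by rewrite mdeg_eq0 => /eqP ->; rewrite add0m.
have eX : expX m = expX m0.
  by rewrite -(addmK (expY m) (expX m)) e -e0 eY addmK.
by rewrite -(mjoinK m) -(mjoinK m0) eX eY.
Qed.
End Layer.

Lemma Xr0 : Xr r (0 : P).
Proof. by exists [::]; split=> //; rewrite big_nil. Qed.

Lemma XrD (u v : P) : Xr r u -> Xr r v -> Xr r (u + v).
Proof.
move=> [s [hs ->]] [t [ht ->]]; exists (s ++ t); split; last by rewrite big_cat.
by move=> c; rewrite mem_cat => /orP [/hs|/ht].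
Qed.

Lemma XrZ a (v : P) : Xr r v -> Xr r (a *: v).
Proof.
move=> [s [hs ->]]; exists [seq (a * c.1, c.2) | c <- s]; split.
  by move=> c /mapP [c' /hs h ->].
by rewrite big_map scaler_sumr; apply: eq_bigr => c _; rewrite [LHS]scalerA.
Qed.

Lemma Xr_act g (v : P) : g \in unitmx -> Xr r v -> Xr r (actGamma 0 g v).
Proof.
move=> ug [s [hs ->]]; exists [seq (c.1, g *m c.2) | c <- s]; split.
  by move=> c /mapP [c' /hs h ->]; rewrite unitmx_mul ug.
rewrite big_map actGamma_sum; apply: eq_bigr => c _.
by rewrite actGammaZ actGamma_comp.
Qed.

Lemma prodX_mono : \prod_i Xv K i ^+ r i = mono rv 0%MM.
Proof. by rewrite mono0r; apply: eq_bigr => i _; rewrite mnmE. Qed.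

Lemma prodX_Xr : Xr r (\prod_i Xv K i ^+ r i).
Proof.
exists [:: (1, 1%:M)]; split; first by move=> c; rewrite inE => /eqP ->; rewrite unitmx1.
rewrite big_seq1 scale1r /= actGamma0 /act.
rewrite (eq_subst (QX := @Xv f K) (QY := @Yv f K)) ?subst_id // => i; rewrite !mxE /=.
  by rewrite io1X io0X scale1r scale0r addr0.
by rewrite io1X io0X scale1r scale0r add0r.
Qed.

Lemma Xr_Vr (v : P) : Xr r v -> Vr r v.
Proof.
move=> [s [hs ->]]; apply: V_sum => c _; apply/VZ/V_actGamma.
by rewrite prodX_mono; apply: Vr_mono; rewrite addm0.
Qed.

Lemma Vstar_act g (v : P) : Vstar r v -> Vstar r (actGamma 0 g v).
Proof.
move=> hv; apply: ev_Vstar => //; first by apply: V_actGamma; case: hv.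
by move=> x y; rewrite ev_act // (Vstar_ev p_prime hv).
Qed.

Lemma soc_module W : ev_module W -> ev_module (soc_over r W).
Proof.
move=> [[WV W0 WD WZ WA] Ws]; split; last first.
  by move=> v hv U' _ h _; apply/h/Ws.
split.
- move=> v h; apply: h; first by case: ev_module_Vr.
    by move=> w; exact: WV.
  by move=> U [[]].
- by move=> U' [].
- by move=> v w hv hw U' sU h1 h2; case: (sU) => _ _ D _ _; apply: D; [exact: hv | exact: hw].
- by move=> a v hv U' sU h1 h2; case: (sU) => _ _ _ Z _; apply: Z; exact: hv.
- by move=> g v ug hv U' sU h1 h2; case: (sU) => _ _ _ _ A; apply: A => //; exact: hv.
Qed.

Lemma Qfil_module n : ev_module (Qfil r n).
Proof.
elim: n => [|n IH]; last exact: soc_module.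
split; last by move=> v hv; exists v, 0; split; rewrite ?addr0 //; exact: Xr0.
split.
- by move=> v [v1 [v2 [[h1 _] /Xr_Vr h2 ->]]]; exact: VD.
- by exists 0, 0; split; rewrite ?addr0 //; [exact: Vstar0 | exact: Xr0].
- move=> v w [v1 [v2 [h1 h2 ->]]] [w1 [w2 [k1 k2 ->]]]; exists (v1 + w1), (v2 + w2).
  by split; [exact: VstarD | exact: XrD | rewrite addrACA].
- move=> a v [v1 [v2 [h1 h2 ->]]]; exists (a *: v1), (a *: v2).
  by split; [exact: VstarZ | exact: XrZ | rewrite scalerDr].
- move=> g v ug [v1 [v2 [h1 h2 ->]]]; exists (actGamma 0 g v1), (actGamma 0 g v2).
  by split; [exact: Vstar_act | exact: Xr_act | rewrite actGammaD].
Qed.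

Lemma Qfil_sub n (v : P) : Qfil r n v -> Qfil r n.+1 v.
Proof. by move=> h U' _ h1 _; exact: h1. Qed.

Lemma Qfil_sub0 n (v : P) : Qfil r 0 v -> Qfil r n v.
Proof. by move=> h; elim: n => // n; exact: Qfil_sub. Qed.

Lemma io_carry (x : F) i (a : vec) : (p <= a (ord_pred i))%N ->
  io x ^+ wt (carry p i a) = io x ^+ wt a.
Proof.
move=> h; apply: io_eqmod => //; last exact: wt_carry.
  by apply: wt_gt0 => //; rewrite /carry mnmD_eq0 mnm1_eq0 andbF.
apply: wt_gt0 => //; apply: contraTneq h => ->; rewrite mnm0E.
by rewrite leqn0 gtn_eqF ?prime_gt0.
Qed.

(** The digit vector defining the same function as [a]. For [a] nonzero its weight is taken in
    [1, q - 1], not in [0, q - 2], because x^0 and x^(q-1) differ at 0; hence the shift by one. *)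
Definition dnorm (a : vec) : vec :=
  if a == 0%MM then 0%MM else digits p f ((wt a).-1 %% q.-1).+1.

Lemma dnorm_digits a : is_digits p (dnorm a).
Proof.
rewrite /dnorm; case: eqP => _; last exact: digits_lt.
by apply/forallP => i; rewrite mnm0E prime_gt0.
Qed.

Lemma wt_dnorm_mod a : wt (dnorm a) = wt a %[mod q.-1].
Proof.
rewrite /dnorm; case: eqVneq => [->//|nz].
rewrite wt_digits //; last by have := ltn_pmod (wt a).-1 qm1_gt0; clear; lia.
by rewrite -addn1 modnDml addn1 prednK // wt_gt0.
Qed.

Lemma io_dnorm (x : F) a : io x ^+ wt (dnorm a) = io x ^+ wt a.
Proof.
have := wt_dnorm_mod a; rewrite /dnorm; case: eqVneq => [->//|nz] e.
apply: io_eqmod => //; last exact: wt_gt0.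
rewrite wt_digits //; by have := ltn_pmod (wt a).-1 qm1_gt0; clear; lia.
Qed.

(** If [a = 0] the function need not vanish on the line x = 0, and Y^r represents it. Otherwise r is
    large enough to leave a positive X-exponent once a digit vector is taken for Y. *)
Lemma ev_in_Vr a b : wt (a + b)%MM = wt rv %[mod q.-1] -> ev_in (Vr r) (mono a b).
Proof.
move=> e; have nz : wt (a + b)%MM != 0 %[mod q.-1] by rewrite e.
have rv0 : (0 < wt rv)%N.
  by rewrite lt0n; apply: contraNneq r_neq0 => ->.
have [a0|na] := eqVneq a 0%MM.
  exists (mono 0%MM rv); first by apply: Vr_mono; rewrite add0m.
  move=> x y; rewrite !ev_mono a0; congr (_ * _).
  move: e nz; rewrite a0 add0m => e nz; apply: io_eqmod => //.
  by rewrite lt0n; apply: contraNneq nz => ->.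
have le := digits_le_r S r_gt (dnorm_digits b).
exists (mono (rv - dnorm b)%MM (dnorm b)); first by apply: Vr_mono; rewrite submK.
move=> x y; rewrite !ev_mono io_dnorm; congr (_ * _).
apply: io_eqmod => //; [exact: wt_rB_gt0 (dnorm_digits b) | exact: wt_gt0 | ].
apply/eqP; rewrite -(eqn_modDr (wt (dnorm b))) -wtD submK // -e wtD.
by rewrite -modnDmr -wt_dnorm_mod modnDmr.
Qed.

(** In multidegree [dvec] all exponents are digits, and the highest weight vector X^dvec has the
    same function as X^r, the generator of X_r. *)
Lemma low_Qfil0 a b : (a + b)%MM = dvec -> ev_in (Qfil r 0) (mono a b).
Proof.
apply: (Nmin_generates (lam := dvec) (Qfil_module 0)) => [a' b' e|].
  move=> /negP []; have /forallP h := dvec_digits.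
  by apply/andP; split; apply/forallP => i; have := h i; rewrite -e mnmDE; clear; lia.
rewrite /Nmin; have -> : bmin dvec = 0%MM.
  apply/mnmP => i; rewrite mnmE mnm0E; have /forallP/(_ i) := dvec_digits.
  by clear; lia.
exists (mono rv 0%MM).
  by rewrite -prodX_mono; exists 0, (\prod_i Xv K i ^+ r i); split; rewrite ?add0r //;
    [exact: Vstar0 | exact: prodX_Xr].
move=> x y; rewrite !ev_mono subm0; congr (_ * _); apply: io_eqmod => //.
- by rewrite lt0n; apply: contraNneq r_neq0 => ->.
- by rewrite lt0n; apply: contraNneq wt_dvec_neq0 => ->.
- by rewrite wt_dvec_mod.
Qed.

(** A carry in either exponent keeps the function and lands one level lower. This supplies the
    hypothesis [W_carry] of the layer computations. *)
Lemma carry_layer (W : P -> Prop) N lam :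
  (forall a b : vec, wt (a + b)%MM = wt rv %[mod q.-1] -> (mdeg (a + b) <= N)%N ->
     ev_in W (mono a b)) ->
  wt lam = wt rv %[mod q.-1] -> (mdeg lam <= N + p.-1)%N ->
  forall a b, (a + b)%MM = lam -> ~~ (is_digits p a && is_digits p b) ->
    ev_in W (mono a b).
Proof.
move=> hW elam dlam a b e; rewrite negb_and => /orP [] /not_digits [i hi].
  apply: (@ev_in_eq _ (mono (carry p i a) b)) => [x y|].
    by rewrite !ev_mono io_carry.
  apply: hW.
    by rewrite wtD -modnDml wt_carry // modnDml -wtD e.
  have := mdeg_carry p_gt1 hi; move: dlam; rewrite -e (mdegD a) (mdegD (carry p i a)).
  by clear; lia.
apply: (@ev_in_eq _ (mono a (carry p i b))) => [x y|].
  by rewrite !ev_mono io_carry.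
apply: hW.
  by rewrite wtD -modnDmr wt_carry // modnDmr -wtD e.
have := mdeg_carry p_gt1 hi; move: dlam; rewrite -e (mdegD a b) (mdegD a (carry p i b)).
by clear; lia.
Qed.

Lemma V_ev_in U lam w : ev_module U ->
  (forall a b, (a + b)%MM = lam -> ev_in U (mono a b)) -> V lam w -> ev_in U w.
Proof.
move=> hU h /VP hw; rewrite (pol_mono w); apply: ev_in_sum => // m hm _.
by apply: ev_inZ => //; apply: h; exact: hw.
Qed.

(** An element outside [W] yields the highest weight vector by [layer_extract], and that vector
    yields the whole layer by [Nmin_generates]. *)
Lemma layer_simple W lam : ev_module W ->
  (forall a b, (a + b)%MM = lam -> ~~ (is_digits p a && is_digits p b) ->
     ev_in W (mono a b)) ->
  forall U', is_submodule r U' -> (forall v, W v -> U' v) ->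
  (exists v w, [/\ U' v, ~ W v, V lam w & ev_in W (v - w)]) ->
  forall w, V lam w -> ev_in U' w.
Proof.
move=> hW Wc U' sU WU [v [w [hv nv hw vw]]].
have hU : ev_module U' by split => // u hu; apply: WU; case: hW => _; exact.
have inU u : ev_in W u -> ev_in U' u by exact: ev_in_sub.
have Vv : Vr r v by case: sU => h _ _ _ _; exact: h.
suff hN : ev_in U' (Nmin lam).
  move=> u; apply: V_ev_in => //; apply: Nmin_generates => // a b e nd.
  exact/inU/Wc.
have cN c : c != 0 -> ev_in U' (c *: Nmin lam) -> ev_in U' (Nmin lam).
  by move=> c0 /(ev_inZ hU c^-1); rewrite scalerA mulVf ?scale1r.
have [[c hc]|[J [c [dJ nJ c0 hc]]]] := layer_extract hW Wc hw.
  apply: (cN c).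
    apply/eqP => c0; apply: nv; apply: (ev_inE hW Vv).
    by move: hc; rewrite c0 scale0r subr0 => /(ev_inD hW vw); rewrite subrK.
  have -> : c *: Nmin lam = v - (v - w) - (w - c *: Nmin lam).
    by rewrite sub_subK.
  apply: ev_inB => //; last exact: inU.
  by apply: ev_inB => //; [exact: ev_in_of | exact: inU].
apply: (cN c) => //.
have -> : c *: Nmin lam = avg upper J v - avg upper J (v - w) - (avg upper J w - c *: Nmin lam).
  by rewrite avgB; exact/esym/sub_subK.
apply: ev_inB => //; last exact: inU.
apply: ev_inB => //; apply: avg_in => //; try exact: upper_unit.
  exact: ev_in_of.
exact: inU.
Qed.

(** Modulo level n, each multidegree of level n + 1 spans a module that is zero or simple, hence
    contained in the socle. *)
Lemma low_Qfil n a b : wt (a + b)%MM = wt rv %[mod q.-1] ->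
  (mdeg (a + b) <= mdeg dvec + n * p.-1)%N -> ev_in (Qfil r n) (mono a b).
Proof.
have pm1 : (0 < p.-1)%N by move: p_gt1; clear; lia.
elim: n a b => [|n IH] a b e le.
  apply: low_Qfil0.
  (* At level 0 no carry is possible, so the multidegree is [dvec] itself. *)
  have [k ek] := mdeg_level p_gt1 dvec_digits wt_dvec_neq0 (etrans e (esym wt_dvec_mod)).
  apply; move: le ek; rewrite mul0n addn0 => le ek; move: le; rewrite ek.
  by case: k {ek} => // k; rewrite mulSn; move: pm1; clear; lia.
have hW := Qfil_module n; set W := Qfil r n in IH hW *.
have le' : (mdeg (a + b) <= mdeg dvec + n * p.-1 + p.-1)%N by move: le; rewrite mulSn; clear; lia.
have Wc := carry_layer IH e le'.
set lam := (a + b)%MM in e Wc.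
have [v hv ev_v] := ev_in_Vr e.
exists v => //.
have vin : ev_in W (v - mono a b).
  by apply: (ev_in_eq _ (ev_in0 hW)) => x y; rewrite evB ev_v subrr /ev meval0.
(* The submodule generated over [W] by the functions of multidegree [lam]; it is simple over [W] as
   soon as [v] is not in [W]. *)
pose Ul u := Vr r u /\ exists2 w, V lam w & ev_in W (u - w).
have Ulv : Ul v by split=> //; exists (mono a b) => //; exact: V_mono.
have [[WV W0 WD WZ WA] Ws] := hW.
have WUl u : W u -> Ul u.
  by move=> hu; split; [exact: WV | exists 0; [exact: V0 | rewrite subr0; exact: ev_in_of]].
have sUl : is_submodule r Ul.
  split; [by move=> u [] | exact: WUl | | | ].
  - move=> u u' [h1 [w h2 h3]] [h1' [w' h2' h3']]; split; first exact: VD.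
    by exists (w + w'); [exact: VD | rewrite opprD addrACA; exact: ev_inD].
  - move=> c u [h1 [w h2 h3]]; split; first exact: VZ.
    by exists (c *: w); [exact: VZ | rewrite -scalerBr; exact: ev_inZ].
  - move=> g u ug [h1 [w h2 h3]]; split; first exact: V_actGamma.
    exists (actGamma 0 g w); first exact: V_actGamma.
    by rewrite -actGammaB; exact: ev_in_act.
move=> U' sU WU simp.
case: (classic (W v)) => [/WU //|nv].
apply: (simp Ul) => //; split => //; first by exists v.
move=> U2 sU2 WU2 U2l; case: (classic (exists2 u, U2 u & ~ W u)) => [[u hu nu]|none].
  right=> u' [Vu' [w' hw' vw']].
  have hU2 : ev_module U2 by split => // z hz; apply/WU2/Ws.
  apply: (ev_inE hU2 Vu'); rewrite -(subrK w' u'); apply: ev_inD => //.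
    exact: (ev_in_sub WU2).
  have [_ [w hw uw]] := U2l u hu.
  apply: (layer_simple hW Wc sU2 WU2) hw'; by exists u, w.
by left=> u hu; apply: NNPP => nu; apply: none; exists u.
Qed.

(** * The top layer and the cosocle *)

Local Notation Wtop := (Qfil r f.-1 : P -> Prop).
(** The only multidegree of level f that is a sum of two digit vectors ([mdeg_level_top]). *)
Definition lamtop : vec := [multinom p.-1 + dvec i | i < f].
Definition Mtop : P := mono (rv - dvec)%MM dvec.

Lemma bmin_top : bmin lamtop = dvec.
Proof. by apply/mnmP => i; rewrite mnmE mnmE addKn. Qed.

Lemma amax_top : (lamtop - dvec)%MM = [multinom p.-1 | i < f].
Proof. by apply/mnmP => i; rewrite mnmBE !mnmE addnK. Qed.

Lemma lamtopE : ([multinom p.-1 | i < f] + dvec)%MM = lamtop.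
Proof. by apply/mnmP => i; rewrite mnmDE !mnmE. Qed.

Lemma mdeg_lamtop : mdeg lamtop = (mdeg dvec + f * p.-1)%N.
Proof.
rewrite -lamtopE mdegD addnC; congr (_ + _)%N; rewrite mdegE.
by rewrite (eq_bigr (fun=> p.-1)) ?sum_nat_const ?card_ord // => i _; rewrite mnmE.
Qed.

Lemma wt_lamtop : wt lamtop = wt rv %[mod q.-1].
Proof. by rewrite -lamtopE wtD wt_top // modnDl wt_dvec_mod. Qed.

Lemma top_carry a b : (a + b)%MM = lamtop -> ~~ (is_digits p a && is_digits p b) ->
  ev_in Wtop (mono a b).
Proof.
apply: (carry_layer (@low_Qfil f.-1)); first exact: wt_lamtop.
by rewrite mdeg_lamtop -addnA leq_add2l addnC -mulSn prednK.
Qed.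

Lemma ev_Mtop x y : ev x y Mtop = ev x y (Nmin lamtop).
Proof.
rewrite /Nmin bmin_top amax_top !ev_mono; congr (_ * _).
have le := digits_le_r S r_gt dvec_digits.
apply: io_eqmod => //; first exact: wt_rB_gt0 dvec_digits.
  by rewrite wt_top // qm1_gt0.
rewrite wt_top // modnn; apply/eqP; rewrite -[X in _ == X](mod0n q.-1).
by rewrite -(eqn_modDr (wt dvec)) -wtD submK // add0n wt_dvec_mod.
Qed.

Lemma Mtop_Vr : Vr r Mtop.
Proof. by apply: Vr_mono; rewrite submK // (digits_le_r S r_gt dvec_digits). Qed.

(** Once both exponents are normalized to digits, a monomial either has multidegree [lamtop] or has
    level at most f - 1 and lies in [Wtop]. *)
Lemma top_decomp v : Vr r v -> exists2 w, V lamtop w & ev_in Wtop (v - w).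
Proof.
have hW := Qfil_module f.-1.
move=> /V_fun/VP hv; rewrite (pol_mono v) big_seq; elim/big_ind: _ => [|u u'|m hm].
- by exists 0; [exact: V0 | rewrite subr0; exact: ev_in0].
- move=> [w h1 h2] [w' h1' h2']; exists (w + w'); first exact: VD.
  by rewrite opprD addrACA; exact: ev_inD.
have e := hv m hm.
set a := dnorm (expX m); set b := dnorm (expY m).
have eab : wt (a + b)%MM = wt rv %[mod q.-1].
  by rewrite wtD -modnDm !wt_dnorm_mod modnDm -wtD e.
have evab x y : ev x y (mono (expX m) (expY m)) = ev x y (mono a b).
  by rewrite !ev_mono !io_dnorm.
have eabd := etrans eab (esym wt_dvec_mod).
have [lef topf] := mdeg_level_top p_gt1 (dnorm_digits _) (dnorm_digits _) dvec_digits wt_dvec_neq0 eabd.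
have [k ek _] := mdeg_level p_gt1 dvec_digits wt_dvec_neq0 eabd.
have [tp|ntp] := eqVneq (mdeg (a + b)) (mdeg dvec + f * p.-1)%N.
  exists (v@_m *: mono a b); first by apply: VZ; rewrite /lamtop -topf //; exact: V_mono.
  rewrite -scalerBr; apply: ev_inZ => //; apply: (ev_in_eq _ (ev_in0 hW)) => x y.
  by rewrite evB evab subrr /ev meval0.
exists 0; first exact: V0.
rewrite subr0; apply: ev_inZ => //; apply: (@ev_in_eq _ (mono a b)) => [x y|]; first by rewrite evab.
apply: low_Qfil => //; rewrite ek leq_add2l.
move: lef ntp; rewrite ek leq_add2l eqn_add2l.
have pm1 : (0 < p.-1)%N by move: p_gt1; clear; lia.
rewrite leq_pmul2r // eqn_pmul2r // => h1 h2; rewrite leq_pmul2r //.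
by move: h1 h2 f_gt0; clear; lia.
Qed.

Lemma top_all : ev_in Wtop (Nmin lamtop) -> forall v, Vr r v -> Wtop v.
Proof.
have hW := Qfil_module f.-1; move=> hN v hv; apply: (ev_inE hW) => //.
have [w hw vw] := top_decomp hv; rewrite -(subrK w v); apply: ev_inD => //.
by apply: (V_ev_in hW _ hw); apply: Nmin_generates => //; exact: top_carry.
Qed.

(** If an average with [J] nonzero produced the highest weight vector, invariance would put that
    average in [Wtop], and the cosocle would be zero. *)
Lemma top_inv v : Vr r v -> (forall c, Wtop (actGamma 0 (upper c) v - v)) ->
  (exists c, Wtop (v - c *: Mtop)) \/ (forall v, Vr r v -> Wtop v).
Proof.
have hW := Qfil_module f.-1; move=> hv inv; have [w hw vw] := top_decomp hv.
have [[c hc]|[J [c [dJ nJ c0 hc]]]] := layer_extract hW top_carry hw.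
  left; exists c; apply: (ev_inE hW); first by apply: VB => //; apply: VZ; exact: Mtop_Vr.
  apply: (@ev_in_eq _ (v - w + (w - c *: Nmin lamtop))) => [x y|]; last exact: ev_inD.
  by rewrite addrA subrK !evB !evZ ev_Mtop.
right; apply: top_all.
have : ev_in Wtop (c *: Nmin lamtop).
  have -> : c *: Nmin lamtop =
      avg upper J v - avg upper J (v - w) - (avg upper J w - c *: Nmin lamtop).
    by rewrite avgB; exact/esym/sub_subK.
  apply: ev_inB => //; apply: ev_inB => //.
    by apply: avg_inv => // c'; apply: ev_in_of; exact: inv.
  by apply: avg_in => //; exact: upper_unit.
by move=> /(ev_inZ hW c^-1); rewrite scalerA mulVf ?scale1r.
Qed.

(** This excludes one-dimensional weights from the cosocle. Since d has nonzero weight modulo q - 1,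
    its complement J is nonzero; going from X^(p-1) Y^d down to X^d Y^(p-1) and back multiplies by a
    unit, whereas invariance already kills the way down. *)
Lemma top_inv2 v : Vr r v -> (forall c, Wtop (actGamma 0 (upper c) v - v)) ->
  (forall c, Wtop (actGamma 0 (lower c) v - v)) -> Wtop v.
Proof.
have hW := Qfil_module f.-1; move=> hv inv inv'.
have [[c hc]|all] := top_inv hv inv; last exact: all.
have [c0|c0] := eqVneq c 0; first by move: hc; rewrite c0 scale0r subr0.
suff hN : ev_in Wtop (Nmin lamtop) by exact: top_all.
pose J := compl p dvec; pose A : vec := [multinom p.-1 | i < f].
have dA : is_digits p A by apply/forallP => i; rewrite mnmE; move: p_gt1; clear; lia.
have dJ : is_digits p J by exact: compl_digits.
have nJ : J != 0%MM.
  apply: contraNneq wt_dvec_neq0 => J0; have := wt_compl p_gt1 dvec_digits.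
  by rewrite -/J J0 wt0 addn0 => ->; rewrite modnn mod0n.
have JA : (J <= A)%MM by apply/mnm_lepP => i; rewrite !mnmE leq_subr.
have AJ : (A - J)%MM = dvec.
  apply/mnmP => i; have /forallP/(_ i) := dvec_digits => h; rewrite mnmBE [A i]mnmE [J i]mnmE.
  by rewrite subKn // -ltnS prednK ?prime_gt0.
have dJA : (dvec + J)%MM = A by exact: complK dvec_digits.
have NE : Nmin lamtop = mono A dvec by rewrite /Nmin bmin_top amax_top.
have h1 : ev_in Wtop (c *: avg lower J (Nmin lamtop)).
  have h2 : ev_in Wtop (avg lower J (v - c *: Nmin lamtop)).
    apply: avg_in => //; first exact: lower_unit.
    apply: (@ev_in_eq _ (v - c *: Mtop)); last exact: ev_in_of.
    by move=> x y; rewrite !evB !evZ ev_Mtop.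
  have h3 : ev_in Wtop (avg lower J v) by apply: avg_inv => // c'; exact/ev_in_of/inv'.
  by have := ev_inB hW h3 h2; rewrite avgB subKr avgZ.
have : ev_in Wtop ((c * (bin A J)%:R * (bin A J)%:R) *: Nmin lamtop).
  have := avg_in J hW upper_unit h1.
  rewrite NE avg_lower // !avgZ AJ dJA avg_upper // dJA AJ !scalerA //.
move=> /(ev_inZ hW (c * (bin A J)%:R * (bin A J)%:R)^-1).
by rewrite scalerA mulVf ?scale1r // !mulf_neq0 ?bin_neq0.
Qed.
End SocleLayers.

(** * Valuations and reduction *)

Section ValuationFacts.
Variables (F : fieldType) (D : realDomainType) (v : F -> D).
Hypothesis v_val : is_valuation v.

Lemma valM x y : x != 0 -> y != 0 -> v (x * y) = v x + v y.
Proof. by case: v_val => h _; exact: h. Qed.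

Lemma val1 : v 1 = 0.
Proof.
have := valM (oner_neq0 F) (oner_neq0 F); rewrite mulr1 => /eqP.
by rewrite -subr_eq subrr eq_sym => /eqP.
Qed.

Lemma valV x : x != 0 -> v x^-1 = - v x.
Proof.
move=> nz; apply/eqP; rewrite -addr_eq0 -valM ?invr_eq0 // mulVf // val1 //.
Qed.

Lemma valN1 : v (-1) = 0.
Proof.
have n1 : (-1 : F) != 0 by rewrite oppr_eq0 oner_neq0.
have := valM n1 n1; rewrite mulrNN mulr1 val1 -mulr2n => /esym/eqP.
by rewrite mulrn_eq0 => /eqP.
Qed.

Lemma val_ge0 N : val_ge v N 0.
Proof. by rewrite /val_ge eqxx. Qed.

Lemma val_geD N x y : val_ge v N x -> val_ge v N y -> val_ge v N (x + y).
Proof. by case: v_val => _; exact. Qed.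

Lemma val_geM M N x y : val_ge v M x -> val_ge v N y -> val_ge v (M + N) (x * y).
Proof.
rewrite /val_ge; have [->|nx] := eqVneq x 0; first by rewrite mul0r eqxx.
have [->|ny] := eqVneq y 0; first by rewrite mulr0 eqxx.
by rewrite mulf_eq0 (negPf nx) (negPf ny) /= valM //; exact: lerD.
Qed.

Lemma val_geN N x : val_ge v N x -> val_ge v N (- x).
Proof.
move=> h; rewrite -mulN1r -[N]add0r; apply: val_geM => //.
by rewrite /val_ge valN1 lexx orbT.
Qed.

Lemma val_geB N x y : val_ge v N x -> val_ge v N y -> val_ge v N (x - y).
Proof. by move=> hx hy; apply: val_geD => //; exact: val_geN. Qed.

Lemma val_ge_le M N x : M <= N -> val_ge v N x -> val_ge v M x.
Proof.
by move=> le; rewrite /val_ge => /orP [->//|h]; rewrite (le_trans le h) orbT.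
Qed.

Lemma val_ge_sum N (I : Type) (s : seq I) (Q : pred I) G :
  (forall i, Q i -> val_ge v N (G i)) -> val_ge v N (\sum_(i <- s | Q i) G i).
Proof.
by move=> h; elim/big_ind: _ => //; [exact: val_ge0 | move=> *; exact: val_geD].
Qed.

Lemma integral1 : v_integral v 1.
Proof. by rewrite /v_integral /val_ge val1 lexx orbT. Qed.

Lemma integralM x y : v_integral v x -> v_integral v y -> v_integral v (x * y).
Proof. by rewrite /v_integral -{3}[0]addr0; exact: val_geM. Qed.

Lemma integralX x n : v_integral v x -> v_integral v (x ^+ n).
Proof.
by move=> h; elim: n => [|n IH]; [exact: integral1 | rewrite exprS; exact: integralM].
Qed.

Lemma integral_nat n : v_integral v n%:R.
Proof.
elim: n => [|n IH]; first exact: val_ge0.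
by rewrite -addn1 natrD; apply: val_geD => //; exact: integral1.
Qed.

Lemma maximal_integral x : v_maximal v x -> v_integral v x.
Proof.
by rewrite /v_maximal /v_integral /val_ge => /orP [->//|/ltW ->]; rewrite orbT.
Qed.

Lemma val_ge_maximal N x : 0 < N -> val_ge v N x -> v_maximal v x.
Proof.
rewrite /val_ge /v_maximal => N0 /orP [->//|h].
by rewrite (lt_le_trans N0 h) orbT.
Qed.

Variables (k : fieldType) (red : F -> k).
Hypothesis red_red : is_reduction v red.

Lemma redD x y : v_integral v x -> v_integral v y -> red (x + y) = red x + red y.
Proof. by case: red_red => _ h _ _; exact: h. Qed.

Lemma redM x y : v_integral v x -> v_integral v y -> red (x * y) = red x * red y.
Proof. by case: red_red => _ _ h _; exact: h. Qed.

Lemma red1 : red 1 = 1.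
Proof. by case: red_red. Qed.

Lemma red_eq0 x : v_integral v x -> (red x == 0) = v_maximal v x.
Proof. by case: red_red => _ _ _; exact. Qed.

Lemma red0 : red 0 = 0.
Proof.
by apply/eqP; rewrite red_eq0 ?/v_integral ?val_ge0 // /v_maximal eqxx.
Qed.

Lemma redN x : v_integral v x -> red (- x) = - red x.
Proof.
move=> h; apply/eqP; rewrite -addr_eq0 -redD // ?addNr ?red0 //; exact: val_geN.
Qed.

Lemma redB x y : v_integral v x -> v_integral v y -> red (x - y) = red x - red y.
Proof. by move=> hx hy; rewrite redD ?redN //; exact: val_geN. Qed.

Lemma redX x n : v_integral v x -> red (x ^+ n) = red x ^+ n.
Proof.
move=> h; elim: n => [|n IH]; first by rewrite !expr0 red1.
by rewrite !exprS redM ?IH //; exact: integralX.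
Qed.

Lemma red_sum (I : Type) (s : seq I) (Q : pred I) G :
  (forall i, Q i -> v_integral v (G i)) ->
  red (\sum_(i <- s | Q i) G i) = \sum_(i <- s | Q i) red (G i).
Proof.
move=> h; elim: s => [|i s IH]; first by rewrite !big_nil red0.
rewrite !big_cons; case: ifP => // qi; rewrite redD ?IH //; first exact: h.
exact: val_ge_sum.
Qed.

Lemma integral_prod (I : Type) (s : seq I) G :
  (forall i, v_integral v (G i)) -> v_integral v (\prod_(i <- s) G i).
Proof.
by move=> h; elim/big_ind: _ => //; [exact: integral1 | move=> *; exact: integralM].
Qed.

Lemma red_prod (I : Type) (s : seq I) G : (forall i, v_integral v (G i)) ->
  red (\prod_(i <- s) G i) = \prod_(i <- s) red (G i).
Proof.
move=> h; elim: s => [|i s IH]; first by rewrite !big_nil red1.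
by rewrite !big_cons redM ?IH //; exact: integral_prod.
Qed.

Lemma red_nat n : red n%:R = n%:R.
Proof.
elim: n => [|n IH]; first exact: red0.
by rewrite -addn1 !natrD redD ?IH ?red1 //; [exact: integral_nat | exact: integral1].
Qed.
End ValuationFacts.

Section InverseTwoByTwo.
Variable F : fieldType.

Definition inv2 (g : 'M[F]_2) : 'M[F]_2 :=
  (\det g)^-1 *: mk2 (g 1 1) (- g 0 1) (- g 1 0) (g 0 0).

Lemma mul_inv2 (g : 'M[F]_2) : \det g != 0 -> g *m inv2 g = 1%:M.
Proof.
move=> nz; have := nz; rewrite det2 => nz'.
by apply: mx2P; rewrite mul2E !mxE /= det2; field.
Qed.

Lemma invmx_inv2 (g : 'M[F]_2) : \det g != 0 -> invmx g = inv2 g.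
Proof.
move=> nz; have ug : g \in unitmx by rewrite unitmxE unitfE.
by rewrite -[invmx g]mulmx1 -(mul_inv2 nz) mulmxA mulVmx // mul1mx.
Qed.
End InverseTwoByTwo.

(** * The group KZ and compact induction *)

Section KZGroup.
Variables (p f : nat) (S : unramified p f).
Hypothesis p_prime : prime p.
Local Notation L := (Qpf S).
Local Notation vL := (@vK p f S).
Let vLP := @vK_spec p f S.

Lemma vK_p : (p%:R : L) != 0 /\ vL p%:R = 1.
Proof.
have [_ /(_ p (prime_gt0 p_prime)) [nz vp] _ _] := Qp_spec S.
have e : (p%:R : L) = (p%:R : Qp S)%:A by rewrite -(rmorph_nat (in_alg L)).
rewrite e; split; last by rewrite vK_extends // vp logn_prime // eqxx.
by rewrite (fmorph_eq0 (in_alg L)).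
Qed.

Lemma p_neq0 : (p%:R : L) != 0. Proof. by case: vK_p. Qed.

Lemma vK_expz n : vL (p%:R ^ n) = n.
Proof.
have nat m : vL (p%:R ^+ m) = m%:Z.
  elim: m => [|m IH]; first by rewrite expr0 (val1 vLP).
  rewrite exprS (valM vLP) ?p_neq0 ?expf_neq0 ?p_neq0 // IH.
  by case: vK_p => _ ->; rewrite -addn1 PoszD addrC.
case: n => m; first by rewrite -exprnP nat.
by rewrite NegzE -exprnN (valV vLP) ?nat // expf_neq0 ?p_neq0.
Qed.

Lemma inKP (g : 'M[L]_2) :
  inK g <-> [/\ forall i j, v_integral vL (g i j), \det g != 0 & vL (\det g) = 0].
Proof.
split=> [/and3P [/forallP h1 h2 /eqP h3]|[h1 h2 h3]].
  by split=> // i j; have /forallP := h1 i.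
by apply/and3P; split; rewrite ?h3 //; apply/forallP => i; apply/forallP.
Qed.

Lemma inK_mul (g h : 'M[L]_2) : inK g -> inK h -> inK (g *m h).
Proof.
move=> /inKP [g1 g2 g3] /inKP [h1 h2 h3]; apply/inKP; split.
- by move=> i j; rewrite mul2E; apply: (val_geD vLP); exact: (integralM vLP).
- by rewrite det_mulmx mulf_neq0.
- by rewrite det_mulmx (valM vLP) // g3 h3.
Qed.

Lemma inK_inv (g : 'M[L]_2) : inK g -> inK (invmx g).
Proof.
move=> /inKP [g1 g2 g3]; apply/inKP; split.
- move=> i j; rewrite invmx_inv2 // /inv2 2!mxE; apply: (integralM vLP).
    by rewrite /v_integral /val_ge (valV vLP) // g3 oppr0 lexx orbT.
  by case: ifP => _; case: ifP => _; rewrite ?g1 //; apply: (val_geN vLP); exact: g1.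
- by rewrite det_inv invr_eq0.
- by rewrite det_inv (valV vLP) // g3 oppr0.
Qed.

Lemma det_scale2 (a : L) (g : 'M[L]_2) : \det (a *: g) = a ^+ 2 * \det g.
Proof. by rewrite detZ. Qed.

(** The determinant of p^n k has valuation 2n, so halving recovers n. *)
Lemma Kpart_scale n (k : 'M[L]_2) : inK k -> Kpart (p%:R ^ n *: k) = k.
Proof.
move=> /inKP [k1 k2 k3]; rewrite /Kpart det_scale2 (valM vLP) ?expf_neq0 ?expfz_neq0 ?p_neq0 //.
rewrite exprnP exprz_exp vK_expz k3 addr0 mulzK //.
by rewrite scalerA -expfzDr ?p_neq0 // addNr expr0z scale1r.
Qed.

Lemma inKZ_scale n (k : 'M[L]_2) : inK k -> inKZ (p%:R ^ n *: k).
Proof.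
move=> hk; rewrite /inKZ Kpart_scale // hk andbT /inG unitmxE unitfE det_scale2.
by have /inKP [_ nz _] := hk; rewrite mulf_neq0 ?expf_neq0 ?expfz_neq0 ?p_neq0.
Qed.

Lemma inKZP (g : 'M[L]_2) : inKZ g -> exists n, g = p%:R ^ n *: Kpart g.
Proof.
move=> _; exists (vL (\det g) %/ 2)%Z.
by rewrite /Kpart scalerA -expfzDr ?p_neq0 // subrr expr0z scale1r.
Qed.

Lemma inKZ_K (g : 'M[L]_2) : inKZ g -> inK (Kpart g).
Proof. by case/andP. Qed.

Lemma inKZ_G (g : 'M[L]_2) : inKZ g -> inG g.
Proof. by case/andP. Qed.

Lemma inKZ_inK (k : 'M[L]_2) : inK k -> inKZ k.
Proof. by move/(inKZ_scale 0); rewrite expr0z scale1r. Qed.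

Lemma Kpart_inK (k : 'M[L]_2) : inK k -> Kpart k = k.
Proof. by move/(Kpart_scale 0); rewrite expr0z scale1r. Qed.

Lemma inKZ_mul (g h : 'M[L]_2) : inKZ g -> inKZ h ->
  inKZ (g *m h) /\ Kpart (g *m h) = Kpart g *m Kpart h.
Proof.
move=> hg hh; have [n en] := inKZP hg; have [m em] := inKZP hh.
have -> : g *m h = p%:R ^ (n + m) *: (Kpart g *m Kpart h).
  by rewrite {1}en {1}em -scalemxAl -scalemxAr scalerA expfzDr ?p_neq0.
have hK := inK_mul (inKZ_K hg) (inKZ_K hh).
by rewrite Kpart_scale // inKZ_scale.
Qed.

Lemma inKZ_inv (g : 'M[L]_2) : inKZ g -> inKZ (invmx g).
Proof.
move=> hg; have [n en] := inKZP hg.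
have -> : invmx g = p%:R ^ (- n) *: invmx (Kpart g).
  have ug := inKZ_G hg.
  have uk : Kpart g \in unitmx.
    by have /inKP [_ nz _] := inKZ_K hg; rewrite unitmxE unitfE.
  rewrite -[RHS]mul1mx -(mulVmx ug) -mulmxA.
  rewrite (_ : g *m (p%:R ^ (- n) *: invmx (Kpart g)) = 1%:M) ?mulmx1 //.
  rewrite {1}en -scalemxAl -scalemxAr scalerA -expfzDr ?p_neq0 // subrr expr0z scale1r.
  exact: mulmxV.
exact: inKZ_scale (inK_inv (inKZ_K hg)).
Qed.

Lemma inKZ_mull (k g : 'M[L]_2) : inKZ k -> inKZ (k *m g) = inKZ g.
Proof.
move=> hk; apply/idP/idP => [h|h]; last by case: (inKZ_mul hk h).
have := inKZ_mul (inKZ_inv hk) h; rewrite mulmxA mulVmx ?mul1mx; first by case.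
exact: inKZ_G hk.
Qed.

Lemma inKZ_mulr (k g : 'M[L]_2) : inKZ k -> inKZ (g *m k) = inKZ g.
Proof.
move=> hk; apply/idP/idP => [h|h]; last by case: (inKZ_mul h hk).
have := inKZ_mul h (inKZ_inv hk); rewrite -mulmxA mulmxV ?mulmx1; first by case.
exact: inKZ_G hk.
Qed.

Section Elements.
Variable R : comNzRingType.
Local Notation P := (pol f R).
Variable ac : 'M[L]_2 -> P -> P.
Hypothesis acM : forall k k' v, inK k -> inK k' -> ac (k *m k') v = ac k (ac k' v).
Hypothesis acD : forall k u v, ac k (u + v) = ac k u + ac k v.
Hypothesis acZ : forall k a v, ac k (a *: v) = a *: ac k v.

Lemma ac0 k : ac k 0 = 0.
Proof. by rewrite -[X in ac k X](scale0r (0 : P)) acZ scale0r. Qed.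

Lemma eltD g u v g' : elt ac g (u + v) g' = elt ac g u g' + elt ac g v g'.
Proof. by rewrite /elt; case: ifP => _; rewrite ?addr0. Qed.

Lemma eltZ g a v g' : elt ac g (a *: v) g' = a *: elt ac g v g'.
Proof. by rewrite /elt; case: ifP => _; rewrite ?scaler0. Qed.

Lemma elt_sum g (I : Type) (s : seq I) (G : I -> P) g' :
  elt ac g (\sum_(i <- s) G i) g' = \sum_(i <- s) elt ac g (G i) g'.
Proof.
apply: (big_morph (fun v => elt ac g v g')) => [u v|]; first exact: eltD.
by rewrite /elt ac0; case: ifP.
Qed.

Lemma elt_K g k v g' : inK k -> elt ac (g *m k) v g' = elt ac g (ac k v) g'.
Proof.
move=> hk; have hkz := inKZ_inK hk; rewrite /elt mulmxA inKZ_mulr //.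
case: ifP => // h; have [_ ->] := inKZ_mul h hkz.
by rewrite (Kpart_inK hk) acM // inKZ_K.
Qed.

Lemma elt_scale g n v g' : elt ac (p%:R ^ n *: g) v g' = elt ac g v g'.
Proof.
have h1 : inK (1%:M : 'M[L]_2).
  apply/inKP; rewrite det1; split; rewrite ?oner_neq0 ?(val1 vLP) // => i j.
  by rewrite mxE; case: eqP => _; [exact: integral1 vLP | exact: val_ge0].
have hz : inKZ (p%:R ^ n *: 1%:M : 'M[L]_2) by exact: inKZ_scale.
rewrite /elt -scalemxAr -[X in p%:R ^ n *: X]mulmx1 scalemxAr (inKZ_mulr (g' *m g) hz).
by case: ifP => // h; have [_ ->] := inKZ_mul h hz; rewrite Kpart_scale // mulmx1.
Qed.

Variable M : P -> Prop.
Hypothesis M0 : M 0.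
Hypothesis MD : forall u v, M u -> M v -> M (u + v).
Hypothesis MZ : forall a v, M v -> M (a *: v).
Hypothesis MA : forall k v, inK k -> M v -> M (ac k v).

Lemma ind_elt g v : inG g -> M v -> ind ac M (elt ac g v).
Proof.
move=> hg hv; split.
- by move=> g'; rewrite /elt; case: ifP => // h; apply: MA => //; exact: inKZ_K.
- move=> g' ng; rewrite /elt; case: ifP => // /inKZ_G; rewrite /inG unitmx_mul => /andP [h _].
  by rewrite /inG h in ng.
- move=> k g' hk hg'; rewrite /elt -mulmxA inKZ_mull //; case: ifP => h.
    by have [_ ->] := inKZ_mul hk h; rewrite acM // inKZ_K.
  by rewrite ac0.
- exists [:: invmx g] => g'; rewrite /elt; case: ifP => [h _|_]; last by rewrite eqxx.
  by rewrite /= invmxK h.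
Qed.

Lemma ind0 : ind ac M (fun=> 0).
Proof.
split=> //; first by move=> *; rewrite ac0.
by exists [::] => g; rewrite eqxx.
Qed.

Lemma indD h h' : ind ac M h -> ind ac M h' -> ind ac M (fun g => h g + h' g).
Proof.
move=> [a1 a2 a3 [s a4]] [b1 b2 b3 [t b4]]; split.
- by move=> g; exact: MD.
- by move=> g hg; rewrite a2 // b2 // addr0.
- by move=> k g hk hg; rewrite a3 // b3 // acD.
- exists (s ++ t) => g; rewrite has_cat; have [->|/a4 -> //] := eqVneq (h g) 0.
  by rewrite add0r => /b4 ->; rewrite orbT.
Qed.

Lemma indZ a h : ind ac M h -> ind ac M (fun g => a *: h g).
Proof.
move=> [a1 a2 a3 [s a4]]; split.
- by move=> g; exact: MZ.
- by move=> g hg; rewrite a2 // scaler0.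
- by move=> k g hk hg; rewrite a3 // acZ.
- exists s => g; have [->|/a4 //] := eqVneq (h g) 0.
  by rewrite scaler0 eqxx.
Qed.

Lemma ind_sum (I : Type) (s : seq I) (Q : I -> Prop) (G : I -> 'M[L]_2 -> P) :
  (forall i, Q i -> ind ac M (G i)) -> (forall i, List.In i s -> Q i) ->
  ind ac M (fun g => \sum_(i <- s) G i g).
Proof.
move=> h; elim: s => [|i s IH] hs.
  have := ind0; congr ind; apply: functional_extensionality => g; by rewrite big_nil.
have := indD (h i (hs i (or_introl erefl))) (IH (fun j hj => hs j (or_intror hj))).
by congr ind; apply: functional_extensionality => g; rewrite big_cons.
Qed.

Lemma ind_sumT (I : Type) (s : seq I) (G : I -> 'M[L]_2 -> P) :
  (forall i, ind ac M (G i)) -> ind ac M (fun g => \sum_(i <- s) G i g).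
Proof. by move=> h; apply: (ind_sum (Q := fun=> True)). Qed.
End Elements.

Lemma ind_mono (R : comNzRingType) ac (M M' : pol f R -> Prop) h :
  (forall v, M v -> M' v) -> ind (S := S) ac M h -> ind ac M' h.
Proof. by move=> sub [a1 a2 a3 a4]; split=> // g; exact: sub. Qed.
End KZGroup.

(** * Coefficientwise valuations of polynomials and their reductions *)

Section Integrality.
Variables (p f : nat) (S : unramified p f) (C : coefficients S).
Hypothesis p_prime : prime p.
Hypothesis f_gt0 : (0 < f)%N.
Local Notation F := (Fq S).
Local Notation L := (Qpf S).
Local Notation EE := (E C).
Local Notation K := (kbar C).
Local Notation io := (Fq_kbar C).
Local Notation PE := (pol f EE).
Local Notation Pk := (pol f K).
Local Notation vL := (@vK p f S).
Local Notation aE := (@actE p f S C).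
Local Notation vEE := (@vE _ _ _ C).
Let vLP := @vK_spec p f S.
Let vEP := @vE_spec _ _ _ C.
Let redKP := @redK_spec p f S.
Let redEP := @redE_spec _ _ _ C.

Lemma val_ge_alg (N : int) (x : L) : val_ge vL N x -> val_ge vEE N%:~R x%:A.
Proof.
rewrite /val_ge; have [->|nz] /= := eqVneq x 0; first by rewrite scale0r eqxx.
by move=> h; rewrite vE_extends // ler_int h orbT.
Qed.

Lemma integral_alg (x : L) : v_integral vL x -> v_integral vEE x%:A.
Proof. exact: val_ge_alg. Qed.

(** Unramifiedness enters here: the valuation has integer values, so a positive one is at least
    1. *)
Lemma maximal_val_ge1 (x : L) : v_maximal vL x -> val_ge vL 1 x.
Proof. by rewrite /v_maximal /val_ge; case: eqP. Qed.

Lemma vE_p : (p%:R : EE) != 0 /\ vEE p%:R = 1.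
Proof.
have [nz vp] := vK_p S p_prime.
have e : (p%:R : EE) = (p%:R : L)%:A by rewrite -(rmorph_nat (in_alg EE)).
rewrite e; split; last by rewrite vE_extends // vp.
by rewrite (fmorph_eq0 (in_alg EE)).
Qed.

Lemma E_integral1 : val_ge vEE 0 1.
Proof. by rewrite /val_ge (val1 vEP) lexx orbT. Qed.

Lemma E_integral_nat n : val_ge vEE 0 n%:R.
Proof.
elim: n => [|n IH]; first exact: val_ge0.
by rewrite -addn1 natrD; apply: (val_geD vEP) => //; exact: E_integral1.
Qed.

Lemma val_ge_pX n : val_ge vEE n%:R (p%:R ^+ n).
Proof.
elim: n => [|n IH]; first by rewrite expr0; exact: E_integral1.
rewrite exprS -addn1 natrD addrC; apply: (val_geM vEP) => //.
by case: vE_p => _ e; rewrite /val_ge e lexx orbT.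
Qed.

Lemma val_ge_dvd n : (p %| n)%N -> val_ge vEE 1 (n%:R : EE).
Proof.
move=> /dvdnP [m ->]; rewrite natrM -[1]add0r; apply: (val_geM vEP).
  exact: E_integral_nat.
exact: (val_ge_pX 1).
Qed.

(** A lower bound for the Gauss valuation, preserved by substitution of integral forms
    ([cge_subst]). *)
Definition cge (N : rat) (v : PE) : Prop := forall m, val_ge vEE N v@_m.

Lemma cge0 N : cge N 0.
Proof. by move=> m; rewrite mcoeff0; exact: val_ge0. Qed.

Lemma cgeD N u v : cge N u -> cge N v -> cge N (u + v).
Proof. by move=> hu hv m; rewrite mcoeffD; exact: (val_geD vEP). Qed.

Lemma cgeZ M N a v : val_ge vEE M a -> cge N v -> cge (M + N) (a *: v).
Proof. by move=> ha hv m; rewrite mcoeffZ; exact: (val_geM vEP). Qed.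

Lemma cgeN N v : cge N v -> cge N (- v).
Proof. by move=> hv m; rewrite mcoeffN; exact: (val_geN vEP). Qed.

Lemma cgeB N u v : cge N u -> cge N v -> cge N (u - v).
Proof. by move=> hu hv; apply: cgeD => //; exact: cgeN. Qed.

Lemma cgeM M N u v : cge M u -> cge N v -> cge (M + N) (u * v).
Proof.
by move=> hu hv m; rewrite mcoeffM; apply: (val_ge_sum vEP) => k _; exact: (val_geM vEP).
Qed.

Lemma cge_le M N v : M <= N -> cge N v -> cge M v.
Proof. by move=> le hv m; apply: val_ge_le le _; exact: hv. Qed.

Lemma cge_sum N (I : Type) (s : seq I) (Q : pred I) G :
  (forall i, Q i -> cge N (G i)) -> cge N (\sum_(i <- s | Q i) G i).
Proof.
by move=> h; elim/big_ind: _ => //; [exact: cge0 | move=> *; exact: cgeD].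
Qed.

Lemma cge_X (m : 'X_{1..f + f}) : cge 0 'X_[m].
Proof.
by move=> k; rewrite mcoeffX; case: eqP => _; [exact: E_integral1 | exact: val_ge0].
Qed.

Lemma cge_mono a b : cge 0 (mono EE a b).
Proof. exact: cge_X. Qed.

Lemma cge0M u v : cge 0 u -> cge 0 v -> cge 0 (u * v).
Proof. by move=> hu hv; rewrite -[0]addr0; exact: cgeM. Qed.

Lemma cge0X u n : cge 0 u -> cge 0 (u ^+ n).
Proof.
move=> hu; elim: n => [|n IH]; last by rewrite exprS; exact: cge0M.
by rewrite expr0 -mpolyX0; exact: cge_X.
Qed.

Lemma cge0_prod (G : 'I_f -> PE) : (forall i, cge 0 (G i)) -> cge 0 (\prod_i G i).
Proof.
move=> h; elim/big_ind: _ => //; last by move=> *; exact: cge0M.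
by rewrite -mpolyX0; exact: cge_X.
Qed.

Lemma cge_lin a b i : v_integral vEE a -> v_integral vEE b ->
  cge 0 (a *: Xv EE i + b *: Yv EE i).
Proof.
move=> ha hb; apply: cgeD; rewrite -[0]addr0; apply: cgeZ => //; exact: cge_X.
Qed.

Lemma cge_subst N PX PY v : (forall i, cge 0 (PX i)) -> (forall i, cge 0 (PY i)) ->
  cge N v -> cge N (subst PX PY v).
Proof.
move=> hX hY hv; rewrite (pol_mono v) subst_sum; apply: cge_sum => m _.
rewrite substZ subst_mono -[N]addr0; apply: cgeZ; first exact: hv.
by apply: cge0M; apply: cge0_prod => i; exact: cge0X.
Qed.

Definition red_of (v : PE) (w : Pk) : Prop :=
  cge 0 v /\ forall m, w@_m = redE v@_m.

Lemma red_of0 : red_of 0 0.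
Proof. by split; [exact: cge0 | move=> m; rewrite !mcoeff0 (red0 redEP)]. Qed.

Lemma red_ofD u v u' v' : red_of u u' -> red_of v v' -> red_of (u + v) (u' + v').
Proof.
move=> [hu eu] [hv ew]; split; first exact: cgeD.
by move=> m; rewrite !mcoeffD eu ew (redD redEP (hu m) (hv m)).
Qed.

Lemma red_ofZ a v v' : v_integral vEE a -> red_of v v' -> red_of (a *: v) (redE a *: v').
Proof.
move=> ha [hv ew]; split; first by rewrite -[0]addr0; exact: cgeZ.
by move=> m; rewrite !mcoeffZ ew (redM redEP ha (hv m)).
Qed.

Lemma red_ofM u v u' v' : red_of u u' -> red_of v v' -> red_of (u * v) (u' * v').
Proof.
move=> [hu eu] [hv ew]; split; first exact: cge0M.
move=> m; rewrite !mcoeffM (red_sum vEP redEP) => [|k _]; last first.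
  exact: (integralM vEP (hu _) (hv _)).
by apply: eq_bigr => k _; rewrite eu ew (redM redEP (hu _) (hv _)).
Qed.

Lemma red_of_sum (I : Type) (s : seq I) G G' :
  (forall i, red_of (G i) (G' i)) -> red_of (\sum_(i <- s) G i) (\sum_(i <- s) G' i).
Proof.
by move=> h; elim/big_ind2: _ => //; [exact: red_of0 | move=> *; exact: red_ofD].
Qed.

Lemma red_of_X (m : 'X_{1..f + f}) : red_of 'X_[m] 'X_[m].
Proof.
split; first exact: cge_X.
by move=> k; rewrite !mcoeffX; case: eqP => _; rewrite ?(red1 redEP) ?(red0 redEP).
Qed.

Lemma red_of_exp u u' n : red_of u u' -> red_of (u ^+ n) (u' ^+ n).
Proof.
move=> h; elim: n => [|n IH]; last by rewrite !exprS; exact: red_ofM.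
by rewrite !expr0 -!mpolyX0; exact: red_of_X.
Qed.

Lemma red_of_prod (G : 'I_f -> PE) G' :
  (forall i, red_of (G i) (G' i)) -> red_of (\prod_i G i) (\prod_i G' i).
Proof.
move=> h; elim/big_ind2: _ => //; last by move=> *; exact: red_ofM.
by rewrite -!mpolyX0; exact: red_of_X.
Qed.

Lemma red_of_subst PX PY QX QY v w : (forall i, red_of (PX i) (QX i)) ->
  (forall i, red_of (PY i) (QY i)) -> red_of v w ->
  red_of (subst PX PY v) (subst QX QY w).
Proof.
move=> hX hY [hv ew].
(* The expansion runs over the support of [v], which may be larger than that of its reduction. *)
have -> : w = \sum_(m <- msupp v) redE v@_m *: mono K (expX m) (expY m).
  apply/mpolyP => m; rewrite ew raddf_sum /=.
  under eq_bigr do rewrite mcoeffZ /mono mjoinK mcoeffX.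
  case: (boolP (m \in msupp v)) => hm.
    rewrite (bigD1_seq m) ?msupp_uniq //= eqxx mulr1 big1 ?addr0 // => k /negPf ->.
    by rewrite mulr0.
  rewrite (memN_msupp_eq0 hm) (red0 redEP) big_seq big1 // => k hk.
  by rewrite (negPf (memPn hm _ hk)) mulr0.
rewrite [v in subst _ _ v]pol_mono !subst_sum; apply: red_of_sum => m.
rewrite !substZ !subst_mono; apply: red_ofZ; first exact: hv.
by apply: red_ofM; apply: red_of_prod => i; exact: red_of_exp.
Qed.

Lemma frob_integral (x : L) : v_integral vL x ->
  v_integral vL (frob S x) /\ redK (frob S x) = redK x ^+ p.
Proof.
move=> hx; have hp := integralX vLP p hx; have mx := frob_spec hx.
have hf : v_integral vL (frob S x).
  rewrite -(subrK (x ^+ p) (frob S x)); apply: (val_geD vLP) => //.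
  exact: (maximal_integral mx).
split=> //; rewrite -(redX vLP redKP) //; apply/eqP; rewrite -subr_eq0.
by rewrite -(redB vLP redKP) // (red_eq0 redKP) //; exact: (val_geB vLP).
Qed.

Lemma iter_frob i (x : L) : v_integral vL x ->
  v_integral vL (iter i (frob S) x) /\ redK (iter i (frob S) x) = redK x ^+ (p ^ i).
Proof.
move=> hx; elim: i => [|i [h1 h2]] /=; first by rewrite expr1.
by have [h3 h4] := frob_integral h1; rewrite h4 h2 -exprM -expnSr.
Qed.

Lemma iter_frobD i (x y : L) : iter i (frob S) (x + y) = iter i (frob S) x + iter i (frob S) y.
Proof. by elim: i => //= i ->; rewrite rmorphD. Qed.

Lemma iter_frobM i (x y : L) : iter i (frob S) (x * y) = iter i (frob S) x * iter i (frob S) y.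
Proof. by elim: i => //= i ->; rewrite rmorphM. Qed.

Lemma actE_comp (g h : 'M[L]_2) v : aE (g *m h) v = aE g (aE h v).
Proof.
apply: act_comp => i x y; first by rewrite iter_frobD scalerDl.
by rewrite iter_frobM -[_%:A]/(in_alg EE _) rmorphM.
Qed.

Lemma actED g u v : aE g (u + v) = aE g u + aE g v.
Proof. exact: substD. Qed.

Lemma actEZ g a v : aE g (a *: v) = a *: aE g v.
Proof. exact: substZ. Qed.

Lemma V_actE r g v : V r v -> V r (aE g v).
Proof. exact: V_act. Qed.

Lemma e_integral i (x : L) : v_integral vL x -> v_integral vEE (iter i (frob S) x)%:A.
Proof. by move=> /(iter_frob i) [h _]; exact: integral_alg. Qed.

Lemma cge_actE N k v : inK k -> cge N v -> cge N (aE k v).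
Proof.
move=> /inKP [hk _ _] hv.
by apply: cge_subst => // i; apply: cge_lin; apply: e_integral.
Qed.

Lemma red_actE k v w : inK k -> red_of v w -> red_of (aE k v) (actk 0 k w).
Proof.
move=> /inKP [hk _ _] h; rewrite /actk actGamma0 /actE /act !mxE.
have e i x : v_integral vL x ->
    redE (iter i (frob S) x)%:A = io (redK x) ^+ (p ^ i).
  by move=> hx; have [h1 h2] := iter_frob i hx; rewrite redE_compat // h2 rmorphXn.
by apply: red_of_subst => // i; apply: red_ofD; rewrite -e //; apply: red_ofZ;
  rewrite ?e_integral //; exact: red_of_X.
Qed.

Lemma map_redK_mul (k k' : 'M[L]_2) : inK k -> inK k' ->
  map_mx (@redK p f S) (k *m k') = map_mx (@redK p f S) k *m map_mx (@redK p f S) k'.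
Proof.
move=> /inKP [h _ _] /inKP [h' _ _]; apply/matrixP => i j.
rewrite [LHS]mxE [in LHS]mul2E [RHS]mul2E !mxE.
rewrite (redD redKP) ?(redM redKP) //; exact: (integralM vLP).
Qed.

Lemma actk_comp m (k k' : 'M[L]_2) (v : Pk) : inK k -> inK k' ->
  actk m (k *m k') v = actk m k (actk m k' v).
Proof. move=> h h'; rewrite /actk (map_redK_mul h h'); exact: (actGamma_comp p_prime). Qed.

Lemma map_redK_unit (k : 'M[L]_2) : inK k -> map_mx (@redK p f S) k \in unitmx.
Proof.
move=> hk; have := map_redK_mul hk (inK_inv hk).
have /inKP [_ nz _] := hk; rewrite mulmxV ?unitmxE ?unitfE // => e.
have := congr1 determinant e; rewrite det_mulmx.
rewrite (_ : map_mx _ 1%:M = 1%:M) ?det1; last first.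
  by apply/matrixP => i j; rewrite !mxE; case: eqP => _; rewrite ?(red1 redKP) ?(red0 redKP).
move=> /esym h; apply/eqP => z; move/eqP: h; rewrite z mul0r eq_sym oner_eq0 //.
Qed.

Lemma elt_cge N g v g' : cge N v -> cge N (elt (aE) g v g').
Proof.
move=> hv; rewrite /elt; case: ifP => h; last exact: cge0.
by apply: cge_actE => //; exact: inKZ_K.
Qed.

Lemma elt_red g v w g' : red_of v w ->
  red_of (elt (aE) g v g') (elt (actk 0) g w g').
Proof.
move=> hv; rewrite /elt; case: ifP => h; last exact: red_of0.
by apply: red_actE => //; exact: inKZ_K.
Qed.
End Integrality.

(** Both sides are n! / (j! k! (n - j - k)!), or 0 when j + k > n. *)
Lemma bin_trinomial n j k : ('C(n, j) * 'C(n - j, k) = 'C(n, k) * 'C(n - k, j))%N.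
Proof.
have z i l : (n < i + l)%N -> ('C(n, i) * 'C(n - i, l) = 0)%N.
  move=> lt; have [le|gt] := leqP i n; last by rewrite bin_small.
  by rewrite (@bin_small (n - i)) ?muln0 // ltn_subLR.
have [le|lt] := leqP (j + k) n; last by rewrite !z // addnC.
have lj : (j <= n)%N by move: le; clear; lia.
have lk : (k <= n)%N by move: le; clear; lia.
have lkj : (k <= n - j)%N by move: le; clear; lia.
have ljk : (j <= n - k)%N by move: le; clear; lia.
have := bin_fact lj; have := bin_fact lk; have := bin_fact lkj; have := bin_fact ljk.
rewrite subnAC; set m := (n - j - k)`!.
move=> h1 h2 h3 h4.
have pos : (0 < j`! * k`! * m)%N by rewrite !muln_gt0 !fact_gt0.
apply/eqP; rewrite -(eqn_pmul2r pos); apply/eqP.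
transitivity (n`!); [rewrite -h4 -h2 | rewrite -h3 -h1]; ring.
Qed.

Lemma vbin_trinomial f (a j k : 'X_{1..f}) :
  (bin a j * bin (a - j)%MM k = bin a k * bin (a - k)%MM j)%N.
Proof.
rewrite /bin -!big_split; apply: eq_bigr => i _ /=; rewrite !mnmBE.
exact: bin_trinomial.
Qed.

Lemma zmod_cancel (V : zmodType) (A H v b U : V) :
  A + H - (v + b) + v = A + U + H - (U + b).
Proof. by rewrite !opprD !addrA [LHS]addrAC subrK [A + U + H - U]addrAC addrK. Qed.

(** * The p-adic estimates for T - a_p *)

Section Analysis.
Variables (p f : nat) (S : unramified p f) (C : coefficients S).
Hypothesis p_prime : prime p.
Hypothesis p_gt2 : (2 < p)%N.
Hypothesis f_gt0 : (0 < f)%N.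
Local Notation q := (p ^ f)%N.
Local Notation F := (Fq S).
Local Notation L := (Qpf S).
Local Notation EE := (E C).
Local Notation K := (kbar C).
Local Notation PE := (pol f EE).
Local Notation Pk := (pol f K).
Local Notation vL := (@vK p f S).
Local Notation vEE := (@vE _ _ _ C).
Local Notation aE := (@actE p f S C).
Local Notation vec := 'X_{1..f}.
Local Notation monok := (@mono f K).
Local Notation mono := (@mono f EE).
Local Notation wt := (@wt p f).
Local Notation cge := (@cge p f S C).
Let vLP := @vK_spec p f S.
Let vEP := @vE_spec _ _ _ C.
Let redKP := @redK_spec p f S.
Let redEP := @redE_spec _ _ _ C.
Let p_gt1 : (1 < p)%N := prime_gt1 p_prime.

Variable r : 'I_f -> nat.
Hypothesis r_gt : forall i, (p ^ f + p - 2 < r i)%N.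
Local Notation rv := [multinom r i | i < f].
Hypothesis r_neq0 : wt rv != 0 %[mod q.-1].
Hypothesis r_neqp : forall j : 'I_f, wt rv != p ^ j %[mod q.-1].
Local Notation d := (dvec p r).
Local Notation N := (mdeg rv).+1.
Local Notation box := {ffun 'I_f -> 'I_N}.

Lemma le_rv_lt (b : vec) : (b <= rv)%MM -> forall i, (b i < N)%N.
Proof.
move=> /mnm_lepP h i; rewrite ltnS (leq_trans (h i)) // mdegE (bigD1 i) //=.
exact: leq_addr.
Qed.

Lemma mpow_wtE (c : EE) (j : vec) : mpow (fun i : 'I_f => c ^+ (p ^ i)) j = c ^+ wt j.
Proof. by rewrite /mpow /wt -prodrXr; apply: eq_bigr => i _; rewrite -exprM mulnC. Qed.

Lemma mpow_cst (c : EE) (j : vec) : mpow (fun=> c) j = c ^+ mdeg j.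
Proof. by rewrite /mpow prodrXr mdegE. Qed.

Definition cT (a : F) : EE := - teichE C a.

Lemma cT_integral a : v_integral vEE (cT a).
Proof.
apply: (val_geN vEP); apply: integral_alg; by case: (teich_spec a).
Qed.

(** The sign survives because q is odd. *)
Lemma cT_expq a : cT a ^+ q = cT a.
Proof.
have oq : odd q.
  rewrite oddX; apply/orP; right; case: (even_prime p_prime) => // e.
  by move: p_gt2; rewrite e.
rewrite /cT exprNn -signr_odd oq expr1 mulN1r; congr (- _).
rewrite /teichE -[_%:A]/(in_alg EE _) -rmorphXn; congr (in_alg EE _).
by case: (teich_spec a).
Qed.

Lemma cT_eqmod a m n : (0 < m)%N -> (0 < n)%N -> m = n %[mod q.-1] -> cT a ^+ m = cT a ^+ n.
Proof.
move=> m0 n0 e; have [->|nz] := eqVneq (cT a) 0; first by rewrite !expr0n !gtn_eqF.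
have c1 : cT a ^+ q.-1 = 1.
  apply: (mulfI nz); rewrite -exprS prednK ?mulr1 ?cT_expq //.
  by rewrite expn_gt0 prime_gt0.
by rewrite -(expr_mod m c1) e expr_mod.
Qed.

Definition subA (a : F) (w : PE) : PE :=
  subst (@Xv f EE) (fun i => (- teichE C a) ^+ (p ^ i) *: Xv EE i + p%:R *: Yv EE i) w.
Definition subAlpha (w : PE) : PE := subst (fun i => p%:R *: Xv EE i) (@Yv f EE) w.

Lemma subA_mono a (A B : vec) : (B <= rv)%MM -> subA a (mono A B) =
  \sum_(j : box) ((bin B (vec_of j))%:R * cT a ^+ wt (B - vec_of j)%MM
                   * p%:R ^+ mdeg (vec_of j)) *: mono (A + (B - vec_of j))%MM (vec_of j).
Proof.
move=> /le_rv_lt hB; rewrite /subA subst_mono (prod_linear_expand _ _ hB) mulr_sumr.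
apply: eq_bigr => j _; rewrite -scalerAr mpow_wtE mpow_cst; congr (_ *: _).
by rewrite -mono0r monoM add0m.
Qed.

Lemma subAlpha_mono A B : subAlpha (mono A B) = p%:R ^+ mdeg A *: mono A B.
Proof.
rewrite /subAlpha subst_mono; under eq_bigr do rewrite exprZn.
by rewrite scaler_prod -scalerAl -monoE prodrXr mdegE.
Qed.

(** Every Y in the expansion comes with a factor p. *)
Lemma subA_mod_p a (A B : vec) : (B <= rv)%MM ->
  cge 1 (subA a (mono A B) - cT a ^+ wt B *: mono (A + B)%MM 0%MM).
Proof.
move=> hB; rewrite subA_mono //.
pose j0 : box := [ffun=> ord0].
have e0 : vec_of j0 = 0%MM by apply/mnmP => i; rewrite mnmE ffunE mnm0E.
rewrite (bigD1 j0) //= e0 vbin0 subm0 mdeg0 expr0 mulr1 mul1r addrAC subrr add0r.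
apply: cge_sum => j ne.
have nj : vec_of j != 0%MM by rewrite -e0 (inj_eq (@vec_of_inj f N)).
rewrite -[1]addr0; apply: cgeZ; last exact: cge_mono.
rewrite -[1]add0r; apply: (val_geM vEP).
  apply: (integralM vEP); first exact: E_integral_nat.
  exact: (integralX vEP _ (cT_integral a)).
apply: (val_ge_le _ (val_ge_pX C p_prime _)).
by rewrite ler1n lt0n mdeg_eq0.
Qed.

Definition vtop : PE := mono (rv - d)%MM d - mono 0%MM rv.

Lemma d_le_rv : (d <= rv)%MM.
Proof. exact: (digits_le_r S r_gt (dvec_digits p_prime _)). Qed.

Lemma wt_rv_gt0 : (0 < wt rv)%N.
Proof. by rewrite lt0n; apply: contraNneq r_neq0 => ->. Qed.

(** The Y-weights of the two monomials agree modulo q - 1, so modulo p both become the same multiple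
    of X^r. *)
Lemma subA_vtop a : cge 1 (subA a vtop).
Proof.
have h1 := subA_mod_p a (rv - d)%MM d_le_rv.
have h2 := subA_mod_p a 0%MM (lepm_refl rv).
have e : cT a ^+ wt d = cT a ^+ wt rv.
  have ed : wt d = wt rv %[mod q.-1] by exact: (wt_dvec_mod S p_prime).
  apply: cT_eqmod; rewrite ?wt_rv_gt0 //.
  by rewrite lt0n; apply: contraNneq r_neq0 => z; rewrite -ed z.
have := cgeB h1 h2; rewrite (submK d_le_rv) add0m e opprB addrA subrK.
by rewrite /subA /vtop substB.
Qed.

Lemma subAlpha_vtop : cge 1 (subAlpha vtop + mono 0%MM rv).
Proof.
rewrite /vtop {1}/subAlpha substB -!/(subAlpha _) !subAlpha_mono mdeg0 expr0 scale1r subrK.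
rewrite -[1]addr0; apply: cgeZ; last exact: cge_mono.
apply: (val_ge_le _ (val_ge_pX C p_prime _)); rewrite ler1n lt0n mdeg_eq0.
apply/eqP => e; have := wt_rB_gt0 S p_prime f_gt0 r_gt (dvec_digits p_prime r).
by rewrite e wt0.
Qed.

Definition cond (j : box) : bool := (vec_of j != 0%MM) && (q.-1 %| wt (vec_of j))%N.

Definition u1 : PE :=
  \sum_(j : box | cond j) (bin rv (vec_of j))%:R *: mono (vec_of j) (rv - vec_of j)%MM.
Definition N0 : nat := (\sum_(j : box | cond j) bin rv (vec_of j))%N.
(** The corrected monomial must have X-weight divisible by q - 1, so that [a] occurs in it to the
    same powers as in [u1], and degree at least 2, for the term of T at [alpha]. Putting q - 1 in
    position 0 achieves both, and r_0 is large enough for it. *)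
Definition jstar : vec := (U_(Ordinal f_gt0) *+ q.-1)%MM.
Definition u2 : PE := u1 - N0%:R *: mono jstar (rv - jstar)%MM.

Lemma wt_jstar : wt jstar = q.-1.
Proof. by rewrite /jstar wtMn wt1 expn0 mul1n. Qed.

Lemma mdeg_jstar : mdeg jstar = q.-1.
Proof. by rewrite /jstar mdegMn mdeg1 mul1n. Qed.

Lemma jstar_le : (jstar <= rv)%MM.
Proof.
apply/mnm_lepP => i; rewrite mulmnE mnm1E mnmE.
by case: eqP => [_|_] /=; rewrite ?mul0n ?mul1n // ltnW // (r_ge_q S p_prime r_gt).
Qed.

Lemma q_gt2 : (2 < q)%N.
Proof.
apply: leq_trans p_gt2 _; rewrite -{1}(expn1 p) leq_exp2l //.
Qed.

(** An exponent of degree 1 has weight p^i, which is prime to q - 1 > 1. *)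
Lemma cond_mdeg j : cond j -> (2 <= mdeg (vec_of j))%N.
Proof.
move=> /andP [nz dv]; rewrite ltn_neqAle lt0n mdeg_eq0 nz andbT eq_sym.
apply/negP => /mdeg1P [i /eqP e]; move: dv; rewrite e wt1 => dv.
have eq1 : q = (q.-1 + 1)%N by rewrite addn1 prednK // expn_gt0 prime_gt0.
have : (q.-1 %| q.-1 + 1)%N.
  by rewrite -eq1; apply: dvdn_trans dv _; rewrite dvdn_exp2l // ltnW.
by rewrite dvdn_addr ?dvdnn // dvdn1; have := q_gt2; clear; lia.
Qed.

Definition uni (a : F) : 'M[L]_2 := mx2 1 (teich a) 0 1.

Lemma uni_inK a : inK (uni a).
Proof.
have e : \det (uni a) = 1 by rewrite det2 !mxE /= mulr1 mulr0 subr0.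
apply/inKP; rewrite e oner_neq0 (val1 vLP); split=> // i j; rewrite mxE.
have [ti _ _] := teich_spec a.
by case: ifP => _; case: ifP => _; rewrite ?ti //; [exact: (integral1 vLP) | exact: val_ge0 | exact: (integral1 vLP)].
Qed.

Lemma iter_frob1 i : iter i (frob S) 1 = 1.
Proof. by elim: i => //= i ->; rewrite rmorph1. Qed.

Lemma actE_uni a : aE (uni a) (mono 0%MM rv) =
  \sum_(j : box) ((bin rv (vec_of j))%:R *
      (\prod_(i < f) iter i (frob S) (teich a) ^+ vec_of j i)%:A) *:
    mono (vec_of j) (rv - vec_of j)%MM.
Proof.
rewrite /actE /act subst_mono !mxE /=.
rewrite [X in X * _]big1 ?mul1r => [|i _]; last by rewrite mnm0E.
rewrite (prod_linear_expandX _ _ (le_rv_lt (lepm_refl rv))); apply: eq_bigr => j _.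
rewrite [mpow _ (rv - _)%MM]big1 ?mulr1 => [|i _]; last first.
  by rewrite iter_frob1 scale1r expr1n.
congr ((_ * _) *: _); rewrite -[RHS]/(in_alg EE _) rmorph_prod; apply: eq_bigr => i _.
by rewrite rmorphXn.
Qed.

Lemma wt_gt0E (j : vec) : (0 < wt j)%N = (j != 0%MM).
Proof.
apply/idP/idP => [h|]; last exact: wt_gt0.
by apply: contraTneq h => ->; rewrite wt0.
Qed.

(** Coefficient by coefficient, the sum over Teichmuller lifts reduces to a power sum over F_q,
    which is -1 exactly for the exponents selected in [u1]. *)
Lemma sum_uni : cge 1 (\sum_(a : F) aE (uni a) (mono 0%MM rv) + u1).
Proof.
under eq_bigr do rewrite actE_uni.
rewrite exchange_big /= /u1 [X in _ + X]big_mkcond -big_split /=.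
apply: cge_sum => j _.
(* The scalar is formed over Q_(p^f), where zero reduction already means divisibility by p. *)
pose ka : L := \sum_(a : F) \prod_(i < f) iter i (frob S) (teich a) ^+ vec_of j i + (cond j)%:R.
have kaP : val_ge vL 1 ka.
  have ti (a : F) : v_integral vL (teich a) by case: (teich_spec a).
  have fi a (i : 'I_f) : v_integral vL (iter i (frob S) (teich a) ^+ vec_of j i).
    by apply: (integralX vLP); case: (iter_frob i (ti a)).
  have pi a : v_integral vL (\prod_(i < f) iter i (frob S) (teich a) ^+ vec_of j i).
    exact: (integral_prod vLP).
  have si : v_integral vL (\sum_(a : F) \prod_(i < f) iter i (frob S) (teich a) ^+ vec_of j i).
    by apply: (val_ge_sum vLP) => a _; exact: pi.
  have ni : v_integral vL (cond j)%:R by exact: (integral_nat vLP).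
  apply: maximal_val_ge1; rewrite -(red_eq0 redKP); last exact: (val_geD vLP).
  rewrite (redD redKP) // (red_nat vLP redKP) (red_sum vLP redKP) //.
  rewrite (eq_bigr (fun a : F => a ^+ wt (vec_of j))) => [|a _]; last first.
    rewrite (red_prod vLP redKP) // /wt -prodrXr; apply: eq_bigr => i _.
    rewrite (redX vLP redKP); last by case: (iter_frob i (ti a)).
    have [_ ->] := iter_frob i (ti a); have [_ -> _] := teich_spec a.
    by rewrite -exprM mulnC.
  by rewrite (sum_expf (Fq_card S)) wt_gt0E -/(cond j) addNr.
have -> : \sum_(i : F) ((bin rv (vec_of j))%:R *
      (\prod_(i0 < f) iter i0 (frob S) (teich i) ^+ vec_of j i0)%:A) *:
        mono (vec_of j) (rv - vec_of j)%MM
   + (if cond j then (bin rv (vec_of j))%:R *: mono (vec_of j) (rv - vec_of j)%MM else 0)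
   = ((bin rv (vec_of j))%:R * ka%:A) *: mono (vec_of j) (rv - vec_of j)%MM.
  rewrite -scaler_suml -mulr_sumr /ka scalerDl scaler_suml mulrDr scalerDl; congr (_ + _).
  by case: (cond j); rewrite ?mulr1n ?mulr0n ?scale1r ?mulr1 ?scale0r ?mulr0 ?scale0r.
rewrite -[1]addr0; apply: cgeZ; last exact: cge_mono.
rewrite -[1]add0r; apply: (val_geM vEP); first exact: E_integral_nat.
exact: (val_ge_alg C kaP).
Qed.

(** Two computations of the sum over F_q of (1 + a)^(wt b): by translation it is the power sum of
    exponent [wt b], hence 0; by expansion it is minus the sum of the selected binomial
    coefficients. *)
Lemma dvd_bin_sum (b : vec) : (b <= rv)%MM -> wt b != 0 %[mod q.-1] ->
  (p %| \sum_(j : box | cond j) bin b (vec_of j))%N.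
Proof.
move=> hb nz; have pF := pchar_Fq S p_prime.
rewrite (dvdn_pcharf pF) natr_sum -oppr_eq0.
have frobD (x y : F) i : (x + y) ^+ (p ^ i) = x ^+ (p ^ i) + y ^+ (p ^ i).
  rewrite exprDn_pchar //; apply/andP; split; first by rewrite expn_gt0 prime_gt0.
  apply/allP => l; case: i => [|i] //; rewrite primesX // primes_prime // inE => /eqP ->.
  exact: pF.
have e : \sum_(a : F) \prod_(i < f) (1 + a ^+ (p ^ i)) ^+ b i = 0.
  rewrite (eq_bigr (fun a : F => (1 + a) ^+ wt b)) => [|a _]; last first.
    rewrite /wt -prodrXr; apply: eq_bigr => i _.
    by rewrite mulnC exprM frobD expr1n.
  have -> : \sum_(a : F) (1 + a) ^+ wt b = \sum_(a : F) a ^+ wt b.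
    by rewrite [RHS](reindex_inj (addrI 1)).
  rewrite (sum_expf (Fq_card S)) /dvdn; move: nz; rewrite mod0n => /negPf ->.
  by rewrite andbF oppr0.
apply/eqP; rewrite -[RHS]e.
under [RHS]eq_bigr do rewrite (prod_exprD _ _ (le_rv_lt hb)).
rewrite exchange_big /= -sumrN big_mkcond; apply: eq_bigr => j _.
rewrite sumrMnl (eq_bigr (fun a : F => a ^+ wt (vec_of j))) => [|a _]; last first.
  rewrite /wt -prodrXr; apply: eq_bigr => i _.
  by rewrite expr1n mul1r -exprM mulnC mnmE.
rewrite (sum_expf (Fq_card S)) wt_gt0E -/(cond j).
by case: (cond j); rewrite ?oppr0 ?mul0rn // mulNrn.
Qed.

Lemma wt_rvB_mod (k : vec) : (k <= rv)%MM -> wt rv != wt k %[mod q.-1] ->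
  wt (rv - k)%MM != 0 %[mod q.-1].
Proof.
move=> le; apply: contraNneq => e; rewrite -{1}(submK le) wtD.
by rewrite -modnDml e modnDml add0n.
Qed.

(** All terms contributing to a given monomial thus carry the same power of - [a], which factors
    out. The condition on [k] keeps both exponents positive, including when [a] = 0. *)
Lemma cT_uniform a (j k : vec) : (j <= rv)%MM -> (q.-1 %| wt j)%N ->
  wt rv != wt k %[mod q.-1] ->
  (bin (rv - j)%MM k)%:R * cT a ^+ wt (rv - j - k)%MM =
  (bin (rv - j)%MM k)%:R * cT a ^+ wt (rv - k)%MM :> EE.
Proof.
move=> hj dv nk; case: (boolP (k <= rv - j)%MM) => [hk|/vbin_small ->]; last by rewrite !mul0r.
have hk' : (k <= rv)%MM by exact: lepm_trans hk (lem_subr _ _).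
have e1 : (wt (rv - j - k)%MM + wt j + wt k)%N = wt rv.
  by rewrite -!wtD -addmA (addmC j k) addmA submK // submK.
have e2 : (wt (rv - k)%MM + wt k)%N = wt rv by rewrite -wtD submK.
have em : wt (rv - j - k)%MM = wt (rv - k)%MM %[mod q.-1].
  apply/eqP; rewrite -(eqn_modDr (wt k)) e2 -e1 addnAC.
  by rewrite -(modnDmr _ (wt j)) (eqP dv) addn0.
have nz := wt_rvB_mod hk' nk.
congr (_ * _); apply: cT_eqmod => //; rewrite lt0n; apply: contraNneq nz => z.
  by rewrite -em z.
by rewrite z.
Qed.

Lemma subAlpha_u2 : cge 2 (subAlpha u2).
Proof.
rewrite /u2 /u1 /subAlpha substB substZ subst_sum; apply: cgeB.
  apply: cge_sum => j cj; rewrite substZ -/(subAlpha _) subAlpha_mono scalerA.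
  rewrite -[2]addr0; apply: cgeZ; last exact: cge_mono.
  rewrite -[2]add0r; apply: (val_geM vEP); first exact: E_integral_nat.
  by apply: (val_ge_le _ (val_ge_pX C p_prime _)); rewrite ler_nat cond_mdeg.
rewrite -/(subAlpha _) subAlpha_mono scalerA.
rewrite -[2]addr0; apply: cgeZ; last exact: cge_mono.
rewrite -[2]add0r; apply: (val_geM vEP); first exact: E_integral_nat.
apply: (val_ge_le _ (val_ge_pX C p_prime _)); rewrite ler_nat mdeg_jstar.
by have := q_gt2; clear; lia.
Qed.

Lemma subA_layer a (j : vec) : (j <= rv)%MM -> subA a (mono j (rv - j)%MM) =
  \sum_(k : box) ((bin (rv - j)%MM (vec_of k))%:R * cT a ^+ wt (rv - j - vec_of k)%MM
                   * p%:R ^+ mdeg (vec_of k)) *: mono (rv - vec_of k)%MM (vec_of k).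
Proof.
move=> hj; rewrite subA_mono ?lem_subr //; apply: eq_bigr => k _.
case: (boolP (vec_of k <= rv - j)%MM) => [hk|/vbin_small ->]; last by rewrite !mul0r !scale0r.
congr (_ *: mono _ _); apply/mnmP => i; have /mnm_lepP/(_ i) := hk; have /mnm_lepP/(_ i) := hj.
by rewrite mnmDE !mnmBE; clear; lia.
Qed.

(** The coefficient of X^(r-k) Y^k carries p^|k|, so only |k| = 0 and |k| = 1 need an argument: the
    first coefficient cancels by the choice of [N0], the second is divisible by one more p. *)
Lemma subA_u2 a : cge 2 (subA a u2).
Proof.
(* The coefficient at [k] stripped of its power of p. *)
pose cf (k : box) : EE :=
  \sum_(j : box | cond j) (bin rv (vec_of j))%:R *
     ((bin (rv - vec_of j)%MM (vec_of k))%:R * cT a ^+ wt (rv - vec_of j - vec_of k)%MM)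
  - N0%:R * ((bin (rv - jstar)%MM (vec_of k))%:R * cT a ^+ wt (rv - jstar - vec_of k)%MM).
have -> : subA a u2 =
    \sum_(k : box) (cf k * p%:R ^+ mdeg (vec_of k)) *: mono (rv - vec_of k)%MM (vec_of k).
  rewrite /subA /u2 /u1 substB substZ subst_sum -/(subA a _) (subA_layer a jstar_le).
  rewrite (eq_bigr (fun j : box => \sum_(k : box) ((bin rv (vec_of j))%:R *
     ((bin (rv - vec_of j)%MM (vec_of k))%:R * cT a ^+ wt (rv - vec_of j - vec_of k)%MM) *
      p%:R ^+ mdeg (vec_of k)) *: mono (rv - vec_of k)%MM (vec_of k))) => [|j _]; last first.
    rewrite substZ -/(subA a _).
    case: (boolP (vec_of j <= rv)%MM) => [hj|/vbin_small ->].
      by rewrite subA_layer // scaler_sumr; apply: eq_bigr => k _; rewrite scalerA !mulrA.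
    by rewrite scale0r big1 // => k _; rewrite !mul0r scale0r.
  rewrite exchange_big scaler_sumr -sumrB; apply: eq_bigr => k _.
  by rewrite -scaler_suml -mulr_suml scalerA mulrA -scalerBl -mulrBl.
apply: cge_sum => k _; rewrite -[2]addr0; apply: cgeZ; last exact: cge_mono.
have int_cT n : v_integral vEE (cT a ^+ n) by exact: (integralX vEP _ (cT_integral a)).
have cf_int : val_ge vEE 0 (cf k).
  apply: (val_geB vEP).
    apply: (val_ge_sum vEP) => j _; apply: (integralM vEP); first exact: E_integral_nat.
    by apply: (integralM vEP) => //; exact: E_integral_nat.
  apply: (integralM vEP); first exact: E_integral_nat.
  by apply: (integralM vEP) => //; exact: E_integral_nat.
have [ge2|] := leqP 2 (mdeg (vec_of k)).
  rewrite -[2]add0r; apply: (val_geM vEP) => //.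
  by apply: (val_ge_le _ (val_ge_pX C p_prime _)); rewrite ler_nat.
have cfE : wt rv != wt (vec_of k) %[mod q.-1] -> cf k = cT a ^+ wt (rv - vec_of k)%MM *
    ((\sum_(j : box | cond j) bin rv (vec_of j) * bin (rv - vec_of j)%MM (vec_of k))%N%:R
     - (N0 * bin (rv - jstar)%MM (vec_of k))%N%:R).
  move=> nk; rewrite /cf mulrBr; congr (_ - _).
    rewrite natr_sum mulr_sumr; apply: eq_bigr => j /andP [_ dv].
    case: (boolP (vec_of j <= rv)%MM) => [hj|/vbin_small ->].
      by rewrite cT_uniform // natrM mulrA mulrC.
    by rewrite mul0n mul0r mulr0.
  rewrite cT_uniform ?jstar_le ?wt_jstar //.
  by rewrite natrM mulrA mulrC.
case e: (mdeg (vec_of k)) => [|[|n]] // _.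
  (* Degree 0: the coefficient sum of [u1] minus [N0] is exactly zero. *)
  have k0 : vec_of k = 0%MM by apply/eqP; rewrite -mdeg_eq0 e.
  rewrite cfE; last by rewrite k0 wt0.
  rewrite k0 vbin0 muln1 (eq_bigr (fun j => bin rv (vec_of j))) => [|j _]; last first.
    by rewrite vbin0 muln1.
  by rewrite subrr mulr0 mul0r; exact: val_ge0.
(* Degree 1: the weight of [k] is some p^i, and the hypothesis that r is not p^i modulo q - 1
   applies. *)
have /eqP/mdeg1P [i /eqP ki] := e.
have nk : wt rv != wt (vec_of k) %[mod q.-1] by rewrite ki wt1.
have lek : (vec_of k <= rv)%MM.
  apply/mnm_lepP => l; rewrite ki mnm1E mnmE.
  by case: eqP => //= _; have := r_ge_p S r_gt l; move: p_gt1; clear; lia.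
rewrite (_ : 2 = 1 + 1) //; apply: (val_geM vEP); last exact: (val_ge_pX C p_prime 1).
rewrite cfE // -[1]add0r; apply: (val_geM vEP); first exact: int_cT.
apply: (val_geB vEP).
  (* The trinomial identity takes [bin rv k] out of the sum and leaves the divisible sum for r - k,
     whose weight is nonzero modulo q - 1. *)
  apply: val_ge_dvd => //; under eq_bigr do rewrite vbin_trinomial.
  rewrite -big_distrr /=; apply: dvdn_mull; apply: dvd_bin_sum; first exact: lem_subr.
  exact: wt_rvB_mod.
apply: val_ge_dvd => //; apply: dvdn_mulr; apply: dvd_bin_sum => //; exact: lepm_refl.
Qed.

Lemma subst_idX (v : PE) (c d : 'I_f -> EE) :
  subst (@Xv f EE) (fun i => c i *: Xv EE i + d i *: Yv EE i) v =
  subst (fun i => 1 *: Xv EE i + 0 *: Yv EE i) (fun i => c i *: Xv EE i + d i *: Yv EE i) v.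
Proof. by apply: eq_subst => // i; rewrite scale1r scale0r addr0. Qed.

Lemma V_subA a v : V r v -> V r (subA a v).
Proof. by move=> hv; rewrite /subA subst_idX; exact: V_subst_lin. Qed.

Lemma V_subAlpha v : V r v -> V r (subAlpha v).
Proof.
move=> hv; rewrite /subAlpha.
rewrite (eq_subst (QX := fun i => p%:R *: Xv EE i + 0 *: Yv EE i)
                  (QY := fun i => 0 *: Xv EE i + 1 *: Yv EE i)); first exact: V_subst_lin.
  by move=> i; rewrite scale0r addr0.
by move=> i; rewrite scale1r scale0r add0r.
Qed.

Lemma VE_mono (a b : vec) : (a + b)%MM = rv -> V r (mono a b).
Proof. by move=> e; apply/V_fun; rewrite -e; exact: V_mono. Qed.

Lemma V_vtop : V r vtop.
Proof. by apply: VB; apply: VE_mono; rewrite ?add0m // submK // d_le_rv. Qed.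

Lemma V_u2 : V r u2.
Proof.
apply: VB; last by apply/VZ/VE_mono; rewrite addmC submK // jstar_le.
rewrite /u1 big_mkcond; apply: V_sum => j _; case: ifP => _; last exact: V0.
case: (boolP (vec_of j <= rv)%MM) => [hj|/vbin_small ->].
  by apply/VZ/VE_mono; rewrite addmC submK.
by rewrite scale0r; exact: V0.
Qed.

Definition Amx (a : F) : 'M[L]_2 := mx2 p%:R (teich a) 0 1.
Definition alpha : 'M[L]_2 := mx2 1 0 0 p%:R.

Lemma det_Amx a : \det (Amx a) = p%:R.
Proof. by rewrite det2 !mxE /= mulr1 mulr0 subr0. Qed.

Lemma det_alpha : \det alpha = p%:R.
Proof. by rewrite det2 !mxE /= mul1r mulr0 subr0. Qed.

Lemma Amx_G g a : inG g -> inG (g *m Amx a).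
Proof.
by move=> hg; rewrite /inG unitmx_mul [g \in _]hg unitmxE det_Amx unitfE p_neq0.
Qed.

Lemma alpha_G g : inG g -> inG (g *m alpha).
Proof.
by move=> hg; rewrite /inG unitmx_mul [g \in _]hg unitmxE det_alpha unitfE p_neq0.
Qed.

Lemma Amx_alpha a : Amx a *m alpha = p%:R ^ 1%:Z *: uni a.
Proof.
rewrite -exprnP expr1; apply: mx2P; rewrite mul2E !mxE /=;
  by rewrite ?mulr0 ?mulr1 ?mul0r ?mul1r ?addr0 ?add0r // mulrC.
Qed.

Lemma eltE_K g k v g' : inK k -> elt aE (g *m k) v g' = elt aE g (aE k v) g'.
Proof. apply: elt_K; [exact: p_prime | by move=> *; exact: actE_comp]. Qed.

Lemma eltE_D g u v g' : elt aE g (u + v) g' = elt aE g u g' + elt aE g v g'.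
Proof. by apply: eltD => *; exact: actED. Qed.

Lemma eltE_Z g a v g' : elt aE g (a *: v) g' = a *: elt aE g v g'.
Proof. by apply: eltZ => *; exact: actEZ. Qed.

Lemma eltE_sum g (G : F -> PE) g' :
  elt aE g (\sum_(a : F) G a) g' = \sum_(a : F) elt aE g (G a) g'.
Proof. by apply: elt_sum => *; [exact: actED | exact: actEZ]. Qed.

Lemma indE_elt g v : inG g -> V r v -> indE r (elt aE g v).
Proof.
move=> hg hv; apply: ind_elt.
- exact: p_prime.
- by move=> *; exact: actE_comp.
- by move=> *; exact: actEZ.
- exact: V0.
- by move=> k w _; exact: V_actE.
- exact: hg.
- exact: hv.
Qed.

Lemma indE_add h h' : indE (C := C) r h -> indE r h' -> indE r (fun g => h g + h' g).
Proof.
apply: indD; first by move=> *; exact: actED.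
by move=> *; exact: VD.
Qed.

Lemma indE_scale a h : indE (C := C) r h -> indE r (fun g => a *: h g).
Proof.
apply: indZ; first by move=> *; exact: actEZ.
by move=> *; exact: VZ.
Qed.

Lemma indE_sum (I : Type) (s : seq I) (G : I -> 'M[L]_2 -> PE) :
  (forall i, indE r (G i)) -> indE r (fun g => \sum_(i <- s) G i g).
Proof.
apply: ind_sumT.
- by move=> *; exact: actED.
- by move=> *; exact: actEZ.
- exact: V0.
- by move=> *; exact: VD.
Qed.

Lemma hecke_eltE g v g' : hecke_elt aE (teichE C) g v g' =
  \sum_(a : F) elt aE (g *m Amx a) (subA a v) g' + elt aE (g *m alpha) (subAlpha v) g'.
Proof. by []. Qed.

Lemma indE_hecke g v : inG g -> V r v -> indE r (hecke_elt aE (teichE C) g v).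
Proof.
move=> hg hv; apply: (@indE_add (fun g' => \sum_(a : F) elt aE (g *m Amx a) (subA a v) g')).
  by apply: indE_sum => a; apply: indE_elt; [exact: Amx_G | exact: V_subA].
by apply: indE_elt; [exact: alpha_G | exact: V_subAlpha].
Qed.

Variable ap : EE.
Hypothesis ap_neq0 : ap != 0.
Hypothesis ap_slope : 0 < vE ap < 1.
Local Notation eps := (1 - vE ap).

Lemma eps_gt0 : 0 < eps.
Proof. by case/andP: ap_slope => _ h; rewrite subr_gt0. Qed.

Lemma val_apV : val_ge vEE (- vE ap) ap^-1.
Proof. by rewrite /val_ge (valV vEP) // lexx orbT. Qed.

Lemma cge_apV v : cge 1 v -> cge eps (ap^-1 *: v).
Proof. by move=> h; rewrite addrC; apply: cgeZ => //; exact: val_apV. Qed.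

(** The bound obtained is 2(1 - v(a_p)), which exceeds 1 - v(a_p). *)
Lemma cge_apV2 v : cge 2 v -> cge eps ((ap^-1 * ap^-1) *: v).
Proof.
move=> h; have := cgeZ (val_geM vEP val_apV val_apV) h; apply: cge_le.
have := eps_gt0; rewrite subr_gt0 => lt.
rewrite (_ : 2 = 1 + 1) // addrACA [- _ + 1]addrC -[X in X <= _]addr0 lerD2l.
by rewrite subr_ge0 ltW.
Qed.

(** The terms of T at the [Amx b] are small by [subA_vtop]; the term at [alpha] returns to the
    vertex [g] through [Amx_alpha], as p acts trivially. *)
Lemma hecke_vtop g a g' :
  cge eps (hecke_elt aE (teichE C) (g *m Amx a) (ap^-1 *: vtop) g'
           + ap^-1 *: elt aE g (aE (uni a) (mono 0%MM rv)) g').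
Proof.
rewrite hecke_eltE -addrA; apply: cgeD.
  apply: cge_sum => b _; apply: elt_cge => //.
  by rewrite /subA substZ; apply: cge_apV; exact: subA_vtop.
rewrite -mulmxA Amx_alpha -scalemxAr elt_scale // eltE_K ?uni_inK // -eltE_Z -eltE_D.
apply: elt_cge => //; rewrite -actEZ -actED; apply: cge_actE => //; first exact: uni_inK.
by rewrite /subAlpha substZ -scalerDr; apply: cge_apV; exact: subAlpha_vtop.
Qed.

Lemma hecke_u2 g g' :
  cge eps (hecke_elt aE (teichE C) g ((ap^-1 * ap^-1) *: u2) g').
Proof.
rewrite hecke_eltE; apply: cgeD.
  apply: cge_sum => b _; apply: elt_cge => //.
  by rewrite /subA substZ; apply: cge_apV2; exact: subA_u2.
by apply: elt_cge => //; rewrite /subAlpha substZ; apply: cge_apV2; exact: subAlpha_u2.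
Qed.

Lemma sum_uni_u2 : cge 1 (\sum_(a : F) aE (uni a) (mono 0%MM rv) + u2).
Proof.
rewrite /u2 addrA; apply: cgeB; first exact: sum_uni.
rewrite -[1]addr0; apply: cgeZ; last exact: cge_mono.
by apply: val_ge_dvd => //; apply: dvd_bin_sum; rewrite ?lepm_refl.
Qed.

(* The element of (T - a_p)(ind V(E)) built from the preimages [vtop / a_p] and
   [u2 / a_p^2] is integral and reduces to a single layer of the tree. *)
Lemma analysis g : inG g -> exists h, [/\ indO r h, zero_in_Pi r ap h &
  forall g', cge eps (h g' + \sum_(a : F) elt aE (g *m Amx a) vtop g')].
Proof.
move=> hg.
pose s0 := [seq (g *m Amx a, ap^-1 *: vtop) | a <- enum F] ++ [:: (g, (ap^-1 * ap^-1) *: u2)].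
have sumE (G : 'M[L]_2 -> PE -> PE) : \sum_(c <- s0) G c.1 c.2 =
    \sum_(a : F) G (g *m Amx a) (ap^-1 *: vtop) + G g ((ap^-1 * ap^-1) *: u2).
  by rewrite /s0 big_cat big_seq1 big_map big_enum.
have s0P c : c \in s0 -> inG c.1 /\ V r c.2.
  rewrite mem_cat inE => /orP [/mapP [a _ ->]|/eqP ->] /=.
    by split; [exact: Amx_G | apply/VZ/V_vtop].
  by split=> //; apply/VZ/V_u2.
pose x g' := \sum_(a : F) elt aE (g *m Amx a) (ap^-1 *: vtop) g'
             + elt aE g ((ap^-1 * ap^-1) *: u2) g'.
pose y g' := \sum_(a : F) hecke_elt aE (teichE C) (g *m Amx a) (ap^-1 *: vtop) g'
             + hecke_elt aE (teichE C) g ((ap^-1 * ap^-1) *: u2) g'.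
have ix : indE r x.
  apply: indE_add; last by apply: indE_elt => //; exact/VZ/V_u2.
  by apply: indE_sum => a; apply: indE_elt; [exact: Amx_G | exact/VZ/V_vtop].
have iy : indE r y.
  apply: indE_add; last by apply: indE_hecke => //; exact/VZ/V_u2.
  by apply: indE_sum => a; apply: indE_hecke; [exact: Amx_G | exact/VZ/V_vtop].
pose h g' := y g' + (- ap) *: x g'.
have key g' : cge eps (h g' + \sum_(a : F) elt aE (g *m Amx a) vtop g').
  have fX : ap *: \sum_(a : F) elt aE (g *m Amx a) (ap^-1 *: vtop) g' =
      \sum_(a : F) elt aE (g *m Amx a) vtop g'.
    rewrite scaler_sumr; apply: eq_bigr => a _.
    by rewrite eltE_Z scalerA mulfV // scale1r.
  have f2 : ap *: elt aE g ((ap^-1 * ap^-1) *: u2) g' = ap^-1 *: elt aE g u2 g'.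
    by rewrite eltE_Z scalerA mulrA mulfV // mul1r.
  have fZ : elt aE g (ap^-1 *: (\sum_(a : F) aE (uni a) (mono 0%MM rv) + u2)) g' =
      \sum_(a : F) ap^-1 *: elt aE g (aE (uni a) (mono 0%MM rv)) g' + ap^-1 *: elt aE g u2 g'.
    by rewrite eltE_Z eltE_D eltE_sum scalerDr scaler_sumr.
  have S1 : cge eps (\sum_(a : F) hecke_elt aE (teichE C) (g *m Amx a) (ap^-1 *: vtop) g'
      + \sum_(a : F) ap^-1 *: elt aE g (aE (uni a) (mono 0%MM rv)) g').
    by rewrite -big_split; apply: cge_sum => a _; exact: hecke_vtop.
  have S2 : cge eps (elt aE g (ap^-1 *: (\sum_(a : F) aE (uni a) (mono 0%MM rv) + u2)) g').
    by apply: elt_cge => //; apply: cge_apV; exact: sum_uni_u2.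
  rewrite fZ in S2.
  have xE : ap *: x g' = \sum_(a : F) elt aE (g *m Amx a) vtop g' + ap^-1 *: elt aE g u2 g'.
    by rewrite /x scalerDr fX f2.
  have hE : h g' = y g' - ap *: x g' by rewrite /h scaleNr.
  rewrite hE xE /y.
  have := cgeB (cgeD S1 (hecke_u2 g g')) S2; congr cge.
  exact/esym/zmod_cancel.
have ih : indE r h by apply: indE_add => //; exact: indE_scale.
exists h; split=> //.
  have [h1 h2 h3 h4] := ih; split=> // g'; split=> // m.
  have int0 : cge 0 (\sum_(a : F) elt aE (g *m Amx a) vtop g').
    apply: cge_sum => a _; apply: elt_cge => //; apply: cgeB; exact: cge_mono.
  rewrite -[h g'](addrK (\sum_(a : F) elt aE (g *m Amx a) vtop g')).
  by apply: cgeB => //; apply: cge_le (key g'); rewrite ltW // eps_gt0.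
exists x, y; split=> //.
  by exists s0; split=> // g'; rewrite (sumE (fun g1 v1 => _ g1 v1 g')).
by move=> g'; rewrite /h scaleNr.
Qed.

Definition vtopk : Pk := monok (rv - d)%MM d - monok 0%MM rv.

Lemma red_vtop : red_of vtop vtopk.
Proof.
have := red_ofD (red_of_X C (mjoin (rv - d)%MM d)) (red_ofZ (_ : v_integral vEE (-1)) (red_of_X C (mjoin 0%MM rv))).
have i1 : v_integral vEE (-1) by apply: (val_geN vEP); exact: E_integral1.
move=> /(_ i1); rewrite (redN vEP redEP) ?(red1 redEP) ?scaleN1r //.
exact: E_integral1.
Qed.

(** The negative of the argument is the reduction of the integral element [h] of [analysis], which
    vanishes in Pi, and [s] is prescribed on reductions. *)
Lemma s_layer (TB : lmodType K) (iota : ('M[L]_2 -> PE) -> TB) (s : ('M[L]_2 -> Pk) -> TB) g :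
  theta_map r ap iota -> is_natural_surjection r iota s -> inG g ->
  s (fun g' => \sum_(a : F) elt (actk 0) (g *m Amx a) vtopk g') = 0.
Proof.
move=> [_ _ th] [sD sZ sred] hg; have [h [hO hz key]] := analysis hg.
have ik a : indk (Vr r) (elt (actk 0) (g *m Amx a) vtopk).
  apply: ind_elt.
  - exact: p_prime.
  - by move=> *; exact: actk_comp.
  - by move=> *; exact: actGammaZ.
  - exact: V0.
  - by move=> k w _; exact: V_actGamma.
  - exact: Amx_G.
  - apply: VB; apply/V_fun.
      by have := @V_mono f K (rv - d)%MM d; rewrite submK // d_le_rv.
    by have := @V_mono f K 0%MM rv; rewrite add0m.
pose x g' := \sum_(a : F) elt (actk 0) (g *m Amx a) vtopk g'.
have ix : indk (Vr r) x.
  apply: ind_sumT.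
  - by move=> *; exact: actGammaD.
  - by move=> *; exact: actGammaZ.
  - exact: V0.
  - by move=> *; exact: VD.
  - exact: ik.
have ix' : indk (Vr r) (fun g' => -1 *: x g').
  apply: indZ ix; first by move=> *; exact: actGammaZ.
  by move=> *; exact: VZ.
have := sred h (fun g' => -1 *: x g') hO ix' _.
rewrite (th h hO hz) sZ // scaleN1r => e0.
apply/eqP; rewrite -oppr_eq0; apply/eqP; apply: e0 => g' m.
have [hi hr] : red_of (\sum_(a : F) elt aE (g *m Amx a) vtop g') (x g').
  by apply: red_of_sum => a; apply: elt_red => //; exact: red_vtop.
have hh : v_integral vEE (h g')@_m by have [/(_ g') [_ /(_ m)]] := hO.
rewrite mcoeffZ hr mulN1r; apply/esym/eqP.
rewrite -addr_eq0 -(redD redEP hh (hi m)) (red_eq0 redEP (val_geD vEP hh (hi m))).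
rewrite -mcoeffD; apply: (val_ge_maximal eps_gt0); exact: key.
Qed.
End Analysis.

(** * Matrix relations permuting the Hecke representatives *)

Section TwoByTwoRelations.
Variable F : fieldType.
Implicit Types x t u : F.

Lemma mk2_mul (a b c d a' b' c' d' : F) : mk2 a b c d *m mk2 a' b' c' d' =
  mk2 (a * a' + b * c') (a * b' + b * d') (c * a' + d * c') (c * b' + d * d').
Proof. by apply: mx2P; rewrite mul2E !mxE. Qed.

(** For x = p, t = [a] and u = [1/a] the fraction is integral, because u t reduces to 1; the last
    factor then lies in K. *)
Lemma weyl_rel x t u : x != 0 ->
  mk2 0 1 1 0 *m mk2 x t 0 1 = mk2 x u 0 1 *m mk2 (- u) ((1 - u * t) / x) x t.
Proof. by move=> nz; rewrite !mk2_mul; congr mk2; field. Qed.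

Lemma weyl_det x t u : x != 0 -> \det (mk2 (- u) ((1 - u * t) / x) x t) = -1.
Proof. by move=> nz; rewrite det_mk2; field. Qed.

(** For x = p, t = [a], s = [b] and u = [a + b] the fraction is integral: the Teichmuller lift is
    additive modulo p. *)
Lemma upper_rel x s t u : x != 0 ->
  mk2 1 s 0 1 *m mk2 x t 0 1 = mk2 x u 0 1 *m mk2 1 ((t + s - u) / x) 0 1.
Proof. by move=> nz; rewrite !mk2_mul; congr mk2; field. Qed.

Lemma weyl_rel0 x : mk2 0 1 1 0 *m mk2 x 0 0 1 = mk2 1 0 0 x *m mk2 0 1 1 0.
Proof. by rewrite !mk2_mul; congr mk2; ring. Qed.

Lemma weyl_rel1 x : mk2 0 1 1 0 *m mk2 1 0 0 x = mk2 x 0 0 1 *m mk2 0 1 1 0.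
Proof. by rewrite !mk2_mul; congr mk2; ring. Qed.

Lemma upper_rel1 x s : mk2 1 s 0 1 *m mk2 1 0 0 x = mk2 1 0 0 x *m mk2 1 (s * x) 0 1.
Proof. by rewrite !mk2_mul; congr mk2; ring. Qed.
End TwoByTwoRelations.

(** * From one element to the image of T on the induced cosocle *)

Section Main.
Variables (p f : nat) (S : unramified p f) (C : coefficients S).
Hypothesis p_prime : prime p.
Hypothesis p_gt2 : (2 < p)%N.
Hypothesis f_gt0 : (0 < f)%N.
Local Notation q := (p ^ f)%N.
Local Notation F := (Fq S).
Local Notation L := (Qpf S).
Local Notation EE := (E C).
Local Notation K := (kbar C).
Local Notation io := (Fq_kbar C).
Local Notation PE := (pol f EE).
Local Notation Pk := (pol f K).
Local Notation vL := (@vK p f S).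
Local Notation vec := 'X_{1..f}.
Local Notation mono := (@mono f K).
Local Notation wt := (@wt p f).
Local Notation redmx := (map_mx (@redK p f S)).
Let vLP := @vK_spec p f S.
Let redKP := @redK_spec p f S.
Let p_gt1 : (1 < p)%N := prime_gt1 p_prime.

Variable r : 'I_f -> nat.
Hypothesis r_gt : forall i, (p ^ f + p - 2 < r i)%N.
Local Notation rv := [multinom r i | i < f].
Hypothesis r_neq0 : wt rv != 0 %[mod q.-1].
Hypothesis r_neqp : forall j : 'I_f, wt rv != p ^ j %[mod q.-1].
Variable ap : EE.
Hypothesis ap_neq0 : ap != 0.
Hypothesis ap_slope : 0 < vE ap < 1.
Variables (TB : lmodType K) (iota : ('M[L]_2 -> PE) -> TB) (s : ('M[L]_2 -> Pk) -> TB).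
Hypothesis iota_theta : theta_map r ap iota.
Hypothesis s_nat : is_natural_surjection r iota s.
Local Notation W := (Qfil r f.-1 : Pk -> Prop).
Let hW : ev_module r W := Qfil_module C p_prime f_gt0 r_gt f.-1.

Lemma W_Vr v : W v -> Vr r v. Proof. by case: hW => [[h _ _ _ _] _]; exact: h. Qed.
Lemma W0 : W 0. Proof. by case: hW => [[]]. Qed.
Lemma WD u v : W u -> W v -> W (u + v). Proof. by case: hW => [[_ _ h _ _] _]; exact: h. Qed.
Lemma WZ a v : W v -> W (a *: v). Proof. by case: hW => [[_ _ _ h _] _]; exact: h. Qed.
Lemma W_actk k v : inK k -> W v -> W (actk 0 k v).
Proof. by case: hW => [[_ _ _ _ h] _] hk; apply: h; exact: map_redK_unit. Qed.

Lemma W_trans u v t : W (u - v) -> W (v - t) -> W (u - t).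
Proof. by move=> h1 h2; have := WD h1 h2; rewrite addrA subrK. Qed.

Lemma W_sym u v : W (u - v) -> W (v - u).
Proof. by move=> h; have := WZ (-1) h; rewrite scaleN1r opprB. Qed.

Lemma actkD m k (u v : Pk) : actk m k (u + v) = actk m k u + actk m k v.
Proof. exact: actGammaD. Qed.
Lemma actkZ m k a (v : Pk) : actk m k (a *: v) = a *: actk m k v.
Proof. exact: actGammaZ. Qed.
Lemma actkM m k k' (v : Pk) : inK k -> inK k' -> actk m (k *m k') v = actk m k (actk m k' v).
Proof. exact: actk_comp. Qed.

Local Notation el := (elt (actk 0 : 'M[L]_2 -> Pk -> Pk)).

Lemma el_W g v : inG g -> W v -> indk W (el g v).
Proof.
move=> hg hv; apply: ind_elt.
- exact: p_prime.
- by move=> *; exact: actkM.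
- by move=> *; exact: actkZ.
- exact: W0.
- by move=> *; exact: W_actk.
- exact: hg.
- exact: hv.
Qed.

Lemma el_V g v : inG g -> Vr r v -> indk (Vr r) (el g v).
Proof.
move=> hg hv; apply: ind_elt.
- exact: p_prime.
- by move=> *; exact: actkM.
- by move=> *; exact: actkZ.
- exact: V0.
- by move=> k u _; exact: V_actGamma.
- exact: hg.
- exact: hv.
Qed.

Lemma el_D g u v g' : el g (u + v) g' = el g u g' + el g v g'.
Proof. by apply: eltD => *; exact: actkD. Qed.
Lemma el_Z g a v g' : el g (a *: v) g' = a *: el g v g'.
Proof. by apply: eltZ => *; exact: actkZ. Qed.
Lemma el_B g u v g' : el g (u - v) g' = el g u g' - el g v g'.
Proof. by rewrite -scaleN1r el_D el_Z scaleN1r. Qed.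
Lemma el_K g k v g' : inK k -> el (g *m k) v g' = el g (actk 0 k v) g'.
Proof. apply: elt_K; [exact: p_prime | by move=> *; exact: actkM]. Qed.

Lemma indW_D h h' : indk W h -> indk W h' -> indk W (fun g => h g + h' g).
Proof. by apply: indD => [*|*]; [exact: actkD | exact: WD]. Qed.
Lemma indW_Z a h : indk W h -> indk W (fun g => a *: h g).
Proof. by apply: indZ => [*|*]; [exact: actkZ | exact: WZ]. Qed.
Lemma indV_D h h' : indk (C := C) (Vr r) h -> indk (Vr r) h' -> indk (Vr r) (fun g => h g + h' g).
Proof. by apply: indD => [*|*]; [exact: actkD | exact: VD]. Qed.
Lemma indV_Z a h : indk (C := C) (Vr r) h -> indk (Vr r) (fun g => a *: h g).
Proof. by apply: indZ => [*|*]; [exact: actkZ | exact: VZ]. Qed.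
Lemma indW_V h : indk W h -> indk (Vr r) h.
Proof. by apply: ind_mono; exact: W_Vr. Qed.
Lemma ind0k (M : Pk -> Prop) : M 0 -> indk M (fun=> 0).
Proof. by move=> h; apply: ind0 => [*|]; [exact: actkZ | exact: h]. Qed.

Lemma indW_sum (I : Type) (t : seq I) (G : I -> 'M[L]_2 -> Pk) :
  (forall i, indk W (G i)) -> indk W (fun g => \sum_(i <- t) G i g).
Proof.
move=> h; elim: t => [|i t IH].
  rewrite (_ : (fun _ => _) = fun=> 0); first exact: (ind0k W0).
  by apply: functional_extensionality => g; rewrite big_nil.
rewrite (_ : (fun _ => _) = fun g => G i g + \sum_(j <- t) G j g); first exact: indW_D.
by apply: functional_extensionality => g; rewrite big_cons.
Qed.

Lemma indV_sum (I : Type) (t : seq I) (G : I -> 'M[L]_2 -> Pk) :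
  (forall i, indk (Vr r) (G i)) -> indk (Vr r) (fun g => \sum_(i <- t) G i g).
Proof.
move=> h; elim: t => [|i t IH].
  rewrite (_ : (fun _ => _) = fun=> 0); first by apply: ind0k; exact: V0.
  by apply: functional_extensionality => g; rewrite big_nil.
rewrite (_ : (fun _ => _) = fun g => G i g + \sum_(j <- t) G j g); first exact: indV_D.
by apply: functional_extensionality => g; rewrite big_cons.
Qed.

Lemma indW_of h : indk (Vr r) h -> (forall g, W (h g)) -> indk W h.
Proof. by move=> [_ h2 h3 h4] h1. Qed.

(** The map [s] is controlled only on ind V_r, so membership there is carried along. *)
Definition Fok (x : 'M[L]_2 -> Pk) : Prop := indk (Vr r) x /\ Ffil r s f.-1 (s x).

Lemma Fok_W x : indk W x -> Fok x.
Proof. by move=> h; split; [exact: indW_V | exists x]. Qed.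

Lemma Fok_D x y : Fok x -> Fok y -> Fok (fun g => x g + y g).
Proof.
move=> [ix [x' hx ex]] [iy [y' hy ey]]; split; first exact: indV_D.
case: s_nat => sD _ _; exists (fun g => x' g + y' g); first exact: indW_D.
by rewrite sD // ex ey sD //; exact: indW_V.
Qed.

Lemma Fok_Z a x : Fok x -> Fok (fun g => a *: x g).
Proof.
move=> [ix [x' hx ex]]; split; first exact: indV_Z.
case: s_nat => _ sZ _; exists (fun g => a *: x' g); first exact: indW_Z.
by rewrite sZ // ex sZ //; exact: indW_V.
Qed.

Lemma Fok_ext x y : x =1 y -> Fok x -> Fok y.
Proof. by move=> /functional_extensionality ->. Qed.

Lemma Fok_mod x y : Fok x -> indk W (fun g => y g - x g) -> Fok y.
Proof.
move=> hx /Fok_W /(Fok_D hx); apply: Fok_ext => g.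
by rewrite addrC subrK.
Qed.

Lemma Fok_sum (I : eqType) (t : seq I) (G : I -> 'M[L]_2 -> Pk) :
  (forall i, i \in t -> Fok (G i)) -> Fok (fun g => \sum_(i <- t) G i g).
Proof.
elim: t => [|i t IH] h.
  apply: (@Fok_ext (fun=> 0)); first by move=> g; rewrite big_nil.
  by apply: Fok_W; exact: (ind0k W0).
apply: (@Fok_ext (fun g => G i g + \sum_(j <- t) G j g)).
  by move=> g; rewrite big_cons.
apply: Fok_D; first by apply: h; rewrite inE eqxx.
by apply: IH => j hj; apply: h; rewrite inE hj orbT.
Qed.

Local Notation Mtop := (Mtop C r).

Lemma Fok_layer g : inG g -> Fok (fun g' => \sum_(a : F) el (g *m Amx a) Mtop g').
Proof.
move=> hg.
have vV : Vr r (vtopk C r).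
  rewrite /vtopk; apply: VB; apply: Vr_mono; rewrite ?add0m //.
  by rewrite submK // (d_le_rv S p_prime r_gt).
have f1 : Fok (fun g' => \sum_(a : F) el (g *m Amx a) (vtopk C r) g').
  split; first by apply: indV_sum => a; apply: el_V => //; exact: Amx_G.
  rewrite (s_layer p_prime p_gt2 f_gt0 r_gt r_neq0 r_neqp ap_neq0 ap_slope iota_theta s_nat hg).
  exists (fun=> 0); first exact: (ind0k W0).
  case: s_nat => _ sZ _; have := sZ 0 (fun=> 0) (ind0k (@V0 f K r)).
  rewrite (scale0r (s _)) => <-.
  by congr s; apply: functional_extensionality => g'; rewrite scaler0.
apply: (Fok_mod f1).
rewrite (_ : (fun _ => _) = fun g' => \sum_(a : F) el (g *m Amx a) (mono 0%MM rv) g').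
  apply: indW_sum => a; apply: el_W; first exact: Amx_G.
  apply: Qfil_sub0; exists 0, (mono 0%MM rv); split; rewrite ?add0r //; first exact: Vstar0.
  (* The Weyl element sends X^r to Y^r, so Y^r lies in X_r and [vtopk] may be replaced by [Mtop]. *)
  exists [:: (1, mk2 0 1 1 0)]; split.
    by move=> c; rewrite inE => /eqP -> /=; rewrite unitmxE det_mk2 mulr0 mul1r sub0r unitrN1.
  rewrite big_seq1 scale1r /= prodX_mono actGamma0 /act subst_mono.
  rewrite [X in _ * X]big1 ?mulr1 => [|i _]; last by rewrite mnm0E.
  rewrite mono0l; apply: eq_bigr => i _; rewrite !mxE /=.
  by rewrite (io1X C) (io0X C p_prime) scale0r add0r scale1r.
apply: functional_extensionality => g'; rewrite -sumrB; apply: eq_bigr => a _.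
by rewrite -el_B /vtopk opprB addrC subrK.
Qed.

(** * One weight mapping to the cosocle *)

Section Weight.
Variables (w : 'I_f -> nat) (m : nat) (phi : Pk -> Pk).
Hypothesis w_lt : forall i, (w i < p)%N.
Hypothesis phi_wm : weight_morphism r w m phi.
Local Notation wv := [multinom w i | i < f].
Local Notation elm := (elt (actk m : 'M[L]_2 -> Pk -> Pk)).

Lemma Vw_mono a b : (a + b)%MM = wv -> V w (mono a b).
Proof. by move=> e; apply/V_fun; rewrite -e; exact: V_mono. Qed.

Lemma phi_Vr v : V w v -> Vr r (phi v).
Proof.
case: phi_wm => h _ _ hv.
by have [[sub _ _ _ _] _] := Qfil_module C p_prime f_gt0 r_gt f; apply: sub; exact: h.
Qed.

(** Since [phi] is a lift, it is linear only modulo [W], and its value at 0 need not be 0. *)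
Lemma phi0 : W (phi 0).
Proof.
case: phi_wm => _ h _; have := h 1 0 0 (@V0 f K w) (@V0 f K w).
rewrite !scale1r addr0 opprD addrA subrr add0r => /(WZ (-1)).
by rewrite scaleN1r opprK.
Qed.

Lemma phiZ a v : V w v -> W (phi (a *: v) - a *: phi v).
Proof.
case: phi_wm => _ h _ hv; have := h a v 0 hv (@V0 f K w).
by rewrite addr0 opprD addrA => /WD/(_ phi0); rewrite subrK.
Qed.

Lemma phiD u v : V w u -> V w v -> W (phi (u + v) - (phi u + phi v)).
Proof.
by case: phi_wm => _ h _ hu hv; have := h 1 u v hu hv; rewrite !scale1r.
Qed.

Lemma phi_sum (I : eqType) (t : seq I) (G : I -> Pk) :
  (forall i, V w (G i)) -> W (phi (\sum_(i <- t) G i) - \sum_(i <- t) phi (G i)).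
Proof.
move=> h; elim: t => [|i t IH]; first by rewrite !big_nil subr0; exact: phi0.
rewrite !big_cons; apply: W_trans (phiD (h i) (V_sum _)) _ => //.
by rewrite opprD addrACA subrr add0r.
Qed.

Lemma phiA k v : inK k -> V w v -> W (phi (actk m k v) - actk 0 k (phi v)).
Proof. by case: phi_wm => _ _ h hk hv; apply: h => //; exact: map_redK_unit. Qed.

Lemma phi_elt g v g' : V w v -> W (phi (elm g v g') - el g (phi v) g').
Proof.
move=> hv; rewrite /elt; case: ifP => h; first exact: (phiA (inKZ_K h) hv).
by rewrite subr0; exact: phi0.
Qed.

Lemma V_elm g v g' : V w v -> V w (elm g v g').
Proof.
move=> hv; rewrite /elt; case: ifP => _; last exact: V0.
exact: V_actGamma.
Qed.

(** The index set [option F] is the projective line over F_q, with [None] as the point at infinity;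
    both parts of T then become one sum. *)
Definition Bm (B : option F) : 'M[L]_2 := if B is Some a then Amx a else alpha S.
(* The reduction of the adjugate of [Bm B]. *)
Definition Nm (B : option F) : 'M[F]_2 :=
  if B is Some a then mk2 1 (- a) 0 0 else mk2 0 0 0 1.
Definition actN (B : option F) (v : Pk) : Pk := act (fun i x => io x ^+ (p ^ i)) (Nm B) v.

Lemma V_actN B v : V w v -> V w (actN B v).
Proof. exact: V_act. Qed.

Lemma Bm_G g B : inG g -> inG (g *m Bm B).
Proof. by case: B => [a|] h; [exact: Amx_G | exact: alpha_G]. Qed.

Lemma sum_option (G : option F -> Pk) :
  \sum_(B : option F) G B = \sum_(a : F) G (Some a) + G None.
Proof.
rewrite (bigD1 None) //= addrC; congr (_ + _).
rewrite (reindex_omap Some id) => [|[a|]] //.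
by apply: eq_bigl => a; rewrite eqxx.
Qed.

Lemma hecke_elt_sum g v g' :
  hecke_elt (actk m : 'M[L]_2 -> Pk -> Pk) io g v g' = \sum_(B : option F) elm (g *m Bm B) (actN B v) g'.
Proof.
have p0 : p%:R = 0 :> K by exact: (pcharf0 (pchar_kbar C p_prime)).
have hA a : actN (Some a) v =
    subst (@Xv f K) (fun i => (- io a) ^+ (p ^ i) *: Xv K i + p%:R *: Yv K i) v.
  apply: eq_subst => i; rewrite !mxE /=.
    by rewrite (io1X C) (io0X C p_prime) scale1r scale0r addr0.
  by rewrite (io0X C p_prime) p0 rmorphN scale0r.
have hB : actN None v = subst (fun i => p%:R *: Xv K i) (@Yv f K) v.
  apply: eq_subst => i; rewrite !mxE /=.
    by rewrite (io0X C p_prime) p0 !scale0r addr0.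
  by rewrite (io1X C) (io0X C p_prime) scale1r scale0r add0r.
rewrite [RHS]sum_option hB; under [in RHS]eq_bigr do rewrite hA.
by [].
Qed.

(** A representative of (ind phi)(T [g, v]), with [phi] applied to the vectors rather than to the
    values of the function ([phi_hecke]). *)
Definition Zel (g : 'M[L]_2) (v : Pk) (g' : 'M[L]_2) : Pk :=
  \sum_(B : option F) el (g *m Bm B) (phi (actN B v)) g'.

Lemma phi_hecke g v g' : V w v ->
  W (phi (hecke_elt (actk m : 'M[L]_2 -> Pk -> Pk) io g v g') - Zel g v g').
Proof.
move=> hv; rewrite hecke_elt_sum.
apply: W_trans (phi_sum _ _) _ => [B|]; first by apply: V_elm; exact: V_actN.
rewrite /Zel -sumrB; elim/big_ind: _ => [|*|B _].
- exact: W0.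
- exact: WD.
- by apply: phi_elt; exact: V_actN.
Qed.

Lemma sum_el_W g (u u' : option F -> Pk) : inG g -> (forall B, W (u B - u' B)) ->
  indk W (fun g' => \sum_(B : option F) el (g *m Bm B) (u B) g'
                    - \sum_(B : option F) el (g *m Bm B) (u' B) g').
Proof.
move=> hg h.
rewrite (_ : (fun _ => _) = fun g' => \sum_(B : option F) el (g *m Bm B) (u B - u' B) g').
  by apply: indW_sum => B; apply: el_W; [exact: Bm_G | exact: h].
by apply: functional_extensionality => g'; rewrite -sumrB; apply: eq_bigr => B _; rewrite el_B.
Qed.

Lemma Zel_lin g a u v : inG g -> V w u -> V w v ->
  indk W (fun g' => Zel g (a *: u + v) g' - (a *: Zel g u g' + Zel g v g')).
Proof.
move=> hg hu hv.
rewrite (_ : (fun _ => _) = fun g' => Zel g (a *: u + v) g' -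
   \sum_(B : option F) el (g *m Bm B) (a *: phi (actN B u) + phi (actN B v)) g').
  apply: sum_el_W => // B.
  have -> : actN B (a *: u + v) = a *: actN B u + actN B v.
    by rewrite /actN /act substD substZ.
  by case: phi_wm => _ h _; apply: h; exact: V_actN.
apply: functional_extensionality => g'; congr (_ - _).
rewrite /Zel scaler_sumr -big_split; apply: eq_bigr => B _ /=.
by rewrite el_D el_Z.
Qed.

Lemma actGamma_act m' (g : 'M[F]_2) (v : Pk) :
  actGamma m' g v = io (\det g) ^+ m' *: act (fun i x => io x ^+ (p ^ i)) g v.
Proof. by []. Qed.

Lemma act_io_comp (g h : 'M[F]_2) (v : Pk) :
  act (fun i x => io x ^+ (p ^ i)) (g *m h) v =
  act (fun i x => io x ^+ (p ^ i)) g (act (fun i x => io x ^+ (p ^ i)) h v).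
Proof. by rewrite -!actGamma0 actGamma_comp. Qed.

(* If [k Bm(B) = Bm(sg B) kB(B)] then [kB(B) adj(Bm B) = adj(Bm (sg B)) k]; this
   is the G-equivariance of the Hecke operator on a set of representatives. *)
Lemma Zel_equiv (k : 'M[L]_2) (sg : option F -> option F) (kB : option F -> 'M[L]_2) g v :
  inK k -> injective sg -> (forall B, k *m Bm B = Bm (sg B) *m kB B) ->
  (forall B, inK (kB B)) -> (forall B, redmx (kB B) *m Nm B = Nm (sg B) *m redmx k) ->
  (forall B, \det (redmx (kB B)) = \det (redmx k)) ->
  inG g -> V w v ->
  indk W (fun g' => Zel g (actk m k v) g' - Zel (g *m k) v g').
Proof.
move=> hk isg ek hkB eN ed hg hv.
have key (G : option F -> Pk) : \sum_(B : option F) G B = \sum_(B : option F) G (sg B).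
  by rewrite (reindex_inj isg).
have e1 g' : Zel (g *m k) v g' =
    \sum_(B : option F) el (g *m Bm (sg B)) (actk 0 (kB B) (phi (actN B v))) g'.
  by apply: eq_bigr => B _; rewrite -mulmxA ek mulmxA el_K.
have e2 g' : Zel g (actk m k v) g' =
    \sum_(B : option F) el (g *m Bm (sg B)) (phi (actN (sg B) (actk m k v))) g'.
  exact: (key (fun B => el (g *m Bm B) (phi (actN B (actk m k v))) g')).
rewrite (_ : (fun _ => _) = fun g' => \sum_(B : option F) el (g *m Bm (sg B))
   (phi (actN (sg B) (actk m k v)) - actk 0 (kB B) (phi (actN B v))) g'); last first.
  apply: functional_extensionality => g'; rewrite e1 e2 -sumrB; apply: eq_bigr => B _.
  by rewrite el_B.
apply: indW_sum => B; apply: el_W; first exact: Bm_G.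
rewrite (_ : actN (sg B) (actk m k v) = actk m (kB B) (actN B v)).
  by apply: phiA => //; exact: V_actN.
rewrite /actk [in RHS]actGamma_act ed /actN -act_io_comp eN act_io_comp.
by rewrite actGamma_act [in LHS]/act substZ.
Qed.

(** Quantifying over all [g] makes the property stable under translation by K, because [g k, v] =
    [g, k v]. *)
Definition OKv (v : Pk) : Prop := forall g, inG g -> Fok (Zel g v).

Lemma OKv_lin a u v : V w u -> V w v -> OKv u -> OKv v -> OKv (a *: u + v).
Proof.
move=> hu hv ou ov g hg.
apply: (Fok_mod (Fok_D (Fok_Z a (ou g hg)) (ov g hg))).
exact: Zel_lin.
Qed.

Lemma inG_K (g k : 'M[L]_2) : inG g -> inK k -> inG (g *m k).
Proof.
move=> hg hk; rewrite /inG unitmx_mul; apply/andP; split; first exact: hg.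
exact: (inKZ_G (inKZ_inK p_prime hk)).
Qed.

Lemma OKv_equiv (k : 'M[L]_2) (sg : option F -> option F) (kB : option F -> 'M[L]_2) v :
  inK k -> injective sg -> (forall B, k *m Bm B = Bm (sg B) *m kB B) ->
  (forall B, inK (kB B)) -> (forall B, redmx (kB B) *m Nm B = Nm (sg B) *m redmx k) ->
  (forall B, \det (redmx (kB B)) = \det (redmx k)) ->
  V w v -> OKv v -> OKv (actk m k v).
Proof.
move=> hk isg ek hkB eN ed hv ov g hg.
apply: (Fok_mod (ov (g *m k) (inG_K hg hk))).
exact: (Zel_equiv hk isg ek hkB eN ed).
Qed.

Lemma redmx_mx2 (a b c e : L) :
  redmx (mx2 a b c e) = mk2 (redK a) (redK b) (redK c) (redK e).
Proof. by apply: mx2P; rewrite !mxE. Qed.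

Lemma redK_p : redK (p%:R : L) = 0.
Proof. by rewrite (red_nat vLP redKP) (pcharf0 (pchar_Fq S p_prime)). Qed.

Lemma teich_red (a : F) : v_integral vL (teich a) /\ redK (teich a) = a.
Proof. by case: (teich_spec a). Qed.

(** A nonzero solution of x^q = x satisfies x^(q-1) = 1, so its reduction is not 0. *)
Lemma teich0 : teich (0 : F) = 0.
Proof.
have [h1 h2 h3] := teich_spec (0 : F).
apply/eqP/negPn/negP => nz.
have e1 : teich (0 : F) ^+ q.-1 = 1.
  by apply: (mulfI nz); rewrite -exprS prednK ?mulr1 ?h3 // expn_gt0 prime_gt0.
have := congr1 (@redK p f S) e1; rewrite (redX vLP redKP) // h2 (red1 redKP) expr0n.
by rewrite gtn_eqF ?qm1_gt0 //= => /eqP; rewrite eq_sym oner_eq0.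
Qed.

Lemma div_p_integral (x : L) : v_integral vL x -> redK x = 0 -> v_integral vL (x / p%:R).
Proof.
move=> hx /eqP; rewrite (red_eq0 redKP) // => /maximal_val_ge1 h.
have [nz vp] := vK_p S p_prime.
have hp : val_ge vL (-1) p%:R^-1 by rewrite /val_ge (valV vLP) // vp lexx orbT.
by have := val_geM vLP h hp; rewrite subrr.
Qed.

Lemma inK_mx2 (a b c e : L) : v_integral vL a -> v_integral vL b -> v_integral vL c ->
  v_integral vL e -> \det (mx2 a b c e) = 1 \/ \det (mx2 a b c e) = -1 -> inK (mx2 a b c e).
Proof.
move=> ha hb hc he hd; apply/inKP; split.
- by move=> i j; rewrite mxE; case: ifP => _; case: ifP.
- by case: hd => ->; rewrite ?oppr_eq0 oner_neq0.
- by case: hd => ->; rewrite ?(val1 vLP) ?(valN1 vLP).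
Qed.

Let int0 : v_integral vL 0 := val_ge0 vL 0.
Let int1 : v_integral vL 1 := integral1 vLP.

Definition weyl : 'M[L]_2 := mx2 0 1 1 0.

Lemma weyl_K : inK weyl.
Proof.
apply: inK_mx2 => //; right; rewrite det2 !mxE /=.
by rewrite mul0r mul1r sub0r.
Qed.

Lemma OKv_weyl v : V w v -> OKv v -> OKv (actk m weyl v).
Proof.
have pn := p_neq0 S p_prime.
(* The Weyl element acts on the projective line by a -> 1/a, exchanging 0 and infinity. *)
pose sg (B : option F) : option F :=
  if B is Some a then (if a == 0 then None else Some a^-1) else Some 0.
pose kB (B : option F) : 'M[L]_2 :=
  if B is Some a then
    if a == 0 then weyl
    else mx2 (- teich a^-1) ((1 - teich a^-1 * teich a) / p%:R) p%:R (teich a)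
  else weyl.
have redw : redmx weyl = mk2 0 1 1 0.
  by rewrite redmx_mx2 (red0 redKP) (red1 redKP).
(* The upper right entry stays unevaluated: it meets the zero second row of [Nm (Some a)] in the
   product and the zero lower left entry in the determinant. *)
have redk a : a != 0 -> redmx (mx2 (- teich a^-1) ((1 - teich a^-1 * teich a) / p%:R) p%:R (teich a))
    = mk2 (- a^-1) (redK ((1 - teich a^-1 * teich a) / p%:R)) 0 a.
  move=> na; rewrite redmx_mx2 redK_p; have [h1 h2] := teich_red a.
  by have [h3 h4] := teich_red a^-1; rewrite (redN vLP redKP) // h2 h4.
apply: (@OKv_equiv weyl sg kB v weyl_K).
- apply: (can_inj (g := sg)) => [[a|]] /=; last by rewrite eqxx.
  have [->|na] := eqVneq a 0; first by [].
  by rewrite /= invr_eq0 (negPf na) invrK.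
- case=> [a|] /=; last first.
    by rewrite /Amx teich0; exact: weyl_rel1.
  case: eqVneq => [->|na] /=; first by rewrite /Amx teich0; exact: weyl_rel0.
  exact: weyl_rel.
- case=> [a|] /=; last exact: weyl_K.
  case: eqVneq => [_|na]; first exact: weyl_K.
  have [h1 h2] := teich_red a; have [h3 h4] := teich_red a^-1.
  have i1 : v_integral vL (1 - teich a^-1 * teich a).
    by apply: (val_geB vLP) => //; exact: (integralM vLP).
  apply: inK_mx2 => //.
  + exact: (val_geN vLP).
  + apply: div_p_integral => //; rewrite (redB vLP redKP) //; last exact: (integralM vLP).
    by rewrite (redM redKP) // h2 h4 (red1 redKP) mulVf // subrr.
  + exact: (integral_nat vLP).
  + by right; exact: weyl_det.
- case=> [a|] /=; rewrite redw; last first.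
    by rewrite oppr0 !mk2_mul; congr mk2; ring.
  case: eqVneq => [->|na]; first by rewrite redw oppr0 !mk2_mul; congr mk2; ring.
  by rewrite redk // !mk2_mul; congr mk2; field.
- case=> [a|] //=; case: eqVneq => [//|na].
  by rewrite redw redk // !det_mk2; field.
Qed.

Lemma OKv_upper b v : V w v -> OKv v -> OKv (actk m (uni b) v).
Proof.
have pn := p_neq0 S p_prime.
(* Upper unipotents act on the projective line by translation and fix infinity. *)
pose sg (B : option F) : option F := omap (fun a => a + b) B.
pose kB (B : option F) : 'M[L]_2 :=
  if B is Some a then mx2 1 ((teich a + teich b - teich (a + b)) / p%:R) 0 1
  else mx2 1 (teich b * p%:R) 0 1.
have [hb hb'] := teich_red b.
have redu : redmx (uni b) = mk2 1 b 0 1.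
  by rewrite redmx_mx2 (red0 redKP) (red1 redKP) hb'.
apply: (@OKv_equiv (uni b) sg kB v (uni_inK b)).
- by case=> [a|] [a'|] //= [] /addIr ->.
- by case=> [a|] /=; [exact: upper_rel | exact: upper_rel1].
- case=> [a|] /=; apply: inK_mx2 => //; try by left; rewrite det2 !mxE /= mulr1 mulr0 subr0.
    have [h1 h2] := teich_red a; have [h3 h4] := teich_red (a + b).
    have i1 : v_integral vL (teich a + teich b) by exact: (val_geD vLP).
    apply: div_p_integral; first exact: (val_geB vLP).
    by rewrite (redB vLP redKP) // (redD redKP) // h2 h4 hb' subrr.
  by apply: (integralM vLP) => //; exact: (integral_nat vLP).
- case=> [a|] /=; rewrite redu redmx_mx2 (red0 redKP) (red1 redKP).
    by rewrite !mk2_mul; congr mk2; ring.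
  rewrite (redM redKP) //; last exact: (integral_nat vLP).
  by rewrite redK_p !mk2_mul; congr mk2; ring.
- by case=> [a|] /=; rewrite redu redmx_mx2 (red0 redKP) (red1 redKP) !det_mk2; ring.
Qed.

Lemma OKv_of_W v : (forall B, W (phi (actN B v))) -> OKv v.
Proof.
move=> h g hg; apply: Fok_W; apply: indW_sum => B; apply: el_W => //.
exact: Bm_G.
Qed.

Lemma OKv0 : OKv 0.
Proof.
apply: OKv_of_W => B; rewrite (_ : actN B 0 = 0); first exact: phi0.
by rewrite /actN /act /subst comp_mpoly0.
Qed.

Lemma OKv_Z a v : V w v -> OKv v -> OKv (a *: v).
Proof.
by move=> hv ov; rewrite -[a *: v]addr0; exact: (OKv_lin a hv (@V0 f K w) ov OKv0).
Qed.

Lemma OKv_sum (I : eqType) (t : seq I) (G : I -> Pk) :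
  (forall i, i \in t -> V w (G i) /\ OKv (G i)) -> OKv (\sum_(i <- t) G i).
Proof.
elim: t => [|i t IH] h; first by rewrite big_nil; exact: OKv0.
rewrite big_cons -[G i]scale1r; have [h1 h2] := h i (mem_head _ _).
have h' j : j \in t -> V w (G j) /\ OKv (G j) by move=> hj; apply: h; rewrite inE hj orbT.
apply: (OKv_lin 1 h1 _ h2 (IH h')).
by apply: V_sum => j /h' [].
Qed.

Local Notation XW := (mono wv 0%MM).
Local Notation YW := (mono 0%MM wv).

Lemma VX_w : V w XW. Proof. by apply: Vw_mono; rewrite addm0. Qed.
Lemma VY_w : V w YW. Proof. by apply: Vw_mono; rewrite add0m. Qed.

Lemma actGamma_upperX m' c : actGamma m' (upper c) XW = XW.
Proof.
rewrite actGamma_act det_mk2 mulr0 subr0 mulr1 (io1X C) scale1r /act subst_mono.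
rewrite [X in _ * X]big1 ?mulr1 => [|i _]; last by rewrite mnm0E.
rewrite mono0r; apply: eq_bigr => i _; rewrite !mxE /=.
by rewrite (io1X C) (io0X C p_prime) scale1r scale0r addr0.
Qed.

Lemma phiX_upper c : W (actGamma 0 (upper c) (phi XW) - phi XW).
Proof.
case: phi_wm => _ _ h; have := h (upper c) XW (upper_unit c) VX_w.
by rewrite actGamma_upperX; exact: W_sym.
Qed.

(** A one-dimensional weight would give a vector of the cosocle fixed by upper and lower unipotents,
    against [top_inv2]. It is treated apart because the substitution at [alpha] does not kill X^0,
    so the argument of [OKv_X] fails for it. *)
Lemma weight0_W v : wv = 0%MM -> V w v -> W (phi v).
Proof.
move=> w0 hv.
have e : v = v@_(mjoin 0%MM 0%MM) *: XW.
  apply/mpolyP => n; rewrite mcoeffZ /mono mcoeffX w0.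
  case: eqVneq => [<-|ne]; rewrite ?mulr1 // mulr0; apply: memN_msupp_eq0.
  apply: contra ne => hn; have /V_fun/VP/(_ n hn) := hv; rewrite w0 => /eqP.
  by rewrite mnmD_eq0 => /andP [/eqP e1 /eqP e2]; rewrite -(mjoinK n) e1 e2.
have low m' c : actGamma m' (lower c) XW = XW.
  rewrite actGamma_act det_mk2 mul0r subr0 mulr1 (io1X C) scale1r /act subst_mono w0.
  by rewrite monoE; congr (_ * _); apply: eq_bigr => i _; rewrite mnm0E !expr0.
have hX : W (phi XW).
  apply: (top_inv2 p_prime f_gt0 r_gt r_neq0); first exact: (phi_Vr VX_w).
    exact: phiX_upper.
  move=> c; case: phi_wm => _ _ h; have := h (lower c) XW (lower_unit c) VX_w.
  by rewrite low; exact: W_sym.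
by rewrite e; have := WD (phiZ v@_(mjoin 0%MM 0%MM) VX_w) (WZ v@_(mjoin 0%MM 0%MM) hX); rewrite subrK.
Qed.

(** The substitutions at the [Amx a] fix X^w and the one at [alpha] kills it. As X^w is fixed by
    upper unipotents, [phi] sends it to a multiple of [Mtop] modulo [W], and [Fok_layer] applies. *)
Lemma OKv_X : wv != 0%MM -> OKv XW.
Proof.
move=> nw g hg.
have nS a : actN (Some a) XW = XW.
  rewrite /actN /act subst_mono [X in _ * X]big1 ?mulr1 => [|i _]; last by rewrite mnm0E.
  rewrite mono0r; apply: eq_bigr => i _; rewrite !mxE /=.
  by rewrite (io1X C) (io0X C p_prime) scale1r scale0r addr0.
have nN : actN None XW = 0.
  have [i hi] : exists i, wv i != 0%N.
    apply/existsP; apply: contraNT nw; rewrite negb_exists => /forallP h.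
    by apply/eqP/mnmP => i; have := h i; rewrite negbK mnm0E => /eqP.
  rewrite /actN /act subst_mono (bigD1 i) //= !mxE /= (io0X C p_prime) !scale0r addr0.
  by rewrite expr0n (negPf hi) !mul0r.
apply: (@Fok_ext (fun g' => \sum_(a : F) el (g *m Amx a) (phi XW) g' + el (g *m alpha S) (phi 0) g')).
  move=> g'; have := sum_option (fun B => el (g *m Bm B) (phi (actN B XW)) g').
  rewrite nN -/(Zel g XW g') => ->; apply: (congr1 (+%R^~ _)).
  by apply: eq_bigr => a _; rewrite nS.
apply: Fok_D; last by apply: Fok_W; apply: el_W; [exact: alpha_G | exact: phi0].
have [[c hc]|all] := top_inv p_prime f_gt0 r_gt r_neq0 (phi_Vr VX_w) phiX_upper.
  apply: (Fok_mod (Fok_Z c (Fok_layer hg))).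
  rewrite (_ : (fun _ => _) = fun g' => \sum_(a : F) el (g *m Amx a) (phi XW - c *: Mtop) g').
    by apply: indW_sum => a; apply: el_W => //; exact: Amx_G.
  apply: functional_extensionality => g'; rewrite scaler_sumr -sumrB; apply: eq_bigr => a _.
  by rewrite el_B el_Z.
apply: Fok_W; apply: indW_sum => a; apply: el_W; first exact: Amx_G.
by apply: all; exact: (phi_Vr VX_w).
Qed.

Lemma OKv_Y : wv != 0%MM -> OKv YW.
Proof.
move=> nw; have := OKv_weyl VX_w (OKv_X nw).
have redw : redmx weyl = mk2 0 1 1 0 by rewrite redmx_mx2 (red0 redKP) (red1 redKP).
have -> : actk m weyl XW = io (-1) ^+ m *: YW.
  rewrite /actk redw actGamma_act det_mk2 mulr0 mul1r sub0r; congr (_ *: _).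
  rewrite /act subst_mono [X in _ * X]big1 ?mulr1 => [|i _]; last by rewrite mnm0E.
  rewrite mono0l; apply: eq_bigr => i _; rewrite !mxE /=.
  by rewrite (io1X C) (io0X C p_prime) scale1r scale0r add0r.
have nz : io (-1) ^+ m != 0 by rewrite expf_neq0 // fmorph_eq0 oppr_eq0 oner_neq0.
move=> h; have e : YW = (io (-1) ^+ m)^-1 *: (io (-1) ^+ m *: YW).
  by rewrite scalerA (mulVf nz) scale1r.
rewrite e; exact: (OKv_Z _ (VZ VY_w) h).
Qed.

(** Since w_i < p, averages of upper unipotent translates of Y^w isolate each monomial with a
    coefficient prime to p. Equivariance is thus needed only for [weyl] and the [uni b]. *)
Lemma OKv_all v : V w v -> OKv v.
Proof.
move=> hv; have [w0|nw] := eqVneq wv 0%MM.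
  by apply: OKv_of_W => B; apply: weight0_W => //; exact: V_actN.
have dw : is_digits p wv by apply/forallP => i; rewrite mnmE.
have hY := OKv_Y nw.
have hU c : OKv (actGamma 0 (upper c) YW).
  have [_ hc] := teich_red c.
  suff e : actk m (uni c) YW = actGamma 0 (upper c) YW by rewrite -e; exact: (OKv_upper c VY_w hY).
  rewrite /actk redmx_mx2 (red0 redKP) (red1 redKP) hc !actGamma_act.
  by rewrite det_mk2 mulr0 subr0 mulr1 !(io1X C).
rewrite (pol_mono v); apply: OKv_sum => n hn.
have /V_fun/VP/(_ n hn) e := hv.
have Vn : V w (mono (expX n) (expY n)) by apply: Vw_mono.
split; first exact: VZ.
apply: (OKv_Z _ Vn).
have [J0|nJ] := eqVneq (expX n) 0%MM.
  by move: e; rewrite J0 add0m => ->.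
have le : (expX n <= wv)%MM by rewrite -e lem_addr.
have dJ : is_digits p (expX n).
  apply/forallP => i; have /mnm_lepP/(_ i) := le; have /forallP/(_ i) := dw.
  by clear; lia.
have eY : (wv - expX n)%MM = expY n by rewrite -e addmC addmK.
have := avg_upper C p_prime 0%MM dw dJ nJ; rewrite add0m eY => ea.
have nb := bin_neq0 C p_prime dw le.
rewrite -[mono _ _]scale1r -(mulVf nb) -scalerA -ea.
have VU c : V w (actGamma 0 (upper c) YW) by apply: V_actGamma; exact: VY_w.
have Vavg : V w (avg (@upper p f S) (expX n) YW).
  rewrite /avg -scaleN1r; apply: VZ; apply: V_sum => c _; exact: VZ.
apply: (OKv_Z _ Vavg); rewrite /avg -scaleN1r; apply: OKv_Z.
  by apply: V_sum => c _; exact: VZ.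
by apply: OKv_sum => c _; split; [exact: (VZ (VU c)) | exact: (OKv_Z _ (VU c) (hU c))].
Qed.
End Weight.

Lemma Fok_cosoc z : T_ind_cosoc r z -> Fok z.
Proof.
elim=> [w m phi x y {}z w_lt wm ix [t [ht _ hy]] hz hzy|z1 z2 _ f1 _ f2]; last exact: Fok_D.
have f1 : Fok (fun g' => \sum_(c <- t) Zel phi c.1 c.2 g').
  by apply: Fok_sum => c hc; have [h1 h2] := ht c hc; exact: (OKv_all w_lt wm).
have izV : indk (Vr r) z.
  apply: ind_mono hz => v; have [[sub _ _ _ _] _] := Qfil_module C p_prime f_gt0 r_gt f.
  exact: sub.
apply: (Fok_mod f1); apply: indW_of.
  have := indV_D izV (indV_Z (-1) f1.1); congr indk.
  by apply: functional_extensionality => g'; rewrite scaleN1r.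
move=> g'; apply: (W_trans (hzy g')); rewrite hy.
have Vh c : c \in t -> V w (hecke_elt (actk m : 'M[L]_2 -> Pk -> Pk) io c.1 c.2 g').
  move=> hc; have [_ h2] := ht c hc; rewrite hecke_elt_sum; apply: V_sum => B _.
  by apply: V_elm; exact: V_actN.
(* The sum is compared term by term, because [phi] is additive only modulo [W]. *)
elim: t {ht hy f1} Vh (fun c (hc : c \in t) => (ht c hc).2) => [|c t IH] Vh ht'.
  by rewrite !big_nil subr0; exact: (phi0 wm).
rewrite !big_cons; apply: W_trans (phiD wm _ _) _.
- by apply: Vh; rewrite mem_head.
- by apply: V_sum => c' hc'; apply: Vh; rewrite inE hc' orbT.
rewrite opprD addrACA; apply: WD.
  by apply: (phi_hecke wm); apply: ht'; rewrite mem_head.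
by apply: IH => c' hc'; [apply: Vh | apply: ht']; rewrite inE hc' orbT.
Qed.
End Main.

Theorem theorem8p1
  (p f : nat) (p_prime : prime p) (p_gt2 : (2 < p)%N) (f_ge1 : (1 <= f)%N)
  (S : unramified p f) (C : coefficients S)
  (k r : 'I_f -> nat)
  (k_eq : forall i, k i = (r i + 2)%N)
  (r_gt : forall i, (p ^ f + p - 2 < r i)%N)
  (r_neq0 : \sum_i r i * p ^ i != 0 %[mod p ^ f - 1])
  (r_neqp : forall j : 'I_f, \sum_i r i * p ^ i != p ^ j %[mod p ^ f - 1])
  (ap : E C) (ap_neq0 : ap != 0) (ap_slope : 0 < vE ap < 1)
  (ThetaBar : lmodType (kbar C))
  (iota : ('M[Qpf S]_2 -> pol f (E C)) -> ThetaBar)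
  (ThetaBar_spec : is_theta_bar r ap iota)
  (s : ('M[Qpf S]_2 -> pol f (kbar C)) -> ThetaBar)
  (s_spec : is_natural_surjection r iota s) :
  forall z : 'M[Qpf S]_2 -> pol f (kbar C),
    T_ind_cosoc r z -> Ffil r s f.-1 (s z).
Proof.
move=> z hz.
have wtE : wt p [multinom r i | i < f] = (\sum_i r i * p ^ i)%N.
  by apply: eq_bigr => i _; rewrite mnmE.
have r0 : wt p [multinom r i | i < f] != 0 %[mod (p ^ f).-1] by rewrite wtE -subn1.
have rp (j : 'I_f) : wt p [multinom r i | i < f] != p ^ j %[mod (p ^ f).-1].
  by rewrite wtE -subn1.
case: ThetaBar_spec => hth _.
by case: (Fok_cosoc p_prime p_gt2 f_ge1 r_gt r0 rp ap_neq0 ap_slope hth s_spec hz).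
Qed.
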